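(* Let $\phi:A^M\to N^2$ be a real-analytic harmonic morphism from an open subset $A^M$ of Minkowski $4$-space $\mathbb{M}^4$ to a Riemann surface, with $d\phi$ nowhere zero. Then there is a shear-free ray congruence $\ell$ on $A^M$ such that each fibre component of $\phi$ is the union of parallel null lines of $\ell$. Further, for any $p\in A^M$, there is a neighbourhood $A^M_1$ of $p$ in $A^M$, and a holomorphic map $\rho:V\to\mathbb{C}\cup\{\infty\}$ from an open subset $V$ of $N^2$, such that $\mu=\rho\circ\phi$ represents $\ell$ on $A^M_1$.
   Context: $\mathbb{M}^4=\{(t,x_1,x_2,x_3)\}$ with metric $-dt^2+dx_1^2+dx_2^2+dx_3^2$ and Levi-Civita connection $\nabla$. A smooth map $\phi$ to a Riemann surface is a harmonic morphism if, in any local complex coordinate of the target, $-\phi_{tt}+\sum_{i=1}^3\phi_{x_ix_i}=0$ and $-\phi_t^2+\sum_{i=1}^3\phi_{x_i}^2=0$ (equivalently, it pulls back local harmonic functions to harmonic functions). A fibre component is a connected component of a fibre. A shear-free ray congruence is a smooth foliation $\ell$ by (open pieces of) affine null lines, called the null lines of $\ell$, with tangent field $w=\partial/\partial t+U$, $U$ unit and tangent to the slices $t=$ const, such that, with $W=\mathrm{span}\{w\}$, $\Sigma$ the space of vectors tangent to the slices $t=$ const and orthogonal to $U$ (oriented by $U$ and the orientation of $\mathbb{R}^3$), $J^\perp$ rotation through $+\pi/2$ on $\Sigma$, and $\{\ \}^\Sigma$ projection $W^\perp\to\Sigma$ along $W$, one has $\{\nabla_{J^\perp X}w\}^\Sigma=J^\perp\{\nabla_Xw\}^\Sigma$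 for all $X\in\Sigma$. A function $\mu$ with values in $\mathbb{C}\cup\{\infty\}$ represents $\ell$ if $U=\sigma^{-1}(i\mu)$, where $\sigma^{-1}(u)=\frac{1}{1+|u|^2}(1-|u|^2,2\,\mathrm{Re}\,u,2\,\mathrm{Im}\,u)$ and $\sigma^{-1}(\infty)=(-1,0,0)$.
   Formalization: The map ρ is shown to be holomorphic only up to the orientation of N²: on each connected component of A^M it is either holomorphic throughout or antiholomorphic throughout, since with fixed orientations the claim that ρ is always holomorphic is false. *)

(* Defs.v *)
From HB Require Import structures.
From mathcomp Require Import all_boot all_order all_algebra.
From mathcomp Require Import all_classical all_reals all_analysis.
From mathcomp Require Import complex.

Set Implicit Arguments.
Unset Strict Implicit.
Unset Printing Implicit Defensive.

Import Order.TTheory GRing.Theory Num.Theory.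
Import numFieldNormedType.Exports.

Local Open Scope classical_set_scope.
Local Open Scope ring_scope.

(* The complex numbers, packaged as a numClosedFieldType so that the norm
   topology and [derivable] (here: complex differentiability) apply. *)
Definition Cx (R : realType) : numClosedFieldType := R[i].

(* Minkowski space: coordinate 0 is t and coordinate [lift 0 j] is x_(j+1).
   The topology is that of R^4. *)
Definition M4 (R : realType) := 'rV[R]_4.

Section Calculus.
Variable R : realType.

Definition basis4 (i : 'I_4) : M4 R := delta_mx 0 i.

Fixpoint Ck (W : normedModType R) (k : nat) (O : set (M4 R)) (f : M4 R -> W)
    : Prop :=
  (forall p, O p -> {for p, continuous f}) /\
  (if k is k'.+1 then
     forall i, (forall p, O p -> derivable f p (basis4 i)) /\
               Ck k' O (fun p => 'D_(basis4 i) f p)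
   else True).

Definition smooth_on (W : normedModType R) (O : set (M4 R)) (f : M4 R -> W) :=
  forall k, Ck k O f.

Definition monomial (x : M4 R) (a : {ffun 'I_4 -> nat}) : R :=
  \prod_(i < 4) x 0 i ^+ a i.

(* Partial sum of the power series with coefficients c over the multi-indices
   all of whose entries are < n. *)
Definition psum (c : {ffun 'I_4 -> nat} -> R) (x : M4 R) (n : nat) : R :=
  \sum_(a : {ffun 'I_4 -> 'I_n})
     let b := [ffun i => nat_of_ord (a i)] in c b * monomial x b.

Definition psum_abs (c : {ffun 'I_4 -> nat} -> R) (x : M4 R) (n : nat) : R :=
  \sum_(a : {ffun 'I_4 -> 'I_n})
     let b := [ffun i => nat_of_ord (a i)] in `|c b * monomial x b|.

(* Near p, f is the sum of an absolutely convergent power series. *)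
Definition real_analytic_at (f : M4 R -> R) (p : M4 R) : Prop :=
  exists (r : R) (c : {ffun 'I_4 -> nat} -> R), 0 < r /\
    forall x, `|x - p| < r ->
      cvg (psum_abs c (x - p) @ \oo) /\ psum c (x - p) @ \oo --> f x.

Definition re_part (f : M4 R -> Cx R) : M4 R -> R := fun p => complex.Re (f p).
Definition im_part (f : M4 R -> Cx R) : M4 R -> R := fun p => complex.Im (f p).

(* Partial derivative of a complex-valued function of the real variables
   t, x_1, x_2, x_3. *)
Definition cpartial (i : 'I_4) (f : M4 R -> Cx R) : M4 R -> Cx R :=
  fun p => Complex ('D_(basis4 i) (re_part f) p) ('D_(basis4 i) (im_part f) p).

End Calculus.

Section Charts.
Variables (R : realType) (T : topologicalType).

(* A coordinate function together with its domain; its values outside the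
   domain are irrelevant. *)
Record chart := Chart { chart_dom : set T; chart_map : T -> Cx R }.

(* A homeomorphism from the open set [chart_dom c] onto an open subset of C. *)
Definition is_chart (c : chart) : Prop :=
  [/\ open (chart_dom c),
      {in chart_dom c &, injective (chart_map c)} &
      forall O, O `<=` chart_dom c -> (open O <-> open (chart_map c @` O))].

Definition holomorphic_on (O : set (Cx R)) (h : Cx R -> Cx R) : Prop :=
  open O /\ forall z, O z -> derivable h z 1.

(* The transition function from c to d is holomorphic; it is the h below. *)
Definition compatible (c d : chart) : Prop :=
  exists h, holomorphic_on (chart_map c @` (chart_dom c `&` chart_dom d)) h /\
    forall x, chart_dom c x -> chart_dom d x -> chart_map d x = h (chart_map c x).

End Charts.

(* The atlas is required to be maximal, so that its elements are all the local
   complex coordinates of the surface. *)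
Record riemann_surface (R : realType) := RiemannSurface {
  rs_space :> topologicalType;
  rs_atlas : set (chart R rs_space);
  rs_hausdorff : hausdorff_space rs_space;
  rs_connected : connected [set: rs_space];
  rs_is_chart : forall c, rs_atlas c -> is_chart c;
  rs_cover : forall x, exists2 c, rs_atlas c & chart_dom c x;
  rs_compatible : forall c d, rs_atlas c -> rs_atlas d -> compatible c d;
  rs_maximal : forall c, is_chart c ->
    (forall d, rs_atlas d -> compatible c d /\ compatible d c) -> rs_atlas c
}.

Section Holomorphic.
Variables (R : realType) (N : riemann_surface R).

Definition holomorphic_fun (O : set N) (f : N -> Cx R) : Prop :=
  open O /\ forall c, rs_atlas c ->
    exists h, holomorphic_on (chart_map c @` (chart_dom c `&` O)) h /\
      forall x, chart_dom c x -> O x -> f x = h (chart_map c x).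

End Holomorphic.

(* C \cup {oo}, with None for oo. *)
Definition sphere (R : realType) := option (Cx R).

Definition sphere_inv (R : realType) (z : Cx R) : sphere R :=
  if z == 0 then None else Some z^-1.

(* Holomorphy into C \cup {oo}: locally, rho or 1/rho is a holomorphic
   C-valued function. *)
Definition holomorphic_to_sphere (R : realType) (N : riemann_surface R)
    (V : set N) (rho : N -> sphere R) : Prop :=
  open V /\ forall x, V x -> exists O : set N, [/\ open O, O x, O `<=` V &
    exists f : N -> Cx R, holomorphic_fun O f /\
      ((forall y, O y -> rho y = Some (f y)) \/
       (forall y, O y -> rho y = sphere_inv (f y)))].

Definition sphere_conj (R : realType) (u : sphere R) : sphere R :=
  omap (fun z : Cx R => z^*%C) u.

(* Holomorphy with respect to N (b = false), or with respect to N with the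
   opposite orientation, i.e. with the conjugate complex structure (b = true):
   rho is holomorphic for the latter iff its conjugate is for the former.

   The choice of orientation is genuinely needed.  The harmonic morphism
   equations are invariant under z |-> z^* on the target, whereas
   mu = rho \o phi with rho holomorphic is not.  For instance, write u = t+x_1,
   v = t-x_1, z = x_2 + i x_3; the solution phi near 0, phi(0) = 0, of
     phi = z^* + phi u + (v + phi z)^2 / 2
   is a C-valued harmonic morphism whose congruence is unique and is
   represented by mu = i phi^*. *)
Definition holomorphic_oriented (R : realType) (b : bool)
    (N : riemann_surface R) (V : set N) (rho : N -> sphere R) : Prop :=
  holomorphic_to_sphere V (if b then fun y => sphere_conj (rho y) else rho).

Section HarmonicMorphism.
Variables (R : realType) (N : riemann_surface R).
Implicit Types (A : set (M4 R)) (phi : M4 R -> N).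

Definition in_coord (c : chart R N) phi : M4 R -> Cx R :=
  fun p => chart_map c (phi p).

Definition coord_dom A (c : chart R N) phi : set (M4 R) :=
  A `&` phi @^-1` chart_dom c.

Definition smooth_map A phi : Prop :=
  (forall p, A p -> {for p, continuous phi}) /\
  forall c, rs_atlas c ->
    smooth_on (coord_dom A c phi) (re_part (in_coord c phi)) /\
    smooth_on (coord_dom A c phi) (im_part (in_coord c phi)).

Definition real_analytic_map A phi : Prop :=
  (forall p, A p -> {for p, continuous phi}) /\
  forall c, rs_atlas c -> forall p, coord_dom A c phi p ->
    real_analytic_at (re_part (in_coord c phi)) p /\
    real_analytic_at (im_part (in_coord c phi)) p.

Definition wave_operator (f : M4 R -> Cx R) (p : M4 R) : Cx R :=
  - cpartial 0 (cpartial 0 f) p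
  + \sum_(j < 3) cpartial (lift 0 j) (cpartial (lift 0 j) f) p.

Definition grad_square (f : M4 R -> Cx R) (p : M4 R) : Cx R :=
  - cpartial 0 f p ^+ 2 + \sum_(j < 3) cpartial (lift 0 j) f p ^+ 2.

Definition harmonic_morphism A phi : Prop :=
  smooth_map A phi /\
  forall c, rs_atlas c -> forall p, coord_dom A c phi p ->
    wave_operator (in_coord c phi) p = 0 /\ grad_square (in_coord c phi) p = 0.

Definition differential_zero_at phi (p : M4 R) : Prop :=
  forall c, rs_atlas c -> chart_dom c (phi p) ->
    forall i, cpartial i (in_coord c phi) p = 0.

Definition fibre_component A phi (F : set (M4 R)) : Prop :=
  exists2 p, A p & F = connected_component (A `&` phi @^-1` [set phi p]) p.

End HarmonicMorphism.

Section Congruence.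
Variable R : realType.
Implicit Types (p v X : M4 R) (U : M4 R -> 'rV[R]_3).

Definition time_part v : R := v 0 0.
Definition space_part v : 'rV[R]_3 := \row_j v 0 (lift 0 j).
Definition mkM4 (t : R) (x : 'rV[R]_3) : M4 R :=
  \row_i (if unlift 0 i is Some j then x 0 j else t).

Definition dot (x y : 'rV[R]_3) : R := \sum_j x 0 j * y 0 j.
Definition mk3 (a b c : R) : 'rV[R]_3 := \row_(j < 3) [:: a; b; c]`_j.
Definition cross (x y : 'rV[R]_3) : 'rV[R]_3 :=
  let x1 := x 0 (inord 0) in let x2 := x 0 (inord 1) in let x3 := x 0 (inord 2) in
  let y1 := y 0 (inord 0) in let y2 := y 0 (inord 1) in let y3 := y 0 (inord 2) in
  mk3 (x2 * y3 - x3 * y2) (x3 * y1 - x1 * y3) (x1 * y2 - x2 * y1).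

Definition minkowski (v v' : M4 R) : R :=
  - (time_part v * time_part v') + dot (space_part v) (space_part v').

Definition line p v : set (M4 R) := [set p + s *: v | s in [set: R]].

(* Nonempty connected open pieces of affine null lines. *)
Definition null_line_piece (l : set (M4 R)) : Prop :=
  exists p v (I : set R),
    [/\ v != 0 /\ minkowski v v = 0, open I, connected I, I !=set0 &
        l = [set p + s *: v | s in I]].

(* w = d/dt + U, with U tangent to the slices t = const. *)
Definition tangent_field U : M4 R -> M4 R := fun p => mkM4 1 (U p).

Definition in_Sigma U p X : Prop :=
  time_part X = 0 /\ dot (space_part X) (U p) = 0.

(* Rotation through +pi/2: for X in Sigma, (U, X, U x X) is positively
   oriented. *)
Definition Jperp U p X : M4 R := mkM4 0 (cross (U p) (space_part X)).

(* The projection W^perp -> Sigma along W = span w: for v in W^perp, the vector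
   v - time_part v *: w p has time component 0 and is orthogonal to w p. *)
Definition proj_Sigma U p v : M4 R := v - time_part v *: tangent_field U p.

(* The Levi-Civita connection of the (flat) Minkowski metric is the ordinary
   directional derivative. *)
Definition nabla X (w : M4 R -> M4 R) p : M4 R := 'D_X w p.

Definition shear_free (A : set (M4 R)) U : Prop :=
  forall p, A p -> forall X, in_Sigma U p X ->
    proj_Sigma U p (nabla (Jperp U p X) (tangent_field U) p) =
    Jperp U p (proj_Sigma U p (nabla X (tangent_field U) p)).

(* A smooth foliation of A by pieces of null lines: the leaves partition A and
   have a smooth tangent field. *)
Record shear_free_ray_congruence (A : set (M4 R)) := ShearFreeRayCongruence {
  src_leaf : set (set (M4 R));
  src_field : M4 R -> 'rV[R]_3;
  src_null : forall l, src_leaf l -> null_line_piece l;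
  src_sub : forall l, src_leaf l -> l `<=` A;
  src_partition : forall p, A p -> exists! l, src_leaf l /\ l p;
  src_tangent : forall l p, src_leaf l -> l p ->
    l `<=` line p (tangent_field src_field p);
  src_smooth : smooth_on A src_field;
  src_unit : forall p, A p -> dot (src_field p) (src_field p) = 1;
  src_shear_free : shear_free A src_field
}.

(* All the members of S, which are pieces of lines, have the same direction. *)
Definition parallel (S : set (set (M4 R))) : Prop :=
  exists2 v : M4 R, v != 0 &
    forall l, S l -> forall p, l p -> l `<=` line p v.

(* Inverse of the stereographic projection from (-1, 0, 0). *)
Definition sigma_inv (u : sphere R) : 'rV[R]_3 :=
  match u with
  | Some z =>
      let a := complex.Re z in let b := complex.Im z in
      let n := a ^+ 2 + b ^+ 2 in
      (1 + n)^-1 *: mk3 (1 - n) (2 * a) (2 * b)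
  | None => mk3 (-1) 0 0
  end.

(* Here i oo = oo. *)
Definition represents (A : set (M4 R)) (l : shear_free_ray_congruence A)
    (B : set (M4 R)) (mu : M4 R -> sphere R) : Prop :=
  forall p, B p -> src_field l p = sigma_inv (omap (fun z : Cx R => 'i * z) (mu p)).

End Congruence.

(* Main.v *)
(* Let f be phi in a local coordinate. Differentiating the two equations shows
   that the Hessian H of f kills the gradient and that tr H = tr H^2 = 0, indices
   being raised by the metric. The null gradient annihilates two totally null
   complex planes, one of each duality, and by linear algebra the first
   derivatives of one of them are proportional to df. By analyticity the same
   plane works near each point, hence on each component of A^M.

   Such a plane contains a unique real null direction w = d/dt + U, and its
   position v in the projective line satisfies dv = a_1 df. Then da_k = a_(k+1) df
   with a_(k+1) the quotient of any two corresponding partial derivatives, and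
   factorial bounds for these coefficients make v the sum of a power series in
   f: v = rho o f with rho holomorphic. U is the stereographic image of v or of
   its conjugate, according to the duality; being conformal in f, it is
   shear-free.

   Since df(w) = 0 at each point and U is a Lipschitz function of f, a Gronwall
   argument shows f to be constant along the null line with direction w_p through
   p. So U is constant along its null lines and along the fibre components, which
   are therefore unions of parallel null lines. *)
Require Import Defs.
From HB Require Import structures.
From mathcomp Require Import all_boot all_order all_algebra.
From mathcomp Require Import all_classical all_reals all_analysis.
From mathcomp Require Import complex.
From mathcomp Require Import zify ring lra.

Set Implicit Arguments.
Unset Strict Implicit.
Unset Printing Implicit Defensive.

Import Order.TTheory GRing.Theory Num.Theory.
Import numFieldNormedType.Exports.

Local Open Scope classical_set_scope.
Local Open Scope ring_scope.

(** Real analyticity enters only through factorial bounds on iterated derivatives. They are proved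
    for iterated difference quotients of the partial sums, where they are uniform, and survive
    pointwise limits, so no series is differentiated term by term. The obstacle is the infinite
    sequence a_(k+1) = d_e a_k / d_e f: a crude product rule would enlarge the geometric ratio at
    each k and destroy convergence. The bounds therefore carry a pole order s besides the ratio K,
    imitating c (1 - K x)^-(s+1): a derivative raises s by one, the product with 1 / d_e f by one
    more, and K never changes. The Taylor sum of v in the value of f, with moving centre, has a
    derivative that telescopes to one term; this yields convergence to v. The same telescoping with
    a coordinate in place of f yields the identity theorem. The null direction is treated in two
    affine charts of the projective line, related by u -> 1/u, which is a half-turn of the
    sphere. *)

(** * Closure properties of C^k functions and the mean value theorem along a line *)

Section RealCalculus.
Variable R : realType.
Local Notation V := (M4 R).
Local Notation e_ := (@basis4 R).
Implicit Types (f g : V -> R) (O : set V) (i j : 'I_4) (k : nat).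

Lemma open_nearP O (P : V -> Prop) p :
  open O -> O p -> (forall q, O q -> P q) -> \near p, P p.
Proof. by move=> oO Op h; apply: filterS h _; exact: open_nbhs_nbhs. Qed.

Lemma for_continuous_ext (W : normedModType R) (f g : V -> W) p : (\near p, f p = g p) ->
  {for p, continuous f} -> {for p, continuous g}.
Proof.
move=> e cf; rewrite /prop_for /continuous_at -(nbhs_singleton e).
exact: cvg_trans (near_eq_cvg e) cf.
Qed.

Lemma Ck_ext (W : normedModType R) O k (f g : V -> W) : open O -> (forall p, O p -> f p = g p) ->
  Ck k O f -> Ck k O g.
Proof.
move=> oO; elim: k f g => [|k IH] f g fg [cf df].
  split=> // p Op; have e := open_nearP oO Op fg.
  exact: for_continuous_ext e (cf p Op).
split=> [p Op|i].
  have e := open_nearP oO Op fg.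
  exact: for_continuous_ext e (cf p Op).
have [di ci] := df i; split=> [p Op|].
  by apply: near_eq_derivable (di p Op); exact: open_nearP oO Op fg.
apply: IH ci => p Op; apply: near_eq_derive; exact: open_nearP oO Op fg.
Qed.

Lemma Ck_pred O k f : Ck k.+1 O f -> Ck k O f.
Proof.
elim: k f => [|k IH] f [cf df]; first by split.
by split=> // i; have [? ?] := df i; split=> //; exact: IH.
Qed.

Lemma Ck_sub O O' k f : O' `<=` O -> Ck k O f -> Ck k O' f.
Proof.
move=> s; elim: k f => [|k IH] f [cf df]; first by split=> // p /s; exact: cf.
split=> [p /s|i]; first exact: cf.
by have [d1 d2] := df i; split=> [p /s|]; [exact: d1|exact: IH].
Qed.

Lemma Ck_cst O k (c : R) : Ck k O (fun _ : V => c).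
Proof.
elim: k c => [|k IH] c; first by split=> // p _; exact: cst_continuous.
split=> [p _|i]; first exact: cst_continuous.
split=> [p _|]; first exact: derivable_cst.
rewrite (_ : (fun p : V => 'D_(e_ i) (fun=> c) p) = fun=> 0) //.
by apply/funext => p; exact: derive_cst.
Qed.

Lemma CkD O k f g : open O -> Ck k O f -> Ck k O g ->
  Ck k O (fun p => f p + g p).
Proof.
move=> oO; elim: k f g => [|k IH] f g [cf df] [cg dg].
  by split=> // p Op; apply: continuousD; [exact: cf|exact: cg].
split=> [p Op|i]; first by apply: continuousD; [exact: cf|exact: cg].
have [df1 df2] := df i; have [dg1 dg2] := dg i; split=> [p Op|].
  by apply: derivableD; [exact: df1|exact: dg1].
apply: Ck_ext oO _ (IH _ _ df2 dg2) => p Op /=.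
by rewrite -[LHS]deriveD//; [exact: df1|exact: dg1].
Qed.

Lemma CkN O k f : open O -> Ck k O f -> Ck k O (fun p => - f p).
Proof.
move=> oO; elim: k f => [|k IH] f [cf df].
  by split=> // p Op; apply: continuousN; exact: cf.
split=> [p Op|i]; first by apply: continuousN; exact: cf.
have [df1 df2] := df i; split=> [p Op|].
  by apply: derivableN; exact: df1.
apply: Ck_ext oO _ (IH _ df2) => p Op /=.
by rewrite -[LHS]deriveN//; exact: df1.
Qed.

Lemma CkM O k f g : open O -> Ck k O f -> Ck k O g ->
  Ck k O (fun p => f p * g p).
Proof.
move=> oO; elim: k f g => [|k IH] f g.
  by move=> [cf _] [cg _]; split=> // p Op; apply: continuousM; [exact: cf|exact: cg].
move=> kf kg; have kf' := Ck_pred kf; have kg' := Ck_pred kg.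
move: kf kg => [cf df] [cg dg].
split=> [p Op|i]; first by apply: continuousM; [exact: cf|exact: cg].
have [df1 df2] := df i; have [dg1 dg2] := dg i; split=> [p Op|].
  by apply: derivableM; [exact: df1|exact: dg1].
apply: Ck_ext oO _ (CkD oO (IH _ _ kf' dg2) (IH _ _ kg' df2)) => p Op /=.
by rewrite [RHS](deriveM (df1 _ Op) (dg1 _ Op)).
Qed.

Lemma CkV O k f : open O -> (forall p, O p -> f p != 0) -> Ck k O f ->
  Ck k O (fun p => (f p)^-1).
Proof.
move=> oO f0; elim: k => [|k IH].
  by move=> [cf _]; split=> // p Op; apply: continuousV; [exact: f0|exact: cf].
move=> kf; have kv := IH (Ck_pred kf); move: kf => [cf df].
split=> [p Op|i]; first by apply: continuousV; [exact: f0|exact: cf].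
have [df1 df2] := df i; split=> [p Op|].
  by apply: derivableV; [exact: f0|exact: df1].
apply: Ck_ext oO _ (CkN oO (CkM oO (CkM oO kv kv) df2)) => p Op /=.
rewrite [RHS](deriveV (f0 _ Op) (df1 _ Op)).
by rewrite -exprVn expr2 /GRing.scale /= mulNr.
Qed.

Lemma line_is_derive f (q v : V) (s : R) : derivable f (q + s *: v) v ->
  is_derive s 1 (fun t : R => f (q + t *: v)) ('D_v f (q + s *: v)).
Proof.
move=> d; pose g1 (h : R) := h^-1 *: (f (h *: v + (q + s *: v)) - f (q + s *: v)).
have E : (fun h : R => h^-1 *: (((fun t : R => f (q + t *: v)) \o shift s) (h *: 1)
         - f (q + s *: v))) = g1.
  apply/funext => h /=; rewrite /g1; congr (_ *: (f _ - _)).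
  by rewrite [h *: 1]mulr1 scalerDl addrCA.
by apply: DeriveDef; rewrite /derivable /derive /= E.
Qed.

Lemma line_mvt f (q v : V) (h : R) :
  (forall t : R, `|t| <= `|h| -> derivable f (q + t *: v) v) ->
  exists2 t : R, `|t| <= `|h| & f (q + h *: v) - f q = h * 'D_v f (q + t *: v).
Proof.
move=> d; pose g t := f (q + t *: v).
have D (t : R) : `|t| <= `|h| -> is_derive t 1 g ('D_v f (q + t *: v)).
  by move=> /d; exact: line_is_derive.
have g0 : g 0 = f q by rewrite /g scale0r addr0.
have C (a b : R) : (forall t, t \in `[a, b] -> `|t| <= `|h|) ->
    {within `[a, b], continuous g}.
  move=> sub; apply: derivable_within_continuous => t tab.
  by have [] := D t (sub _ tab).
have [h0|h0] := leP 0 h.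
  have sub t : t \in `[0, h] -> `|t| <= `|h|.
    by rewrite in_itv /= => /andP[t0 th]; rewrite !ger0_norm.
  have [|t th E] := MVT_segment h0 _ (C _ _ sub) (df := fun t => 'D_v f (q + t *: v)).
    by move=> t th; apply: D; apply: sub; exact: subset_itv_oo_cc th.
  exists t; first exact: sub.
  by rewrite -/(g h) -g0 E subr0 mulrC.
have sub t : t \in `[h, 0] -> `|t| <= `|h|.
  rewrite in_itv /= => /andP[th t0]; rewrite !ler0_norm ?lerN2//; exact: ltW.
have [|t th E] := MVT_segment (ltW h0) _ (C _ _ sub) (df := fun t => 'D_v f (q + t *: v)).
  by move=> t th; apply: D; apply: sub; exact: subset_itv_oo_cc th.
exists t; first exact: sub.
by rewrite -/(g h) -g0 -opprB E sub0r mulrN opprK mulrC.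
Qed.

Lemma rv_norm_lt (x : V) (r : R) : 0 < r ->
  (`|x| < r) <-> (forall i, `|x 0 i| < r).
Proof.
move=> r0; rewrite [`|x|]mx_normrE; split=> [h i|h].
  by apply: le_lt_trans h; exact: (le_bigmax _ (fun ij : 'I_1 * 'I_4 => `|x ij.1 ij.2|) (0, i)).
by apply/bigmax_ltP; split=> // -[a b] _ /=; rewrite (ord1 a).
Qed.

Lemma rv_coord_le (x : V) i : `|x 0 i| <= `|x|.
Proof.
rewrite [`|x|]mx_normrE.
exact: (le_bigmax _ (fun ij : 'I_1 * 'I_4 => `|x ij.1 ij.2|) (0, i)).
Qed.

Lemma basis4E i j : e_ i 0 j = (i == j)%:R.
Proof. by rewrite mxE eqxx /= eq_sym. Qed.

End RealCalculus.

(** * Directional derivatives of C^1 functions and symmetry of second derivatives *)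

Section MultivariableCalculus.
Variable R : realType.
Local Notation V := (M4 R).
Local Notation e_ := (@basis4 R).
Implicit Types (f g : V -> R) (O : set V) (i j k l : 'I_4).

(** The path from [x] to [y] changes one coordinate at a time. The norm is the sup norm, so the ball
    is a cube and contains the whole path; the price is a different intermediate point for each
    coordinate. *)
Lemma axis_mvt f (c x y : V) (r : R) :
  `|x - c| < r -> `|y - c| < r ->
  (forall z, `|z - c| < r -> forall i, derivable f z (e_ i)) ->
  exists xi : 'I_4 -> V, (forall i, `|xi i - c| < r) /\
    f y - f x = \sum_i (y 0 i - x 0 i) * 'D_(e_ i) f (xi i).
Proof.
move=> xc yc d.
have r0 : 0 < r by exact: le_lt_trans (normr_ge0 _) xc.
pose P (n : nat) : V := \row_i (if (i < n)%N then y 0 i else x 0 i).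
have /all_sig[xi xiP] (i : 'I_4) : {xi : V | `|xi - c| < r /\
    f (P i.+1) - f (P i) = (y 0 i - x 0 i) * 'D_(e_ i) f xi}.
  apply: cid.
  have E t : P i + t *: e_ i = \row_j (if j == i then x 0 i + t else P i 0 j).
    apply/rowP => j; rewrite !mxE eqxx /=.
    by case: eqVneq => [->|_]; rewrite ?ltnn ?mulr1 ?mulr0 ?addr0.
  have PS : P i.+1 = P i + (y 0 i - x 0 i) *: e_ i.
    rewrite E; apply/rowP => j; rewrite !mxE ltnS leq_eqVlt.
    have [->|ji] := eqVneq j i; first by rewrite eqxx /= addrC subrK.
    by rewrite [X in X || _](negbTE ji).
  pose g (s : R) := f (P i + (s * (y 0 i - x 0 i)) *: e_ i).
  pose df (s : R) := (y 0 i - x 0 i) * 'D_(e_ i) f (P i + (s * (y 0 i - x 0 i)) *: e_ i).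
  have inb s : 0 <= s <= 1 -> `|P i + (s * (y 0 i - x 0 i)) *: e_ i - c| < r.
    move=> s01; apply/rv_norm_lt => // j; rewrite E !mxE.
    have /(rv_norm_lt _ r0)/(_ j) := xc; have /(rv_norm_lt _ r0)/(_ j) := yc.
    rewrite !mxE; case: eqVneq => [->|_]; last by case: ifP.
    rewrite !ltr_norml => /andP[y1 y2] /andP[x1 x2]; case/andP: s01 => s0 s1.
    set a := x 0 i in x1 x2 *; set b := y 0 i in y1 y2 *; set cc := c 0 i in x1 x2 y1 y2 *.
    have -> : a + s * (b - a) - cc = (1 - s) * (a - cc) + s * (b - cc) by ring.
    (* A convex combination of two strict bounds: strictness is drawn from the positive weight [s],
       so [s = 0] is treated apart. *)
    have [s_0|s_0] := eqVneq s 0; first by rewrite s_0 subr0 mul0r mul1r addr0 x1 x2.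
    have sp : 0 < s by rewrite lt_neqAle eq_sym s_0.
    by apply/andP; split; nra.
  have D (s : R) : 0 <= s <= 1 -> is_derive s 1 g (df s).
    move=> s01; have dv := d _ (inb _ s01) i.
    pose h (t : R) := f (P i + t *: e_ i).
    have Dh : is_derive (s * (y 0 i - x 0 i)) 1 h
       ('D_(e_ i) f (P i + (s * (y 0 i - x 0 i)) *: e_ i)) by exact: line_is_derive.
    have : is_derive s (1 : R) (h \o (fun t : R => t * (y 0 i - x 0 i)))
       ('D_(e_ i) f (P i + (s * (y 0 i - x 0 i)) *: e_ i) * (y 0 i - x 0 i)).
      apply: is_derive1_comp.
      by apply: is_derive_eq; rewrite scaler0 add0r /GRing.scale /= mulr1.
    by rewrite /df mulrC.
  have Dg : forall s : R, s \in `]0, 1[ -> is_derive s 1 g (df s).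
    by move=> s; rewrite in_itv /= => /andP[s0 s1]; apply: D; rewrite !ltW.
  have Cg : {within `[0, 1], continuous g}.
    apply: derivable_within_continuous => s; rewrite in_itv /= => s01.
    by have [] := D s s01.
  have [s sin Es] := MVT_segment ler01 Dg Cg.
  rewrite in_itv /= in sin.
  exists (P i + (s * (y 0 i - x 0 i)) *: e_ i); split; first exact: inb.
  by move: Es; rewrite /g mul1r mul0r scale0r addr0 -PS => ->; rewrite subr0 mulr1.
exists xi; split=> [i|]; first by have [] := xiP i.
rewrite -(eq_bigr _ (fun i _ => (xiP i).2)).
rewrite -(big_mkord xpredT (fun i : nat => f (P i.+1) - f (P i))) telescope_sumr//.
congr (f _ - f _); apply/rowP => i; rewrite !mxE ?ltn_ord//.
Qed.

Definition directional f (v p : V) : R := \sum_i v 0 i * 'D_(e_ i) f p.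

(** By continuity the partial derivatives at the intermediate points of [axis_mvt] are close to
    those at [p], so the difference quotient is close to their linear combination. *)
Lemma C1_is_derive O f (p v : V) : open O -> Ck 1 O f -> O p ->
  is_derive p v f (directional f v p).
Proof.
move=> oO [_ df] Op.
have [r0 /= r0p sub] : exists2 r : R, 0 < r & forall z, `|z - p| < r -> O z.
  have /nbhs_ballP[r /= rp h] : nbhs p O by exact: open_nbhs_nbhs.
  by exists r => // z zp; apply: h; rewrite -ball_normE /= distrC.
have key (eps : R) : 0 < eps -> exists2 del : R, 0 < del & forall h : R, h != 0 -> `|h| < del ->
    `|h^-1 * (f (h *: v + p) - f p) - directional f v p| <= eps.
  (* The summand 1 keeps [M] positive when [v = 0]; the errors [|v_i| eps / M] add up to at most
     [eps]. *)
  move=> e0; pose M := 1 + \sum_i `|v 0 i|.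
  have M0 : 0 < M by rewrite ltr_pwDl// sumr_ge0.
  have [r1 r10 h1] : exists2 r : R, 0 < r & forall z, `|z - p| < r ->
      forall i, `|'D_(e_ i) f z - 'D_(e_ i) f p| <= eps / M.
    have : \forall z \near p, forall i, `|'D_(e_ i) f p - 'D_(e_ i) f z| <= eps / M.
      apply: (@filter_forall _ _ _ (nbhs p)) => i; have [_ [c _]] := df i.
      have := c _ Op; rewrite /prop_for /continuous_at => /cvgrPdist_le; apply.
      by rewrite divr_gt0.
    move=> /nbhs_ballP[r /= rp h]; exists r => // z zp i.
    by rewrite distrC; apply: h; rewrite -ball_normE /= distrC.
  pose r := Num.min r0 r1.
  have rp : 0 < r by rewrite lt_min r0p r10.
  exists (r / (1 + `|v|)) => [|h h0 hd]; first by rewrite divr_gt0// ltr_pwDl.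
  have inr : `|(h *: v + p) - p| < r.
    rewrite addrK normrZ; apply: le_lt_trans (_ : `|h| * (1 + `|v|) < r).
      by rewrite ler_wpM2l// lerDr.
    by rewrite -ltr_pdivlMr// ltr_pwDl.
  have inp : `|p - p| < r by rewrite subrr normr0.
  have [z zr i|xi [xir ->]] := axis_mvt (f := f) inp inr.
    have [d _] := df i; apply: d; apply: sub; apply: lt_le_trans zr _.
    by rewrite ge_min lexx.
  rewrite mulr_sumr /directional -sumrB.
  apply: le_trans (ler_norm_sum _ _ _) _.
  apply: le_trans (_ : \sum_i `|v 0 i| * (eps / M) <= eps).
    apply: ler_sum => i _; rewrite !mxE addrK -(mulrA h) mulKf// -mulrBr normrM.
    rewrite ler_wpM2l// h1//; apply: lt_le_trans (xir i) _.
    by rewrite ge_min lexx orbT.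
  rewrite -mulr_suml mulrA ler_pdivrMr// mulrC ler_wpM2l ?(ltW e0)//.
  by rewrite /M lerDr.
have C : (fun h : R => h^-1 *: ((f \o shift p) (h *: v) - f p)) @ 0^' --> directional f v p.
  apply/cvgrPdist_le => eps e0; have [del d0 h] := key _ e0.
  near=> t; rewrite distrC; apply: h; near: t; first exact: nbhs_dnbhs_neq.
  exact: dnbhs0_lt.
by apply: DeriveDef; [apply/cvg_ex; exists (directional f v p)|exact: cvg_lim].
Unshelve. all: by end_near. Qed.

Lemma ball_sub O p : open O -> O p ->
  exists2 r : R, 0 < r & forall z : V, `|z - p| < r -> O z.
Proof.
move=> oO Op; have /nbhs_ballP[r /= rp h] : nbhs p O by exact: open_nbhs_nbhs.
by exists r => // z zp; apply: h; rewrite -ball_normE /= distrC.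
Qed.

Lemma norm_basis4 i : `|e_ i| = 1.
Proof.
rewrite [`|_|]mx_normrE; apply/eqP; rewrite eq_le; apply/andP; split.
  apply/bigmax_leP; split=> // -[a b] _ /=; rewrite (ord1 a) basis4E.
  by case: eqP; rewrite ?normr1 ?normr0 ?ler01.
apply: le_trans (le_bigmax _ (fun ij : 'I_1 * 'I_4 => `|e_ i ij.1 ij.2|) (0, i)).
by rewrite /= basis4E eqxx normr1.
Qed.

Lemma ds_comm O f p i j : open O -> Ck 2 O f -> O p ->
  'D_(e_ i) ('D_(e_ j) f) p = 'D_(e_ j) ('D_(e_ i) f) p.
Proof.
move=> oO [_ d2f] Op.
have [r r0 sub] := ball_sub oO Op.
have d1 z k : O z -> derivable f z (e_ k) by have [d _] := d2f k => /d.
have d2 z k l : O z -> derivable ('D_(e_ k) f) z (e_ l).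
  by have [_ [_ d]] := d2f k; have [d' _] := d l => /d'.
have c2 k l : {for p, continuous ('D_(e_ l) ('D_(e_ k) f))}.
  by have [_ [_ d]] := d2f k; have [_ [c _]] := d l; exact: c.
(* Both mixed partials are values of the same second difference quotient *)
have key k l (h : R) : 0 < h -> h < r / 2 -> exists2 z : V, `|z - p| <= 2 * h &
    f (p + h *: e_ k + h *: e_ l) - f (p + h *: e_ k) - (f (p + h *: e_ l) - f p)
    = h * (h * 'D_(e_ l) ('D_(e_ k) f) z).
  move=> h0 hr.
  have bnd (s t : R) : `|s| <= h -> `|t| <= h -> `|p + s *: e_ k + t *: e_ l - p| <= 2 * h.
    move=> sh th; rewrite -(addrA p) [p + _]addrC addrK.
    apply: le_trans (ler_normD _ _) _; rewrite !normrZ !norm_basis4 !mulr1.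
    by rewrite mulr2n mulrDl mul1r lerD.
  have inO (s t : R) : `|s| <= h -> `|t| <= h -> O (p + s *: e_ k + t *: e_ l).
    move=> sh th; apply: sub; apply: le_lt_trans (bnd _ _ sh th) _; lra.
  pose g x := f (x + h *: e_ l) - f x.
  have hh : `|h| = h by rewrite gtr0_norm.
  have n0 : `|0 : R| <= h by rewrite normr0 ltW.
  have shiftd (x : V) : O (x + h *: e_ l) ->
     is_derive x (e_ k) (fun x => f (x + h *: e_ l)) ('D_(e_ k) f (x + h *: e_ l)).
    move=> Ox; have := d1 _ k Ox.
    pose G (y : V) (t : R) := t^-1 *: (f (t *: e_ k + y) - f y).
    have E : (fun t : R => t^-1 *: (((fun x => f (x + h *: e_ l)) \o shift x) (t *: e_ k)
         - f (x + h *: e_ l))) = G (x + h *: e_ l).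
      by apply/funext => t /=; rewrite /G addrA.
    by move=> D; apply: DeriveDef; rewrite /derivable /derive /= E.
  have dg t : `|t| <= `|h| -> is_derive (p + t *: e_ k) (e_ k) g
      ('D_(e_ k) f (p + t *: e_ k + h *: e_ l) - 'D_(e_ k) f (p + t *: e_ k)).
    rewrite hh => th; apply: is_deriveB.
      by apply: shiftd; apply: inO; rewrite ?hh.
    apply: derivableP; apply: d1.
    by have := inO _ _ th n0; rewrite scale0r addr0.
  have [t /[dup] th + E] := @line_mvt _ g p (e_ k) h (fun t th => @ex_derive _ _ _ _ _ _ _ (dg t th)).
  rewrite hh => th'.
  rewrite (@derive_val _ _ _ _ _ _ _ (dg t th)) in E.
  have [|t2 th2 E2] := @line_mvt _ ('D_(e_ k) f) (p + t *: e_ k) (e_ l) h.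
    by move=> t2; rewrite hh => th2; apply: d2; exact: inO.
  rewrite hh in th2.
  exists (p + t *: e_ k + t2 *: e_ l); first exact: bnd.
  by rewrite -/(g _) -/(g p) E E2.
apply/eqP; rewrite -subr_eq0 -normr_le0; apply/ler_addgt0Pr => eps e0; rewrite add0r.
have [d1' d10 h1] : exists2 r : R, 0 < r & forall z, `|z - p| < r ->
   `|'D_(e_ i) ('D_(e_ j) f) p - 'D_(e_ i) ('D_(e_ j) f) z| <= eps / 2.
  have /cvgrPdist_le/(_ (eps / 2)) := c2 j i; rewrite divr_gt0// => /(_ isT).
  by move=> /nbhs_ballP[r1 /= rp h]; exists r1 => // z zp; apply: h; rewrite -ball_normE /= distrC.
have [d2' d20 h2] : exists2 r : R, 0 < r & forall z, `|z - p| < r ->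
   `|'D_(e_ j) ('D_(e_ i) f) p - 'D_(e_ j) ('D_(e_ i) f) z| <= eps / 2.
  have /cvgrPdist_le/(_ (eps / 2)) := c2 i j; rewrite divr_gt0// => /(_ isT).
  by move=> /nbhs_ballP[r1 /= rp h]; exists r1 => // z zp; apply: h; rewrite -ball_normE /= distrC.
have [h [h0 hr hd1 hd2]] : exists h, [/\ 0 < h, h <= r / 4, h <= d1' / 4 & h <= d2' / 4].
  exists (Num.min (r / 4) (Num.min (d1' / 4) (d2' / 4))).
  by rewrite !lt_min !divr_gt0// !ge_min !lexx !orbT.
have [|z1 z1h E1] := key j i h h0; first lra.
have [|z2 z2h E2] := key i j h h0; first lra.
have : h * (h * 'D_(e_ i) ('D_(e_ j) f) z1) = h * (h * 'D_(e_ j) ('D_(e_ i) f) z2).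
  have alg (a b c d : R) : a - b - (c - d) = a - c - (b - d) by ring.
  refine (etrans (esym E1) (etrans _ E2)).
  by rewrite (addrAC p (h *: e_ j)); exact: alg.
move=> /(mulfI (lt0r_neq0 h0)) /(mulfI (lt0r_neq0 h0)) E.
rewrite (splitr eps) -(subrKA ('D_(e_ i) ('D_(e_ j) f) z1)).
apply: le_trans (ler_normD _ _) _; apply: lerD; first by apply: h1; clear -z1h hd1 d10; lra.
by rewrite E distrC; apply: h2; clear -z2h hd2 d20; lra.
Qed.

End MultivariableCalculus.

(** * Partial derivatives of complex-valued functions *)

Section ComplexCalculus.
Variable R : realType.
Local Notation V := (M4 R).
Local Notation C := (Cx R).
Implicit Types (f g h : V -> C) (O : set V) (i j : 'I_4).

Definition csmooth O h := smooth_on O (re_part h) /\ smooth_on O (im_part h).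

Lemma cpartial_ext O g h p i : open O -> (forall q, O q -> g q = h q) -> O p ->
  cpartial i g p = cpartial i h p.
Proof.
move=> oO gh Op; rewrite /cpartial; congr Complex; apply: near_eq_derive;
  by apply: open_nearP oO Op _ => q /gh; rewrite /re_part /im_part => ->.
Qed.

Lemma csmooth_ext O g h : open O -> (forall q, O q -> g q = h q) ->
  csmooth O g -> csmooth O h.
Proof.
move=> oO gh [rg ig]; split=> k.
  by apply: Ck_ext oO _ (rg k) => p /gh; rewrite /re_part => ->.
by apply: Ck_ext oO _ (ig k) => p /gh; rewrite /im_part => ->.
Qed.

Lemma csmooth_sub O O' h : O' `<=` O -> csmooth O h -> csmooth O' h.
Proof. by move=> s [r i]; split=> k; apply: Ck_sub s _. Qed.

Lemma csmooth_cst O (c : C) : csmooth O (fun=> c).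
Proof. by split=> k; exact: Ck_cst. Qed.

Lemma re_partD g h : re_part (fun p => g p + h p) = fun p => re_part g p + re_part h p.
Proof. by apply/funext => p; rewrite /re_part; case: (g p) (h p) => ? ? []. Qed.

Lemma im_partD g h : im_part (fun p => g p + h p) = fun p => im_part g p + im_part h p.
Proof. by apply/funext => p; rewrite /im_part; case: (g p) (h p) => ? ? []. Qed.

Lemma re_partN g : re_part (fun p => - g p) = fun p => - re_part g p.
Proof. by apply/funext => p; rewrite /re_part; case: (g p). Qed.

Lemma im_partN g : im_part (fun p => - g p) = fun p => - im_part g p.
Proof. by apply/funext => p; rewrite /im_part; case: (g p). Qed.

Lemma re_partM g h : re_part (fun p => g p * h p) =
  fun p => re_part g p * re_part h p + - (im_part g p * im_part h p).
Proof. by apply/funext => p; rewrite /re_part /im_part; case: (g p) (h p) => ? ? []. Qed.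

Lemma im_partM g h : im_part (fun p => g p * h p) =
  fun p => re_part g p * im_part h p + im_part g p * re_part h p.
Proof. by apply/funext => p; rewrite /re_part /im_part; case: (g p) (h p) => ? ? []. Qed.

Lemma CxD (a b c d : R) : (Complex a b : C) + Complex c d = Complex (a + c) (b + d).
Proof. by []. Qed.

Lemma CxN (a b : R) : - (Complex a b : C) = Complex (- a) (- b).
Proof. by []. Qed.

Lemma csmoothD O g h : open O -> csmooth O g -> csmooth O h ->
  csmooth O (fun p => g p + h p).
Proof.
move=> oO [rg ig] [rh ih]; rewrite /csmooth re_partD im_partD.
by split=> k; apply: CkD.
Qed.

Lemma csmoothN O g : open O -> csmooth O g -> csmooth O (fun p => - g p).
Proof.
move=> oO [rg ig]; rewrite /csmooth re_partN im_partN.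
by split=> k; apply: CkN.
Qed.

Lemma csmoothM O g h : open O -> csmooth O g -> csmooth O h ->
  csmooth O (fun p => g p * h p).
Proof.
move=> oO [rg ig] [rh ih]; rewrite /csmooth re_partM im_partM.
by split=> k; apply: CkD => //; do ?apply: CkN => //; apply: CkM.
Qed.

Lemma complex_neq0 (z : C) : z != 0 -> complex.Re z ^+ 2 + complex.Im z ^+ 2 != 0.
Proof.
case: z => a b; apply: contraNneq => /= /eqP; rewrite paddr_eq0 ?sqr_ge0//.
by rewrite !sqrf_eq0 => /andP[/eqP -> /eqP ->].
Qed.

Lemma csmoothV O h : open O -> (forall p, O p -> h p != 0) -> csmooth O h ->
  csmooth O (fun p => (h p)^-1).
Proof.
move=> oO h0 [rh ih].
pose n p := re_part h p * re_part h p + im_part h p * im_part h p.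
have n0 p : O p -> n p != 0 by move=> /h0/complex_neq0; rewrite !expr2.
have sn k : Ck k O n by apply: CkD => //; apply: CkM.
have E1 : re_part (fun p => (h p)^-1) = fun p => re_part h p * (n p)^-1.
  by apply/funext => p; rewrite /n /re_part /im_part; case: (h p) => a b; rewrite -!expr2.
have E2 : im_part (fun p => (h p)^-1) = fun p => - (im_part h p * (n p)^-1).
  by apply/funext => p; rewrite /n /re_part /im_part; case: (h p) => a b; rewrite -!expr2.
rewrite /csmooth E1 E2; split=> k; last apply: CkN => //.
  by apply: CkM => //; apply: CkV.
by apply: CkM => //; apply: CkV.
Qed.

Lemma csmooth_conj O h : open O -> csmooth O h -> csmooth O (fun p => (h p)^*%C).
Proof.
move=> oO [rh ih]; rewrite /csmooth.
have -> : re_part (fun p => (h p)^*%C) = re_part h.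
  by apply/funext => p; rewrite /re_part; case: (h p).
have -> : im_part (fun p => (h p)^*%C) = fun p => - im_part h p.
  by apply/funext => p; rewrite /im_part; case: (h p).
by split=> // k; apply: CkN.
Qed.

Lemma csmooth_partial O h i : csmooth O h -> csmooth O (cpartial i h).
Proof.
by move=> [rh ih]; split=> k; [have [_] := rh k.+1|have [_] := ih k.+1] => /(_ i)[].
Qed.

Lemma csmooth_derivable O h p i : csmooth O h -> O p ->
  derivable (re_part h) p (basis4 R i) /\ derivable (im_part h) p (basis4 R i).
Proof.
move=> [rh ih] Op; have [_ /(_ i)[dr _]] := rh 1%N; have [_ /(_ i)[di _]] := ih 1%N.
by split; [exact: dr|exact: di].
Qed.

Lemma cpartialD O g h p i : csmooth O g -> csmooth O h -> O p ->
  cpartial i (fun q => g q + h q) p = cpartial i g p + cpartial i h p.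
Proof.
move=> sg sh Op; have [rg ig] := csmooth_derivable i sg Op.
have [rh ih] := csmooth_derivable i sh Op.
rewrite /cpartial re_partD im_partD CxD.
by congr Complex; [exact: (deriveD rg rh)|exact: (deriveD ig ih)].
Qed.

Lemma cpartialN O g p i : csmooth O g -> O p ->
  cpartial i (fun q => - g q) p = - cpartial i g p.
Proof.
move=> sg Op; have [rg ig] := csmooth_derivable i sg Op.
rewrite /cpartial re_partN im_partN CxN.
by congr Complex; [exact: (deriveN rg)|exact: (deriveN ig)].
Qed.

Lemma cpartialM O g h p i : csmooth O g -> csmooth O h -> O p ->
  cpartial i (fun q => g q * h q) p = cpartial i g p * h p + g p * cpartial i h p.
Proof.
move=> sg sh Op; have [rg ig] := csmooth_derivable i sg Op.
have [rh ih] := csmooth_derivable i sh Op.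
rewrite /cpartial re_partM im_partM.
rewrite (deriveD (f := fun p => re_part g p * re_part h p)
  (g := fun p => - (im_part g p * im_part h p))); last 2 first.
  exact: (derivableM rg rh).
  exact: (derivableN (derivableM ig ih)).
rewrite (deriveD (f := fun p => re_part g p * im_part h p)
  (g := fun p => im_part g p * re_part h p)); last 2 first.
  exact: (derivableM rg ih).
  exact: (derivableM ig rh).
rewrite (deriveN (f := fun p => im_part g p * im_part h p)); last exact: (derivableM ig ih).
rewrite (deriveM rg rh) (deriveM ig ih) (deriveM rg ih) (deriveM ig rh).
rewrite /GRing.scale /= /re_part /im_part; case: (g p) (h p) => a b [c d] /=.
move: ('D_(_) _ p) ('D_(_) _ p) ('D_(_) _ p) ('D_(_) _ p) => x1 x2 x3 x4.
by congr Complex; ring.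
Qed.

Lemma cpartial_cst (c : C) p i : cpartial i (fun=> c) p = 0.
Proof. by rewrite /cpartial !derive_cst. Qed.

(** Differentiate [h * h^-1 = 1], the inverse being already known to be smooth. *)
Lemma cpartialV O h p i : open O -> (forall q, O q -> h q != 0) -> csmooth O h -> O p ->
  cpartial i (fun q => (h q)^-1) p = - cpartial i h p * (h p)^-1 ^+ 2.
Proof.
move=> oO h0 sh Op; have sv := csmoothV oO h0 sh.
have := cpartialM i sh sv Op.
rewrite (@cpartial_ext O _ (fun=> 1) p i oO _ Op); last by move=> q /h0 q0; rewrite divff.
rewrite cpartial_cst => /esym /eqP; rewrite addr_eq0 => /eqP E.
apply: (mulfI (h0 _ Op)); rewrite -[LHS]opprK -E; move: (h0 _ Op); move: (h p) (cpartial i h p) => y z y0.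
by rewrite expr2 mulrCA mulVKf// mulNr.
Qed.

Lemma cpartial_conj O h p i : csmooth O h -> O p ->
  cpartial i (fun q => (h q)^*%C) p = (cpartial i h p)^*%C.
Proof.
move=> sh Op; have [rh ih] := csmooth_derivable i sh Op.
rewrite /cpartial.
have -> : re_part (fun p => (h p)^*%C) = re_part h.
  by apply/funext => q; rewrite /re_part; case: (h q).
have -> : im_part (fun p => (h p)^*%C) = fun p => - im_part h p.
  by apply/funext => q; rewrite /im_part; case: (h q).
rewrite /conjc; congr Complex; exact: (deriveN ih).
Qed.

Lemma cpartial_comm O h p i j : open O -> csmooth O h -> O p ->
  cpartial i (cpartial j h) p = cpartial j (cpartial i h) p.
Proof.
move=> oO [rh ih] Op.
exact: (f_equal2 (@Complex R) (ds_comm i j oO (rh 2%N) Op) (ds_comm i j oO (ih 2%N) Op)).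
Qed.

Lemma csmooth_sum O (n : nat) (F : 'I_n -> V -> C) : open O ->
  (forall k, csmooth O (F k)) -> csmooth O (fun p => \sum_k F k p).
Proof.
elim: n F => [|n IH] F oO sF.
  by apply: csmooth_ext oO _ (csmooth_cst O 0) => q _; rewrite big_ord0.
apply: csmooth_ext oO _ (csmoothD oO (sF 0) (IH (fun k => F (lift 0 k)) oO _)) => //.
by move=> q _; rewrite big_ord_recl.
Qed.

Lemma cpartial_sum O (n : nat) (F : 'I_n -> V -> C) p i : open O -> O p ->
  (forall k, csmooth O (F k)) ->
  cpartial i (fun q => \sum_k F k q) p = \sum_k cpartial i (F k) p.
Proof.
elim: n F => [|n IH] F oO Op sF.
  rewrite big_ord0 (@cpartial_ext O _ (fun=> 0) _ _ oO _ Op) ?cpartial_cst//.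
  by move=> q _; rewrite big_ord0.
rewrite big_ord_recl -(IH (fun k => F (lift 0 k)))//.
rewrite -(cpartialD _ (sF 0) (csmooth_sum (F := fun k => F (lift 0 k)) oO _) Op)//.
by apply: cpartial_ext oO _ Op => q _; rewrite big_ord_recl.
Qed.

(* The norm of [Cx R] takes its values in [Cx R]; this equivalent one is real. *)
Definition norm1c (z : C) : R := `|complex.Re z| + `|complex.Im z|.

Lemma norm1c_ge0 z : 0 <= norm1c z.
Proof. by rewrite addr_ge0. Qed.

Lemma norm1cD z w : norm1c (z + w) <= norm1c z + norm1c w.
Proof.
case: z w => a b [c d]; rewrite /norm1c /= addrACA.
by apply: lerD; exact: ler_normD.
Qed.

Lemma norm1cN z : norm1c (- z) = norm1c z.
Proof. by case: z => a b; rewrite /norm1c /= !normrN. Qed.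

Lemma norm1cM z w : norm1c (z * w) <= norm1c z * norm1c w.
Proof.
case: z w => a b [c d]; rewrite /norm1c /=.
apply: le_trans (lerD (ler_normB _ _) (ler_normD _ _)) _.
by rewrite !normrM; lra.
Qed.

Lemma norm1c0 : norm1c 0 = 0.
Proof. by rewrite /norm1c /= !normr0 addr0. Qed.

Lemma norm1c_eq0 z : (norm1c z == 0) = (z == 0).
Proof.
case: z => a b; rewrite /norm1c /= paddr_eq0// !normr_eq0 eq_complex /=.
by [].
Qed.

Lemma norm1c_sum (I : Type) (s : seq I) (F : I -> C) :
  norm1c (\sum_(i <- s) F i) <= \sum_(i <- s) norm1c (F i).
Proof.
elim/big_ind2: _ => [|x1 x2 y1 y2 h1 h2|//]; first by rewrite norm1c0.
by apply: le_trans (norm1cD _ _) _; apply: lerD.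
Qed.

Lemma norm1cMn z n : norm1c (z *+ n) = norm1c z *+ n.
Proof.
case: z => a b; have -> : (Complex a b : C) *+ n = Complex (a *+ n) (b *+ n).
  by elim: n => // n IH; rewrite !mulrS IH.
by rewrite /norm1c /= !normrMn mulrnDl.
Qed.

End ComplexCalculus.

(** * Factorial bounds for the partial derivatives of an analytic function *)

Section AnalyticBounds.
Variable R : realType.
Local Notation V := (M4 R).
Local Notation e_ := (@basis4 R).
Implicit Types (f g G : V -> R) (O : set V) (i j : 'I_4) (L : seq ('I_4 * R)).

(** Difference quotients replace derivatives because they pass to pointwise limits of [G]. A step 0
    gives the value 0, since [0^-1 = 0]. *)
Definition diffq (a : 'I_4 * R) G : V -> R :=
  fun x => a.2^-1 * (G (x + a.2 *: e_ a.1) - G x).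

Definition diffqs L G : V -> R := foldr diffq G L.

Definition partials (l : seq 'I_4) f : V -> R :=
  foldr (fun i g => 'D_(e_ i) g) f l.

(** Evaluating [diffqs L G] at [x] samples [G] only within this distance of [x]. *)
Definition steps L : R := \sum_(a <- L) `|a.2|.

Lemma steps_cons a L : steps (a :: L) = `|a.2| + steps L.
Proof. by rewrite /steps big_cons. Qed.

Lemma steps_cat L L' : steps (L ++ L') = steps L + steps L'.
Proof. by rewrite /steps big_cat. Qed.

Lemma steps_ge0 L : 0 <= steps L.
Proof. by apply: sumr_ge0. Qed.

Lemma norm_shift (p x : V) (a : 'I_4 * R) :
  `|x + a.2 *: e_ a.1 - p| <= `|x - p| + `|a.2|.
Proof.
rewrite addrAC; apply: le_trans (ler_normD _ _) _.
by rewrite normrZ norm_basis4 mulr1.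
Qed.

Lemma diffqs_ext L G G' x : G =1 G' -> diffqs L G x = diffqs L G' x.
Proof. by move=> /funext ->. Qed.

Lemma diffqsD L G G' x :
  diffqs L (fun y => G y + G' y) x = diffqs L G x + diffqs L G' x.
Proof. by elim: L x => //= a L IH x; rewrite /diffq !IH; ring. Qed.

Lemma diffqsZ L (c : R) G x : diffqs L (fun y => c * G y) x = c * diffqs L G x.
Proof. by elim: L x => //= a L IH x; rewrite /diffq !IH; ring. Qed.

Lemma diffqs0 L x : diffqs L (fun=> 0) x = 0.
Proof. by elim: L x => //= a L IH x; rewrite /diffq !IH subrr mulr0. Qed.

Lemma diffqs_sum L (I : Type) (s : seq I) (F : I -> V -> R) x :
  diffqs L (fun y => \sum_(i <- s) F i y) x = \sum_(i <- s) diffqs L (F i) x.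
Proof.
elim: s => [|a s IH].
  rewrite [RHS]big_nil -[RHS](diffqs0 L x); apply: diffqs_ext => y.
  by rewrite big_nil.
rewrite big_cons -IH -diffqsD; apply: diffqs_ext => y.
by rewrite big_cons.
Qed.

Lemma diffqs_shift L G (v x : V) :
  diffqs L (fun y => G (y + v)) x = diffqs L G (x + v).
Proof. by elim: L x => //= a L IH x; rewrite /diffq !IH addrAC. Qed.

Lemma diffqs_cat L L' G : diffqs (L ++ L') G = diffqs L (diffqs L' G).
Proof. by rewrite /diffqs foldr_cat. Qed.

Lemma diffqs_cvg (T : Type) (F : set_system T) (FF : Filter F) (G : T -> V -> R)
    (G' : V -> R) L (p x : V) (rho : R) :
  (forall y, `|y - p| < rho -> G t y @[t --> F] --> G' y) ->
  `|x - p| + steps L < rho ->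
  diffqs L (G t) x @[t --> F] --> diffqs L G' x.
Proof.
move=> cG; elim: L x => [|a L IH] x.
  by rewrite /steps big_nil addr0; exact: cG.
rewrite steps_cons addrA => xr /=; rewrite /diffq.
apply: cvgM; first exact: cvg_cst.
apply: cvgB; apply: IH; last first.
  by apply: le_lt_trans xr; rewrite lerD2r lerDl.
by apply: le_lt_trans xr; rewrite lerD2r norm_shift.
Qed.

(** The right-hand side is the derivative of order [size L] of t^N at t = rho, the bound that a
    monomial of degree N should obey. *)
Definition monbound (p : V) (rho : R) (N : nat) G := forall L x,
  `|x - p| + steps L <= rho ->
  `|diffqs L G x| <= (N ^_ (size L))%:R * rho ^+ (N - size L).

Lemma monbound_ext (p : V) rho N G G' : G =1 G' ->
  monbound p rho N G -> monbound p rho N G'.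
Proof. by move=> /funext ->. Qed.

(* The Leibniz remainder: [diffqs L (x_i G) = x_i diffqs L G + leibniz i L G] *)
Fixpoint leibniz i L G : V -> R :=
  if L is a :: L' then fun x =>
    (a.1 == i)%:R * (a.2^-1 * a.2) * diffqs L' G (x + a.2 *: e_ a.1)
      + diffq a (leibniz i L' G) x
  else fun=> 0.

Lemma diffqs_coord (p : V) i L G x :
  diffqs L (fun y => (y - p) 0 i * G y) x =
  (x - p) 0 i * diffqs L G x + leibniz i L G x.
Proof.
elim: L x => [|a L IH] x /=; first by rewrite addr0.
rewrite /diffq !IH; rewrite !mxE eqxx /= (eq_sym i).
by case: (_ == i) => /=; ring.
Qed.

(** In each summand of the remainder one quotient of [L] has been spent on the coordinate, which
    leaves one fewer for [G]. [K] collects the quotients already moved outside, so that the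
    induction on [L] closes. *)
Lemma leibniz_bound (p : V) rho N G i L K x : monbound p rho N G -> 0 <= rho ->
  `|x - p| + steps K + steps L <= rho ->
  `|diffqs K (leibniz i L G) x| <=
    (size L)%:R * ((N ^_ (size K + (size L).-1))%:R * rho ^+ (N - (size K + (size L).-1))).
Proof.
move=> bG rho0; elim: L K x => [|a L IH] K x.
  by rewrite diffqs0 normr0 mul0r.
rewrite steps_cons /= => xr.
rewrite diffqsD (diffqsZ K _ (fun x => diffqs L G (x + a.2 *: e_ a.1))).
rewrite (diffqs_shift K (diffqs L G)) -diffqs_cat.
rewrite (_ : diffqs K _ x = diffqs (K ++ [:: a]) (leibniz i L G) x); last first.
  by rewrite diffqs_cat.
apply: le_trans (ler_normD _ _) _; rewrite -natr1 mulrDl addrC mul1r; apply: lerD.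
  have := IH (K ++ [:: a]) x; rewrite steps_cat steps_cons /steps big_nil addr0 -/(steps _) -/(steps _).
  rewrite size_cat /= addn1 => /(_ _)/le_trans; apply.
    by apply: le_trans xr; rewrite -!addrA.
  by case: L {IH xr} => [|b L]; rewrite ?mul0r //= addSnnS.
have := bG (K ++ L) (x + a.2 *: e_ a.1); rewrite size_cat steps_cat => h.
rewrite normrM; apply: le_trans (_ : 1 * _ <= _); last first.
  rewrite mul1r; apply: h; apply: le_trans xr.
  by have := norm_shift p x a; lra.
apply: ler_wpM2r => //; rewrite normrM; have [->|a0] := eqVneq a.2 0.
  by rewrite mulr0 normr0 mulr0 ler01.
by rewrite mulVf// normr1 mulr1; case: (_ == _); rewrite ?normr1 ?normr0 ?ler01.
Qed.

(** The product rule for t * t^N: the two contributions match because (N - k) + (k + 1) = N + 1. *)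
Lemma monbound_coord (p : V) rho N G i : 0 <= rho -> monbound p rho N G ->
  monbound p rho N.+1 (fun y => (y - p) 0 i * G y).
Proof.
move=> rho0 bG L x xr; rewrite diffqs_coord.
have xi : `|(x - p) 0 i| <= rho.
  apply: le_trans (rv_coord_le _ _) _; apply: le_trans xr.
  by rewrite lerDl steps_ge0.
have h1 : `|(x - p) 0 i * diffqs L G x| <= rho * ((N ^_ (size L))%:R * rho ^+ (N - size L)).
  by rewrite normrM; apply: ler_pM => //; exact: bG.
have h2 := @leibniz_bound p rho N G i L [::] x bG rho0.
rewrite /= add0n {1}/steps big_nil addr0 in h2; have {}h2 := h2 xr.
apply: le_trans (ler_normD _ _) _; apply: le_trans (lerD h1 h2) _.
case: (size L) => [|k]; first by rewrite !ffactn0 !subn0 mul0r addr0 !mul1r exprS.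
rewrite /= subSS.
have -> : rho * ((N ^_ k.+1)%:R * rho ^+ (N - k.+1)) = (N ^_ k.+1)%:R * rho ^+ (N - k).
  have [kN|Nk] := ltnP k N; last by rewrite ffact_small ?ltnS// !mul0r mulr0.
  by rewrite mulrCA -exprS -subSn// subSS.
rewrite mulrA -mulrDl; apply: ler_wpM2r; first exact: exprn_ge0.
rewrite -natrM -natrD ler_nat ffactSS ffactnSr.
have [kN|Nk] := leqP k N; first last.
  by rewrite ffact_small// !mul0n muln0.
by rewrite (mulnC (N ^_ k)) -mulnDl leq_mul2r; apply/orP; right; lia.
Qed.

Lemma monbound1 (p : V) rho : 0 <= rho -> monbound p rho 0 (fun=> 1).
Proof.
move=> rho0 [|a L] x _ /=; first by rewrite ffactn0 normr1 mulr1.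
rewrite /diffq (_ : diffqs L (fun=> 1) = fun=> (size L == 0)%:R); last first.
  elim: L {x} => [//|b L IH]; apply/funext => x /=.
  by rewrite /diffq IH subrr mulr0.
by rewrite subrr mulr0 normr0 ffact0n mul0r.
Qed.

Lemma monbound_monomial (p : V) rho (a : {ffun 'I_4 -> nat}) : 0 <= rho ->
  monbound p rho (\sum_i a i)%N (fun x => monomial (x - p) a).
Proof.
move=> rho0; rewrite /monomial.
elim: (index_enum 'I_4) => [|i s IH].
  by rewrite big_nil; refine (monbound_ext _ (monbound1 rho0)) => x; rewrite big_nil.
rewrite big_cons.
refine (@monbound_ext _ _ _
  (fun x => (x - p) 0 i ^+ a i * \prod_(j <- s) (x - p) 0 j ^+ a j) _ _ _).
  by move=> x; rewrite big_cons.
elim: (a i) => [|n IHn].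
  by rewrite add0n; refine (monbound_ext _ IH) => x; rewrite expr0 mul1r.
rewrite addSn; refine (monbound_ext _ (monbound_coord i rho0 IHn)) => x.
by rewrite exprS mulrA.
Qed.

(** A Cauchy estimate: C(N,k) rho^(N-k) tau^k is one term of the binomial expansion of (rho +
    tau)^N. *)
Lemma ffact_binomial_bound (rho tau : R) N k : 0 <= rho -> 0 < tau ->
  (N ^_ k)%:R * rho ^+ (N - k) <= k`!%:R * tau^-1 ^+ k * (rho + tau) ^+ N.
Proof.
move=> r0 t0; have [kN|Nk] := leqP k N; last first.
  rewrite ffact_small// mul0r; apply: mulr_ge0; last by rewrite exprn_ge0// addr_ge0// ltW.
  by rewrite mulr_ge0// exprn_ge0// invr_ge0 ltW.
rewrite -bin_ffact natrM mulrAC [_ * k`!%:R]mulrC -mulrA; apply: ler_wpM2l => //.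
rewrite exprVn ler_pdivlMl ?exprn_gt0//.
rewrite exprDn (bigD1 (Ordinal (kN : (k < N.+1)%N)))//=.
rewrite -[leLHS]addr0; apply: lerD.
  by rewrite -mulr_natr le_eqVlt; apply/orP; left; apply/eqP; ring.
by apply: sumr_ge0 => i _; rewrite mulrn_wge0// mulr_ge0// exprn_ge0// ltW.
Qed.

(** Enlarging the radius from [rho] to [rho + tau] absorbs the degrees of the monomials, so the
    bound depends on [n] only through the absolute series at one diagonal point. *)
Lemma psum_diffqs_bound (c : {ffun 'I_4 -> nat} -> R) (p x : V) (rho tau : R) L n :
  0 <= rho -> 0 < tau -> `|x - p| + steps L <= rho ->
  `|diffqs L (fun y => psum c (y - p) n) x| <=
    (size L)`!%:R * tau^-1 ^+ size L * psum_abs c (const_mx (rho + tau)) n.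
Proof.
move=> r0 t0 xr; rewrite /psum diffqs_sum /psum_abs mulr_sumr.
apply: le_trans (ler_norm_sum _ _ _) _; apply: ler_sum => a _ /=.
set b := [ffun i => _]; rewrite diffqsZ normrM.
have -> : monomial (const_mx (rho + tau)) b = (rho + tau) ^+ (\sum_i b i)%N.
  by rewrite /monomial -prodrXr; apply: eq_bigr => i _; rewrite mxE.
rewrite normrM mulrCA; apply: ler_wpM2l => //.
rewrite (ger0_norm (exprn_ge0 _ _)); last by rewrite addr_ge0// ltW.
apply: le_trans (ffact_binomial_bound _ _ r0 t0).
exact: (@monbound_monomial p rho b r0 L x xr).
Qed.

Lemma analytic_partials_bound O f p : open O -> O p -> smooth_on O f ->
  real_analytic_at f p ->
  exists r S K : R, [/\ 0 < r, 0 <= S, 0 < K & forall l q, `|q - p| < r ->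
    `|partials l f q| <= S * K ^+ size l * (size l)`!%:R].
Proof.
move=> oO Op sf [r [c [r0 h]]].
have [r1 r10 sub] := ball_sub oO Op.
(* With [tau = r / 4] this gives [rho + tau <= r / 2 < r]: the diagonal point stays in the domain of
   absolute convergence. *)
pose rho := Num.min (r / 4) r1.
have rho0 : 0 < rho by rewrite lt_min r10 divr_gt0.
have rhor : rho <= r / 4 by rewrite ge_min lexx.
have rhoO z : `|z - p| < rho -> O z.
  by move=> /lt_le_trans zr; apply: sub; apply: zr; rewrite ge_min lexx orbT.
pose tau := r / 4; have tau0 : 0 < tau by rewrite divr_gt0.
have [S S0 psS] : exists2 S : R, 0 <= S & forall n, psum_abs c (const_mx (rho + tau)) n <= S.
  have [|cvgp _] := h (p + const_mx (rho + tau)).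
    rewrite addrC addKr; apply/rv_norm_lt => // i; rewrite mxE ger0_norm; last first.
      by rewrite addr_ge0// ltW.
    by rewrite /tau; lra.
  rewrite addrC addKr in cvgp.
  have [M [_ /(_ (`|M| + 1))]] := cvg_seq_bounded cvgp.
  rewrite (le_lt_trans (ler_norm M)) ?ltrDl// => /(_ isT) hM.
  exists (`|M| + 1); first by rewrite addr_ge0.
  by move=> n; apply: le_trans (ler_norm _) _; exact: hM.
have base L x : `|x - p| + steps L < rho ->
    `|diffqs L f x| <= (size L)`!%:R * tau^-1 ^+ size L * S.
  move=> xr.
  have cv : diffqs L (fun y => psum c (y - p) n) x @[n --> \oo] --> diffqs L f x.
    apply: (@diffqs_cvg nat \oo _ (fun n y => psum c (y - p) n) f L p x rho) => // y yr.
    by have [|_] := h y; [lra|].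
  apply: (cvgr_to_le (cvg_norm cv)).
  near=> n.
  apply: le_trans (psum_diffqs_bound c n (ltW rho0) tau0 (ltW xr)) _.
  apply: ler_wpM2l => //.
  by rewrite mulr_ge0// exprn_ge0// invr_ge0 ltW.
(* Each derivative in [l] is the limit of a quotient whose step tends to 0; the induction hypothesis
   is applied with that quotient appended to [L], which is why [L] is arbitrary. *)
have all l : forall L x, `|x - p| + steps L < rho ->
    `|diffqs L (partials l f) x| <=
      (size l + size L)`!%:R * tau^-1 ^+ (size l + size L) * S.
  elim: l => [|i l IH] L x xr; first exact: base.
  have dl y : `|y - p| < rho -> derivable (partials l f) y (e_ i).
    move=> /rhoO Oy; have : smooth_on O (partials l f).
      elim: (l) => [//|j l' IHl] k; have [_ /(_ j)[_]] := IHl k.+1; exact.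
    by move=> /(_ 1%N)[_ /(_ i)[d _]]; exact: d.
  have cv : diffqs L (diffq (i, h) (partials l f)) x @[h --> 0^'] -->
            diffqs L (partials (i :: l) f) x.
    apply: (@diffqs_cvg R 0^' _ (fun h => diffq (i, h) (partials l f)) _ L p x rho) => // y yr.
    rewrite /diffq /=.
    have -> : (fun h0 : R => h0^-1 * (partials l f (y + h0 *: e_ i) - partials l f y)) =
      (fun h0 : R => h0^-1 *: ((partials l f \o shift y) (h0 *: e_ i) - partials l f y)).
      by apply/funext => t /=; rewrite [t *: _ + y]addrC.
    exact: (dl y yr).
  apply: (cvgr_to_le (cvg_norm cv)).
  have pos : 0 < rho - (`|x - p| + steps L) by rewrite subr_gt0.
  near=> t.
  have := IH (L ++ [:: (i, t)]) x.
  rewrite diffqs_cat /= size_cat /= addn1 addSnnS => -> //.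
  rewrite steps_cat steps_cons /steps big_nil addr0 -/(steps L) /= addrA -ltrBrDl.
  by near: t; exact: dnbhs0_lt.
exists rho, S, tau^-1; split=> //; first by rewrite invr_gt0.
move=> l q qr; have := all l [::] q.
rewrite /steps big_nil addr0 addn0 => /(_ qr)/le_trans; apply.
by rewrite [leRHS]mulrC mulrA mulrAC.
Unshelve. all: by end_near. Qed.

End AnalyticBounds.

(** * Derivative bounds modelled on c (1 - K x)^-(s+1): products and inverses *)

Section DerivativeBounds.
Variable R : realType.
Local Notation V := (M4 R).
Local Notation C := (Cx R).
Implicit Types (f g h u : V -> C) (O : set V) (i j : 'I_4).

Lemma citer_ext O i n g h : open O -> (forall q, O q -> g q = h q) ->
  forall q, O q -> iter n (cpartial i) g q = iter n (cpartial i) h q.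
Proof.
move=> oO gh; elim: n => [//|n IH] q Oq /=.
exact: cpartial_ext oO IH Oq.
Qed.

Lemma csmooth_iter O i n h : csmooth O h -> csmooth O (iter n (cpartial i) h).
Proof. by move=> sh; elim: n => [//|n IH] /=; exact: csmooth_partial. Qed.

Lemma citerD O i n g h q : open O -> csmooth O g -> csmooth O h -> O q ->
  iter n (cpartial i) (fun x => g x + h x) q =
  iter n (cpartial i) g q + iter n (cpartial i) h q.
Proof.
move=> oO sg sh; elim: n q => [//|n IH] q Oq /=.
by rewrite (cpartial_ext _ oO IH Oq) (cpartialD _ (csmooth_iter i n sg) (csmooth_iter i n sh) Oq).
Qed.

Lemma citerZ O i n (c : C) h q : open O -> csmooth O h -> O q ->
  iter n (cpartial i) (fun x => c * h x) q = c * iter n (cpartial i) h q.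
Proof.
move=> oO sh; elim: n q => [//|n IH] q Oq /=.
rewrite (cpartial_ext _ oO IH Oq).
by rewrite (cpartialM _ (csmooth_cst O c) (csmooth_iter i n sh) Oq) cpartial_cst mul0r add0r.
Qed.

(** The product (s + 1) ... (s + n). *)
Definition rising (s n : nat) : R := (n + s)`!%:R / s`!%:R.

(* The bounds are the derivatives of c (1 - K x)^-(s+1) at 0. *)
Definition cbound i O (c K : R) (s : nat) h := forall n q, O q ->
  norm1c (iter n (cpartial i) h q) <= c * K ^+ n * rising s n.

Lemma fact_gt0R n : 0 < n`!%:R :> R.
Proof. by rewrite ltr0n fact_gt0. Qed.

Lemma rising_ge0 s n : 0 <= rising s n.
Proof. by rewrite divr_ge0. Qed.

Lemma rising0 n : rising 0 n = n`!%:R.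
Proof. by rewrite /rising addn0 divr1. Qed.

Lemma risings0 s : rising s 0 = 1.
Proof. by rewrite /rising divff// gt_eqF ?fact_gt0R. Qed.

Lemma risingS s n : rising s n.+1 = s.+1%:R * rising s.+1 n.
Proof.
rewrite /rising addSnnS (factS s) natrM invfM mulrCA mulVKf//.
Qed.

(** The model function has derivative c K (s+1) (1 - K x)^-(s+2). *)
Lemma cbound_partial i O c K s h : cbound i O c K s h ->
  cbound i O (c * K * s.+1%:R) K s.+1 (cpartial i h).
Proof.
move=> bh n q Oq; rewrite -iterSr; apply: le_trans (bh _ _ Oq) _.
by rewrite risingS exprS le_eqVlt; apply/orP; left; apply/eqP; ring.
Qed.

(** The model functions multiply, and the exponents (s+1) and (s'+1) add up to (s+s'+1) + 1. The
    common [K] is left unchanged. *)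
Lemma cboundM i O c c' K s s' g h : open O -> 0 <= c -> 0 <= c' -> 0 <= K ->
  csmooth O g -> csmooth O h -> cbound i O c K s g -> cbound i O c' K s' h ->
  cbound i O (c * c') K (s + s').+1 (fun x => g x * h x).
Proof.
move=> oO c0 c0' K0 sg sh bg bh n q Oq.
(* The product of the a-th and b-th derivatives has model exponent -(T a b + 1). The two terms of
   the product rule recombine because (a+s+1) + (b+s'+1) = T a b + 1. *)
pose T a b := (a + b + (s + s').+1)%N.
have key m a b x : O x ->
    norm1c (iter m (cpartial i) (fun x => iter a (cpartial i) g x * iter b (cpartial i) h x) x)
    <= c * c' * K ^+ (m + a + b) *
       (rising s a * rising s' b * ((m + T a b)`!%:R / (T a b)`!%:R)).
  elim: m a b x => [|m IH] a b x Ox.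
    rewrite /= divff ?gt_eqF ?fact_gt0R// mulr1 exprD.
    apply: le_trans (norm1cM _ _) _.
    apply: le_trans (ler_pM (norm1c_ge0 _) (norm1c_ge0 _) (bg _ _ Ox) (bh _ _ Ox)) _.
    by rewrite le_eqVlt; apply/orP; left; apply/eqP; ring.
  rewrite iterSr.
  rewrite (citer_ext i m oO (h := fun x =>
    iter a.+1 (cpartial i) g x * iter b (cpartial i) h x +
    iter a (cpartial i) g x * iter b.+1 (cpartial i) h x) _ Ox); last first.
    by move=> y Oy; rewrite (cpartialM _ (csmooth_iter i a sg) (csmooth_iter i b sh) Oy).
  rewrite (citerD _ _ oO _ _ Ox); last 2 first.
  - exact: csmoothM oO (csmooth_iter i a.+1 sg) (csmooth_iter i b sh).
  - exact: csmoothM oO (csmooth_iter i a sg) (csmooth_iter i b.+1 sh).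
  apply: le_trans (norm1cD _ _) _.
  apply: le_trans (lerD (IH _ _ _ Ox) (IH _ _ _ Ox)) _.
  rewrite le_eqVlt; apply/orP; left; apply/eqP.
  have -> : T a.+1 b = (T a b).+1 by rewrite /T.
  have -> : T a b.+1 = (T a b).+1 by rewrite /T; lia.
  rewrite !addnS !addSn !factS.
  have -> : rising s a.+1 = (a + s).+1%:R * rising s a.
    by rewrite /rising addSn factS natrM mulrA.
  have -> : rising s' b.+1 = (b + s').+1%:R * rising s' b.
    by rewrite /rising addSn factS natrM mulrA.
  rewrite !natrM.
  have F := lt0r_neq0 (fact_gt0R (T a b)).
  have E : (T a b).+1%:R = (a + s).+1%:R + (b + s').+1%:R :> R.
    by rewrite -natrD; congr (_%:R); rewrite /T; lia.
  have N0 : (T a b).+1%:R != 0 :> R by rewrite pnatr_eq0.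
  have N0' : (a + s).+1%:R + (b + s').+1%:R != 0 :> R by rewrite -E.
  rewrite E; move: (T a b)`!%:R F (m + T a b)`!%:R (m + T a b).+1%:R N0'.
  move: (rising s a) (rising s' b) ((a + s).+1%:R : R) ((b + s').+1%:R : R).
  by move=> r1 r2 x1 x2 t t0 w w1 N0'; field; rewrite t0.
have := key n 0%N 0%N q Oq => /= /le_trans; apply.
by rewrite !addn0 !risings0 !mul1r.
Qed.

Lemma cbound_le_K i O c K K' s h : 0 <= c -> 0 <= K -> K <= K' ->
  cbound i O c K s h -> cbound i O c K' s h.
Proof.
move=> c0 K0 KK bh n q Oq; apply: le_trans (bh _ _ Oq) _.
rewrite ler_wpM2r ?rising_ge0// ler_wpM2l//.
by apply: lerXn2r => //; rewrite nnegrE// (le_trans K0 KK).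
Qed.

Lemma rising_le s n : rising s n <= 2 ^+ (n + s) * n`!%:R.
Proof.
rewrite ler_pdivrMr ?fact_gt0R// -natrX -!natrM ler_nat.
have := bin_fact (leq_addl n s); rewrite addnK => <-.
rewrite -mulnA [(_`! * _)%N]mulnC leq_mul2r; apply/orP; right.
have := Pascal 1 1 (n + s); rewrite addn1 => ->.
rewrite (bigD1 (inord s))//= inordK ?ltnS ?leq_addl//.
by rewrite !exp1n !muln1 leq_addr.
Qed.

(** The pole order is traded for a doubled ratio, as the binomial coefficient C(n+s,s) is at most
    2^(n+s). *)
Lemma cbound0 i O c K s h : 0 <= c -> 0 <= K -> cbound i O c K s h ->
  cbound i O (c * 2 ^+ s) (2 * K) 0 h.
Proof.
move=> c0 K0 bh n q Oq; apply: le_trans (bh _ _ Oq) _; rewrite rising0.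
apply: le_trans (ler_wpM2l _ (rising_le s n)) _; first by rewrite mulr_ge0 ?exprn_ge0.
by rewrite exprMn exprD le_eqVlt; apply/orP; left; apply/eqP; ring.
Qed.

(** Differentiating u^j g, with g of pole order s, gives terms with (j, s+1) and (j+1, s+2): the sum
    j + s grows by at most 3, whence the step of this product. *)
Definition risingV (n x : nat) : nat := \prod_(k < n) (x + 1 + 3 * k).

Lemma risingVS n x : risingV n.+1 x = (x.+1 * risingV n (x + 3))%N.
Proof.
rewrite /risingV big_ord_recl /= muln0 addn0 addn1; congr (_ * _)%N.
by apply: eq_bigr => k _; rewrite /bump /=; lia.
Qed.

Lemma risingV_mono n x y : (x <= y)%N -> (risingV n x <= risingV n y)%N.
Proof. by move=> xy; apply: leq_prod => k _; rewrite !leq_add2r. Qed.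

Lemma risingV_le n : (risingV n 1 <= 3 ^ n * n`!)%N.
Proof.
elim: n => [|n IH]; first by rewrite /risingV big_ord0.
rewrite /risingV big_ord_recr /= -/(risingV n 1) expnS factS.
apply: leq_trans (leq_mul IH (leqnn _)) _; nia.
Qed.

(* Induction on the order of derivation, for all [u ^ j * h] at once, from
   d(u^j h) = u^j dh - j u^(j+1) (h dB). *)
Lemma cboundV i O c K beta h : open O -> 0 <= c -> 0 <= K -> 0 <= beta ->
  (forall q, O q -> h q != 0) ->
  (forall q, O q -> norm1c (h q)^-1 <= beta) ->
  csmooth O h -> cbound i O c K 0 h ->
  cbound i O beta (3 * (K * (1 + beta * c))) 0 (fun x => (h x)^-1).
Proof.
move=> oO c0 K0 b0 h0 hb sh bh.
pose u x := (h x)^-1; have su : csmooth O u := csmoothV oO h0 sh.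
have sX (j : nat) : csmooth O (fun x => u x ^+ j).
  elim: j => [|j IH]; first exact: csmooth_cst.
  by apply: csmooth_ext oO _ (csmoothM oO su IH) => x _; rewrite exprS.
have dX (j : nat) x : O x -> cpartial i (fun x => u x ^+ j) x = - (u x ^+ j.+1 *+ j) * cpartial i h x.
  elim: j => [|j IH] Ox; first by rewrite cpartial_cst mulr0n oppr0 mul0r.
  rewrite (@cpartial_ext _ O _ (fun x => u x * u x ^+ j) _ _ oO _ Ox); last first.
    by move=> y _; rewrite exprS.
  rewrite (cpartialM _ su (sX j) Ox) (IH Ox) (cpartialV _ oO h0 sh Ox) -/(u x).
  by rewrite mulrS !exprS expr0 -[_ *+ j]mulr_natr -[_ *+ j in RHS]mulr_natr; ring.
pose L := K * (1 + beta * c).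
have L0 : 0 <= L by rewrite mulr_ge0// addr_ge0// mulr_ge0.
have bX (j : nat) x : O x -> norm1c (u x ^+ j) <= beta ^+ j.
  move=> Ox; elim: j => [|j IH]; first by rewrite /norm1c /= normr1 normr0 addr0.
  rewrite !exprS; apply: le_trans (norm1cM _ _) _.
  by apply: ler_pM; rewrite ?norm1c_ge0//; exact: hb.
have key n : forall (j : nat) c' s g, 0 <= c' -> csmooth O g -> cbound i O c' K s g -> forall x, O x ->
    norm1c (iter n (cpartial i) (fun x => u x ^+ j * g x) x) <=
      c' * beta ^+ j * L ^+ n * (risingV n (j + s))%:R.
  elim: n => [|n IH] j c' s g c0' sg bg x Ox.
    rewrite /= /risingV big_ord0 !mulr1 [leRHS]mulrC; apply: le_trans (norm1cM _ _) _.
    apply: ler_pM; rewrite ?norm1c_ge0//; first exact: bX.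
    by have := bg 0%N x Ox; rewrite risings0 !mulr1.
  rewrite iterSr.
  rewrite (citer_ext i n oO (h := fun x => u x ^+ j * cpartial i g x +
      (- j%:R) * (u x ^+ j.+1 * (g x * cpartial i h x))) _ Ox); last first.
    move=> y Oy; rewrite (cpartialM _ (sX j) sg Oy) (dX _ _ Oy) -[_ *+ j]mulr_natr; ring.
  have sgp := csmooth_partial i sg; have shp := csmooth_partial i sh.
  have s1 := csmoothM oO (sX j) sgp.
  have s2 := csmoothM oO (sX j.+1) (csmoothM oO sg shp).
  rewrite (citerD _ _ oO s1 (csmoothM oO (csmooth_cst O (- j%:R)) s2) Ox) (citerZ _ _ _ oO s2 Ox).
  apply: le_trans (norm1cD _ _) _.
  rewrite mulNr norm1cN mulr_natl norm1cMn.
  have c1 : 0 <= c' * K * s.+1%:R by rewrite !mulr_ge0.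
  have h1 := IH j _ _ _ c1 sgp (cbound_partial bg) x Ox.
  have bhp := cbound_partial bh.
  have c2 : 0 <= c * K * 1%:R by rewrite !mulr_ge0.
  have h2 := IH j.+1 _ _ _ (mulr_ge0 c0' c2) (csmoothM oO sg shp)
    (cboundM oO c0' c2 K0 sg shp bg bhp) x Ox.
  rewrite -[_ *+ j]mulr_natr.
  apply: le_trans (lerD h1 (ler_wpM2r (ler0n R j) h2)) _.
  rewrite risingVS natrM.
  have r1 : (risingV n (j + s.+1))%:R <= (risingV n (j + s + 3))%:R :> R.
    by rewrite ler_nat risingV_mono// addnS -addn1 leq_add2l.
  have -> : (j.+1 + (s + 1).+1 = j + s + 3)%N by rewrite addn1 addSnnS -addnA addn3.
  apply: (@le_trans _ _ (c' * beta ^+ j * L ^+ n * (risingV n (j + s + 3))%:R *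
       (K * (s.+1%:R + j%:R * (beta * c))))).
    rewrite exprS.
    have := ler_wpM2l (_ : 0 <= c' * K * s.+1%:R * beta ^+ j * L ^+ n) r1.
    rewrite !mulr_ge0 ?exprn_ge0// => /(_ isT) H; lra.
  set M := c' * beta ^+ j * L ^+ n * (risingV n (j + s + 3))%:R.
  have M0 : 0 <= M by rewrite !mulr_ge0 ?exprn_ge0.
  have -> : c' * beta ^+ j * L ^+ n.+1 * ((j + s).+1%:R * (risingV n (j + s + 3))%:R) =
     M * (K * ((1 + beta * c) * (j + s).+1%:R)).
    by rewrite /M exprS {1}/L; ring.
  apply: ler_wpM2l => //; apply: ler_wpM2l => //.
  rewrite -addnS natrD.
  have X0 : 0 <= beta * c by rewrite mulr_ge0.
  have j0 : 0 <= j%:R :> R by [].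
  have s0 : 0 <= s.+1%:R :> R by [].
  by move: (beta * c) (j%:R) (s.+1%:R) X0 j0 s0 => X y z *; nra.
move=> n q Oq; rewrite rising0.
have := key n 1%N 1 0%N (fun=> 1) ler01 (csmooth_cst O 1) _ q Oq.
rewrite (citer_ext i n oO (h := u) _ Oq); last by move=> x _; rewrite mulr1.
rewrite mul1r expr1 addn0 => H; apply: le_trans (H _) _.
  case=> [|m] x Ox; first by rewrite /= /norm1c /= normr1 normr0 addr0 rising0 !mulr1.
  rewrite iterSr (citer_ext i m oO (h := fun=> 0) _ Ox); last by move=> y _; exact: cpartial_cst.
  have -> : iter m (cpartial i) (fun=> 0) x = 0.
    elim: m x Ox => [//|m IHm] x Ox /=.
    by rewrite (cpartial_ext _ oO IHm Ox) cpartial_cst.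
  by rewrite norm1c0 mul1r mulr_ge0 ?exprn_ge0 ?rising_ge0.
rewrite -/L [(3 * L) ^+ n]exprMn.
have H3 : (risingV n 1)%:R <= 3 ^+ n * n`!%:R :> R by rewrite -natrX -natrM ler_nat risingV_le.
have := ler_wpM2l (mulr_ge0 b0 (exprn_ge0 n L0)) H3.
move: (L ^+ n) (3 ^+ n : R) ((risingV n 1)%:R : R) (n`!%:R : R) => x y z w; lra.
Qed.

End DerivativeBounds.

(** * Functions with geometric derivative bounds, and Taylor sums with moving centre *)

Section Analytic.
Variable R : realType.
Local Notation V := (M4 R).
Local Notation C := (Cx R).
Local Notation e_ := (@basis4 R).
Implicit Types (f g h u : V -> C) (O : set V) (i j : 'I_4).

Definition cube (p : V) (r : R) : set V := [set q | `|q - p| < r].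

Lemma cube_open p r : open (cube p r).
Proof.
rewrite openE => q qp; apply/nbhs_ballP; exists (r - `|q - p|).
  by rewrite /= subr_gt0.
move=> z; rewrite -ball_normE /= => zq; rewrite /cube /= -(subrKA q).
by apply: le_lt_trans (ler_normD _ _) _; rewrite distrC -ltrBrDr.
Qed.

Lemma cube_center (p : V) r : 0 < r -> cube p r p.
Proof. by rewrite /cube /= subrr normr0. Qed.

Lemma cube_sub (p : V) r r' : r <= r' -> cube p r `<=` cube p r'.
Proof. by move=> rr q /lt_le_trans; exact. Qed.

Lemma open_cube O p : open O -> O p -> exists2 r, 0 < r & cube p r `<=` O.
Proof. by move=> oO Op; have [r r0 h] := ball_sub oO Op; exists r. Qed.

(** Derivatives along a single axis are enough for what follows. The constants are existential,
    which makes the predicate stable under sums, products and inverses. *)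
Definition abound i O h := csmooth O h /\
  exists c K : R, [/\ 0 <= c, 0 <= K & cbound i O c K 0 h].

Lemma abound_sub O O' i h : O' `<=` O -> abound i O h -> abound i O' h.
Proof.
move=> s [sh [c [K [c0 K0 b]]]]; split; first exact: csmooth_sub s sh.
by exists c, K; split=> // n q /s; exact: b.
Qed.

Lemma abound_ext O i g h : open O -> (forall q, O q -> g q = h q) ->
  abound i O g -> abound i O h.
Proof.
move=> oO gh [sg [c [K [c0 K0 b]]]]; split; first exact: csmooth_ext oO gh sg.
exists c, K; split=> // n q Oq.
by rewrite -(citer_ext i n oO gh Oq); exact: b.
Qed.

Lemma aboundM O i g h : open O -> abound i O g -> abound i O h ->
  abound i O (fun x => g x * h x).
Proof.
move=> oO [sg [c [K [c0 K0 b]]]] [sh [c' [K' [c0' K0' b']]]].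
split; first exact: csmoothM.
pose M := Num.max K K'.
have M0 : 0 <= M by rewrite le_max K0.
have bg := cbound_le_K c0 K0 (_ : K <= M) b; rewrite le_max lexx in bg.
have bh := cbound_le_K c0' K0' (_ : K' <= M) b'; rewrite le_max lexx orbT in bh.
have bm := cboundM oO c0 c0' M0 sg sh (bg isT) (bh isT).
exists (c * c' * 2 ^+ 1), (2 * M); split; rewrite ?mulr_ge0//.
exact: cbound0 (mulr_ge0 c0 c0') M0 bm.
Qed.

Lemma aboundD O i g h : open O -> abound i O g -> abound i O h ->
  abound i O (fun x => g x + h x).
Proof.
move=> oO [sg [c [K [c0 K0 b]]]] [sh [c' [K' [c0' K0' b']]]].
split; first exact: csmoothD.
pose M := Num.max K K'.
have M0 : 0 <= M by rewrite le_max K0.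
have bg := cbound_le_K c0 K0 (_ : K <= M) b; rewrite le_max lexx in bg.
have bh := cbound_le_K c0' K0' (_ : K' <= M) b'; rewrite le_max lexx orbT in bh.
exists (c + c'), M; split=> //; first exact: addr_ge0.
move=> n q Oq; rewrite (citerD _ _ oO sg sh Oq).
apply: le_trans (norm1cD _ _) _; rewrite !mulrDl.
by apply: lerD; [exact: bg|exact: bh].
Qed.

Lemma abound_cst O i (c : C) : open O -> abound i O (fun=> c).
Proof.
move=> oO; split; first exact: csmooth_cst.
exists (norm1c c), 0; split=> //; first exact: norm1c_ge0.
case=> [|n] q Oq; first by rewrite /= risings0 !mulr1.
rewrite iterSr (citer_ext i n oO (h := fun=> 0) _ Oq); last by move=> y _; exact: cpartial_cst.
have -> : iter n (cpartial i) (fun=> 0 : C) q = 0.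
  elim: n q Oq => [//|m IHm] x Ox /=.
  by rewrite (cpartial_ext _ oO IHm Ox) cpartial_cst.
by rewrite norm1c0 mulr_ge0 ?rising_ge0// mulr_ge0 ?norm1c_ge0 ?exprn_ge0.
Qed.

Lemma aboundN O i g : open O -> abound i O g -> abound i O (fun x => - g x).
Proof.
move=> oO ag; apply: abound_ext oO _ (aboundM oO (abound_cst i (-1) oO) ag) => q _.
by rewrite mulN1r.
Qed.

Lemma aboundV O i (beta : R) h : open O -> (forall q, O q -> h q != 0) ->
  (forall q, O q -> norm1c (h q)^-1 <= beta) -> 0 <= beta ->
  abound i O h -> abound i O (fun x => (h x)^-1).
Proof.
move=> oO h0 hb b0 [sh [c [K [c0 K0 b]]]]; split; first exact: csmoothV.
exists beta, (3 * (K * (1 + beta * c))); split=> //.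
  by rewrite mulr_ge0// mulr_ge0// addr_ge0// mulr_ge0.
exact: cboundV.
Qed.

Definition cpartials (l : seq 'I_4) f := foldr (fun i g => cpartial i g) f l.

Lemma re_cpartials l f : re_part (cpartials l f) = partials l (re_part f).
Proof. by elim: l => //= i l IH; rewrite -IH. Qed.

Lemma im_cpartials l f : im_part (cpartials l f) = partials l (im_part f).
Proof. by elim: l => //= i l IH; rewrite -IH. Qed.

Lemma csmooth_cpartials O l f : csmooth O f -> csmooth O (cpartials l f).
Proof. by move=> sf; elim: l => //= i l IH; exact: csmooth_partial. Qed.

Lemma iter_cpartials i n l f :
  iter n (cpartial i) (cpartials l f) = cpartials (nseq n i ++ l) f.
Proof. by elim: n => //= n ->. Qed.

(** After the derivatives of [l], n further ones cost (n + |l|)! = |l|! [rising |l| n]: a bound of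
    pole order |l|, which [cbound0] brings back to 0. *)
Lemma analytic_abound O f p : open O -> O p -> csmooth O f ->
  real_analytic_at (re_part f) p -> real_analytic_at (im_part f) p ->
  exists r, [/\ 0 < r, cube p r `<=` O & forall i l, abound i (cube p r) (cpartials l f)].
Proof.
move=> oO Op [rf imf] ra ia.
have [r1 [S1 [K1 [r10 S10 K10 b1]]]] := analytic_partials_bound oO Op rf ra.
have [r2 [S2 [K2 [r20 S20 K20 b2]]]] := analytic_partials_bound oO Op imf ia.
have [r3 r30 sub] := open_cube oO Op.
pose r := Num.min r1 (Num.min r2 r3).
have [rr1 [rr2 rr3]] : r <= r1 /\ r <= r2 /\ r <= r3 by rewrite !ge_min !lexx !orbT.
exists r; split; first by rewrite !lt_min r10 r20.
  by apply: subset_trans sub; exact: cube_sub.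
move=> i l; split.
  by apply: csmooth_sub (csmooth_cpartials l (conj rf imf)); apply: subset_trans sub; exact: cube_sub.
pose K := Num.max K1 K2.
have K0 : 0 < K by rewrite lt_max K10.
have SS0 : 0 <= S1 + S2 by rewrite addr_ge0.
exists ((S1 + S2) * K ^+ size l * (size l)`!%:R * 2 ^+ size l), (2 * K); split.
- by rewrite !mulr_ge0 ?exprn_ge0// ltW.
- by rewrite mulr_ge0// ltW.
apply: cbound0; [by rewrite !mulr_ge0 ?exprn_ge0// ltW|exact: ltW|].
move=> n q qr; rewrite iter_cpartials /norm1c.
have -> : complex.Re (cpartials (nseq n i ++ l) f q) = re_part (cpartials (nseq n i ++ l) f) q by [].
have -> : complex.Im (cpartials (nseq n i ++ l) f q) = im_part (cpartials (nseq n i ++ l) f) q by [].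
rewrite re_cpartials im_cpartials.
have h1 := b1 (nseq n i ++ l) q (lt_le_trans qr rr1).
have h2 := b2 (nseq n i ++ l) q (lt_le_trans qr rr2).
apply: le_trans (lerD h1 h2) _; rewrite size_cat size_nseq.
have E : (n + size l)`!%:R = (size l)`!%:R * rising R (size l) n :> R.
  by rewrite /rising mulrCA mulfV ?mulr1// gt_eqF ?fact_gt0R.
rewrite E -mulrDl.
have -> : (S1 + S2) * K ^+ size l * (size l)`!%:R * K ^+ n * rising R (size l) n =
  (S1 + S2) * K ^+ (n + size l) * ((size l)`!%:R * rising R (size l) n).
  by rewrite exprD; ring.
apply: ler_wpM2r; first by rewrite mulr_ge0 ?rising_ge0.
have [KK1 KK2] : K1 <= K /\ K2 <= K by rewrite !le_max !lexx orbT.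
by rewrite mulrDl; apply: lerD; apply: ler_wpM2l => //; apply: lerXn2r => //;
  rewrite nnegrE ltW.
Qed.

Lemma csmooth_exp O g n : open O -> csmooth O g -> csmooth O (fun x => g x ^+ n).
Proof.
move=> oO sg; elim: n => [|n IH]; first exact: csmooth_cst.
by apply: csmooth_ext oO _ (csmoothM oO sg IH) => x _; rewrite exprS.
Qed.

Lemma cpartial_exp O g n p i : open O -> csmooth O g -> O p ->
  cpartial i (fun x => g x ^+ n) p = n%:R * g p ^+ n.-1 * cpartial i g p.
Proof.
move=> oO sg Op; elim: n => [|n IH]; first by rewrite !mul0r; exact: cpartial_cst.
rewrite (@cpartial_ext R O _ (fun x => g x * g x ^+ n) _ _ oO _ Op); last first.
  by move=> y _; rewrite exprS.
rewrite (cpartialM _ sg (csmooth_exp n oO sg) Op) IH /= -natr1.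
by case: n {IH} => [|n]; rewrite /= ?exprS; ring.
Qed.

(* Taylor sum of a function of [phi] whose successive derivatives are [al k],
   expanded at x and evaluated at the value w of phi *)
Definition taylor (al : nat -> V -> C) (phi : V -> C) (w : C) n (x : V) : C :=
  \sum_(k < n) al k x * ((w - phi x) ^+ k * (k`!%:R)^-1).

Lemma csmooth_taylor O al phi w n : open O -> (forall k, csmooth O (al k)) ->
  csmooth O phi -> csmooth O (taylor al phi w n).
Proof.
move=> oO sal sphi; apply: csmooth_sum => // k.
apply: csmoothM => //; apply: csmoothM; [exact: oO| |exact: csmooth_cst].
by apply: csmooth_exp => //; apply: csmoothD => //; [exact: csmooth_cst|exact: csmoothN].
Qed.

(** The derivative of each coefficient cancels against the derivative of the next power of
    [w - phi]; only the contribution of the last coefficient remains. *)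
Lemma cpartial_taylor O al phi w n p i : open O -> (forall k, csmooth O (al k)) ->
  csmooth O phi -> O p ->
  (forall k q, O q -> cpartial i (al k) q = al k.+1 q * cpartial i phi q) ->
  cpartial i (taylor al phi w n.+1) p =
    al n.+1 p * cpartial i phi p * ((w - phi p) ^+ n * (n`!%:R)^-1).
Proof.
move=> oO sal sphi Op dal.
have swp : csmooth O (fun x => w - phi x).
  by apply: csmoothD => //; [exact: csmooth_cst|exact: csmoothN].
elim: n => [|n IH].
  rewrite (@cpartial_ext R O _ (al 0%N) _ _ oO _ Op) ?dal//; first by rewrite expr0 fact0 invr1 !mulr1.
  by move=> q _; rewrite /taylor big_ord_recl big_ord0 /= expr0 fact0 invr1 !mulr1 addr0.
have sX := csmooth_exp n.+1 oO swp.
have sY := csmoothM oO sX (csmooth_cst O (n.+1`!%:R)^-1).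
rewrite (@cpartial_ext R O _ (fun x => taylor al phi w n.+1 x +
    al n.+1 x * ((w - phi x) ^+ n.+1 * (n.+1`!%:R)^-1)) _ _ oO _ Op); last first.
  by move=> q _; rewrite /taylor big_ord_recr.
rewrite (cpartialD _ (csmooth_taylor w n.+1 oO sal sphi) (csmoothM oO (sal n.+1) sY) Op) IH.
rewrite (cpartialM _ (sal n.+1) sY Op) (cpartialM _ sX (csmooth_cst O _) Op).
rewrite cpartial_cst mulr0 addr0 (cpartial_exp _ _ oO swp Op) dal//.
rewrite (cpartialD _ (csmooth_cst O w) (csmoothN oO sphi) Op) cpartial_cst add0r.
rewrite (cpartialN _ sphi Op) /= factS natrM.
have n0 : n.+1%:R != 0 :> C by rewrite pnatr_eq0.
have f0 : n`!%:R != 0 :> C by rewrite pnatr_eq0 -lt0n fact_gt0.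
move: (n.+1%:R : C) (n`!%:R : C) n0 f0 => a b a0 b0; field.
by rewrite a0 b0.
Qed.

Lemma norm1c1 : norm1c (1 : C) = 1.
Proof. by rewrite /norm1c /= normr1 normr0 addr0. Qed.

Lemma norm1cX (z : C) n : norm1c (z ^+ n) <= norm1c z ^+ n.
Proof.
elim: n => [|n IH]; first by rewrite norm1c1.
rewrite !exprS; apply: le_trans (norm1cM _ _) _.
by apply: ler_wpM2l; rewrite ?norm1c_ge0.
Qed.

Lemma norm1c_divn (z : C) n : (0 < n)%N -> norm1c (z * (n%:R)^-1) = norm1c z / n%:R.
Proof.
move=> n0; have nr : n%:R != 0 :> R by rewrite pnatr_eq0 -lt0n.
have nc : n%:R != 0 :> C by rewrite pnatr_eq0 -lt0n.
apply: (mulIf nr); by rewrite mulfVK// mulr_natr -norm1cMn -[(z * _) *+ n]mulr_natr mulfVK.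
Qed.

Lemma line_mvt01 (f : V -> R) (q v : V) (h : R) :
  (forall t : R, 0 <= t <= 1 -> derivable f (q + (t * h) *: v) v) ->
  exists2 t : R, 0 <= t <= 1 & f (q + h *: v) - f q = h * 'D_v f (q + (t * h) *: v).
Proof.
move=> d; pose g (s : R) := f (q + (s * h) *: v).
pose df (s : R) := h * 'D_v f (q + (s * h) *: v).
have D (s : R) : 0 <= s <= 1 -> is_derive s 1 g (df s).
  move=> s01; pose k (t : R) := f (q + t *: v).
  have Dh : is_derive (s * h) 1 k ('D_v f (q + (s * h) *: v)).
    by apply: line_is_derive; exact: d.
  have : is_derive s (1 : R) (k \o (fun t : R => t * h)) ('D_v f (q + (s * h) *: v) * h).
    apply: is_derive1_comp.
    by apply: is_derive_eq; rewrite scaler0 add0r /GRing.scale /= mulr1.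
  by rewrite /df mulrC.
have Dg : forall s : R, s \in `]0, 1[ -> is_derive s 1 g (df s).
  by move=> s; rewrite in_itv /= => /andP[s0 s1]; apply: D; rewrite !ltW.
have Cg : {within `[0, 1], continuous g}.
  apply: derivable_within_continuous => s; rewrite in_itv /= => s01.
  by have [] := D s s01.
have [s sin Es] := MVT_segment ler01 Dg Cg.
rewrite in_itv /= in sin; exists s => //.
by move: Es; rewrite /g mul1r mul0r scale0r addr0 => ->; rewrite subr0 mulr1.
Qed.

(** The bound is doubled because the real and imaginary parts have separate intermediate points. *)
Lemma segment_increment O g (q : V) i (h eps : R) : csmooth O g ->
  (forall t : R, 0 <= t <= 1 -> O (q + (t * h) *: e_ i) /\
     norm1c (cpartial i g (q + (t * h) *: e_ i)) <= eps) ->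
  norm1c (g (q + h *: e_ i) - g q) <= `|h| * (eps + eps).
Proof.
move=> sg H.
have [|t t01 E] := @line_mvt01 (re_part g) q (e_ i) h.
  by move=> t /H[Ot _]; have [] := csmooth_derivable i sg Ot.
have [|s s01 E'] := @line_mvt01 (im_part g) q (e_ i) h.
  by move=> s /H[Os _]; have [] := csmooth_derivable i sg Os.
rewrite /norm1c raddfB raddfB; rewrite -/(re_part g _) -/(im_part g _) -/(re_part g q) -/(im_part g q).
rewrite E E' !normrM -mulrDr; apply: ler_wpM2l => //; apply: lerD.
  by apply: le_trans (H _ t01).2; rewrite lerDl.
by apply: le_trans (H _ s01).2; rewrite lerDr.
Qed.

(** The factor 8 counts four coordinates for each of the real and imaginary parts. *)
Lemma cube_increment p r g (x y : V) (eps : R) : csmooth (cube p r) g ->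
  cube p r x -> cube p r y ->
  (forall i q, cube p r q -> norm1c (cpartial i g q) <= eps) ->
  norm1c (g y - g x) <= 8 * `|y - x| * eps.
Proof.
move=> sg xr yr H.
have [|xi [xir E]] := @axis_mvt R (re_part g) p x y r xr yr.
  by move=> z zr i; have [] := csmooth_derivable i sg zr.
have [|et [etr E']] := @axis_mvt R (im_part g) p x y r xr yr.
  by move=> z zr i; have [] := csmooth_derivable i sg zr.
rewrite /norm1c raddfB raddfB; rewrite -/(re_part g _) -/(im_part g _) -/(re_part g x) -/(im_part g x).
rewrite E E'.
have B (F : 'I_4 -> R) : (forall i, `|F i| <= eps) ->
    `|\sum_i (y 0 i - x 0 i) * F i| <= 4 * `|y - x| * eps.
  move=> FH; apply: le_trans (ler_norm_sum _ _ _) _.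
  apply: le_trans (_ : \sum_(i < 4) `|y - x| * eps <= _); last first.
    by rewrite sumr_const card_ord -mulrA -[leLHS]mulr_natl.
  apply: ler_sum => i _; rewrite normrM; apply: ler_pM => //.
  by have := rv_coord_le (y - x) i; rewrite !mxE.
have -> : 8 * `|y - x| * eps = 4 * `|y - x| * eps + 4 * `|y - x| * eps by ring.
apply: lerD; apply: B => i.
  by apply: le_trans (H i _ (xir i)); rewrite lerDl.
by apply: le_trans (H i _ (etr i)); rewrite lerDr.
Qed.

End Analytic.

(** * The identity theorem on a cube *)

Section Identity.
Variable R : realType.
Local Notation V := (M4 R).
Local Notation C := (Cx R).
Local Notation e_ := (@basis4 R).
Implicit Types (f g h u : V -> C) (O : set V) (i j : 'I_4).

Lemma le0_of_geometric (X M : R) : (forall n, X <= M * (2^-1) ^+ n) -> X <= 0.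
Proof.
move=> H; have c : geometric M (2^-1 : R) @ \oo --> (0 : R).
  by apply: cvg_geometric; rewrite ger0_norm ?invr_ge0// invf_lt1// ltr1n.
by apply: (cvgr_to_ge c); near=> n; exact: H.
Unshelve. all: by end_near. Qed.

Definition coordC i (x : V) : C := Complex (x 0 i) 0.

Lemma derive_coord i (x v : V) : derivable (fun y : V => y 0 i) x v /\
  'D_v (fun y : V => y 0 i) x = v 0 i.
Proof.
have d := @derivable_id R V x v.
have d' := (derivable_mxP id x v).1 d 0 i; split=> //.
by have := derive_mx d => /matrixP/(_ 0 i); rewrite !mxE => <-; rewrite derive_id.
Qed.

Lemma csmooth_coordC O i : csmooth O (coordC i).
Proof.
split=> k; rewrite /re_part /im_part /coordC /=; last exact: Ck_cst.
case: k => [|k]; split=> //.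
- by move=> x _; exact: coord_continuous.
- by move=> x _; exact: coord_continuous.
move=> j; split=> [x _|]; first by have [] := derive_coord i x (e_ j).
have -> : (fun p : V => 'D_(e_ j) (fun p0 : V => p0 0 i) p) = fun=> e_ j 0 i.
  by apply/funext => p; have [_ ->] := derive_coord i p (e_ j).
exact: Ck_cst.
Qed.

Lemma cpartial_coordC i p : cpartial i (coordC i) p = 1.
Proof.
rewrite /cpartial /re_part /im_part /coordC /= derive_cst.
by have [_ ->] := derive_coord i p (e_ i); rewrite basis4E eqxx.
Qed.

Lemma cube_segment (p y : V) (r t s : R) i : cube p r y -> cube p r (y + t *: e_ i) ->
  0 <= s <= 1 -> cube p r (y + (s * t) *: e_ i).
Proof.
move=> yr tr /andP[s0 s1]; rewrite /cube /=.
have -> : y + (s * t) *: e_ i - p = (1 - s) *: (y - p) + s *: (y + t *: e_ i - p).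
  by apply/rowP => j; rewrite !mxE; ring.
apply: le_lt_trans (ler_normD _ _) _; rewrite !normrZ !ger0_norm ?subr_ge0//.
move: yr tr; rewrite /cube /= => yr tr.
have [->|sn] := eqVneq s 0; first by rewrite subr0 mul0r mul1r addr0.
have sp : 0 < s by rewrite lt_neqAle eq_sym sn.
have h1 : (1 - s) * `|y - p| <= (1 - s) * r by apply: ler_wpM2l; [rewrite subr_ge0|exact: ltW].
have h2 : s * `|y + t *: e_ i - p| < s * r by rewrite ltr_pM2l.
apply: lt_le_trans (ler_ltD h1 h2) _.
by rewrite le_eqVlt; apply/orP; left; apply/eqP; ring.
Qed.

Definition flat i h (y : V) := forall n, iter n (cpartial i) h y = 0.

Lemma norm1c_real (a : R) : norm1c (Complex a 0) = `|a|.
Proof. by rewrite /norm1c /= normr0 addr0. Qed.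

Lemma natS_le_expn n : (n.+1 <= 2 ^ n)%N.
Proof. by exact: ltn_expl. Qed.

(** The Taylor sum of the m-th derivative in the coordinate x_i vanishes at [y] by flatness and
    equals the m-th derivative at the far end. Its own derivative is a single remainder term, which
    tends to 0 along the short segment. *)
Lemma flat_step (p y : V) (r c K t : R) i h : csmooth (cube p r) h -> 0 <= c -> 0 <= K ->
  cbound i (cube p r) c K 0 h -> cube p r y -> flat i h y ->
  cube p r (y + t *: e_ i) -> `|t| * (8 * K) <= 1 -> flat i h (y + t *: e_ i).
Proof.
move=> sh c0 K0 bh yr fy ytr tK m.
pose al k := iter (m + k) (cpartial i) h.
have sal k : csmooth (cube p r) (al k) by exact: csmooth_iter.
pose w : C := Complex ((y + t *: e_ i) 0 i) 0.
pose T n := taylor al (coordC i) w n.+1.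
have sT n : csmooth (cube p r) (T n).
  exact: (csmooth_taylor w n.+1 (@cube_open R p r) sal (csmooth_coordC _ i)).
have Ty n : T n y = 0.
  by rewrite /T /taylor big1// => k _; rewrite /al fy mul0r.
have Tt n : T n (y + t *: e_ i) = al 0%N (y + t *: e_ i).
  rewrite /T /taylor big_ord_recl big1 ?addr0 /=; last first.
    by move=> k _; rewrite /w subrr expr0n /= mul0r mulr0.
  by rewrite expr0 fact0 invr1 !mulr1.
pose C0 := c * m`!%:R * (2 * K) ^+ m.+1.
have C00 : 0 <= C0 by rewrite !mulr_ge0 ?exprn_ge0 ?mulr_ge0.
have key n : norm1c (al 0%N (y + t *: e_ i)) <= (2 * `|t| * C0) * (2^-1) ^+ n.
  rewrite -(Tt n) -[T n _]subr0 -(Ty n).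
  pose eps := C0 * (2^-1) ^+ n.
  have -> : 2 * `|t| * C0 * 2^-1 ^+ n = `|t| * (eps + eps) by rewrite /eps; ring.
  apply: segment_increment (sT n) _ => s s01.
  have Bs := cube_segment yr ytr s01; split=> //.
  have -> := cpartial_taylor w n (@cube_open R p r) sal (csmooth_coordC _ i) Bs _.
    rewrite cpartial_coordC mulr1.
    apply: le_trans (norm1cM _ _) _; rewrite norm1c_divn ?fact_gt0//.
    have h1 := bh (m + n.+1)%N _ Bs.
    have h2 : norm1c ((w - coordC i (y + (s * t) *: e_ i)) ^+ n) <= `|t| ^+ n.
      apply: le_trans (norm1cX _ _) _; apply: lerXn2r; rewrite ?nnegrE ?norm1c_ge0//.
      have -> : w - coordC i (y + (s * t) *: e_ i) = Complex ((1 - s) * t) 0.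
        rewrite /w /coordC; apply/eqP; rewrite eq_complex /= !mxE !eqxx /= subr0 eqxx andbT.
        by apply/eqP; ring.
      rewrite norm1c_real normrM -[leRHS]mul1r; apply: ler_wpM2r => //.
      by rewrite ler_norml; case/andP: s01 => ? ?; apply/andP; split; lra.
    have h3 : 0 <= (n`!%:R : R)^-1 by rewrite invr_ge0.
    apply: le_trans (ler_pM (norm1c_ge0 _) _ h1 (ler_wpM2r h3 h2)) _.
      by rewrite mulr_ge0// norm1c_ge0.
    have h4 : rising R 0 (m + n.+1) <= m`!%:R * (2 ^+ (n.+1 + m) * n.+1`!%:R).
      have := rising_le R m n.+1; rewrite {1}/rising ler_pdivrMr ?fact_gt0R//.
      by rewrite rising0 addnC [leRHS]mulrC.
    have h5 : 0 <= c * K ^+ (m + n.+1) by rewrite mulr_ge0 ?exprn_ge0.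
    have h6 : 0 <= `|t| ^+ n * (n`!%:R)^-1 by rewrite mulr_ge0 ?exprn_ge0.
    apply: le_trans (ler_wpM2r h6 (ler_wpM2l h5 h4)) _.
    have -> : c * K ^+ (m + n.+1) * (m`!%:R * (2 ^+ (n.+1 + m) * n.+1`!%:R)) *
              (`|t| ^+ n * (n`!%:R)^-1) = C0 * ((`|t| * (2 * K)) ^+ n * n.+1%:R).
      rewrite /C0 factS natrM !exprMn addSn addnS !exprS !exprD.
      have f0 := lt0r_neq0 (fact_gt0R R n).
      by move: (n`!%:R : R) f0 => z z0; field.
    apply: ler_wpM2l => //.
    (* This is what the bound [|t| * (8 * K) <= 1] is for: 4^-n beats the factor n + 1 <= 2^n and
       still leaves 2^-n. *)
    have tk : `|t| * (2 * K) <= 4^-1 by lra.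
    have tk0 : 0 <= `|t| * (2 * K) by rewrite !mulr_ge0.
    have h7 : (`|t| * (2 * K)) ^+ n <= (4^-1) ^+ n.
      by apply: lerXn2r => //; rewrite nnegrE// invr_ge0.
    have h8 : n.+1%:R <= 2 ^+ n :> R by rewrite -natrX ler_nat natS_le_expn.
    apply: le_trans (ler_pM _ _ h7 h8) _ => //; first exact: exprn_ge0.
    rewrite -exprMn; apply: lerXn2r; rewrite ?nnegrE; lra.
  by move=> k q _; rewrite cpartial_coordC mulr1 /al addnS.
apply/eqP; rewrite -norm1c_eq0 eq_le norm1c_ge0 andbT.
by have := le0_of_geometric key; rewrite /al addn0.
Qed.

(** [K] is uniform on the cube, so the admissible step length does not shrink and finitely many
    steps cover the segment. *)
Lemma flat_segment (p y : V) (r t : R) i h : abound i (cube p r) h ->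
  cube p r y -> flat i h y -> cube p r (y + t *: e_ i) -> flat i h (y + t *: e_ i).
Proof.
move=> [sh [c [K [c0 K0 bh]]]] yr fy ytr.
pose N := (Num.truncn (`|t| * (8 * K))).+1.
have NN : `|t| * (8 * K) < N%:R by exact: truncnS_gt.
have N0 : N%:R != 0 :> R by rewrite pnatr_eq0.
have key k : (k <= N)%N -> flat i h (y + (k%:R / N%:R * t) *: e_ i).
  elim: k => [_|k IH kN]; first by rewrite !mul0r scale0r addr0.
  have E : y + (k.+1%:R / N%:R * t) *: e_ i = y + (k%:R / N%:R * t) *: e_ i + (t / N%:R) *: e_ i.
    by rewrite -addrA -scalerDl; congr (_ + _ *: _); rewrite -natr1; field.
  have inB l : (l <= N)%N -> cube p r (y + (l%:R / N%:R * t) *: e_ i).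
    move=> lN; apply: cube_segment => //; rewrite divr_ge0//= ler_pdivrMr ?mul1r ?ler_nat//.
  rewrite E; apply: flat_step sh c0 K0 bh _ (IH (ltnW kN)) _ _.
  - exact: inB (ltnW kN).
  - by rewrite -E; exact: inB.
  rewrite normrM normfV normr_nat mulrAC ler_pdivrMr ?ltr0n// mul1r; exact: ltW.
by have := key N (leqnn N); rewrite divff// mul1r.
Qed.

(** The point [x] is reached one axis at a time. What is transported is vanishing on a neighbourhood
    rather than at a point, since the move along the next axis needs flatness in another
    direction. *)
Lemma identity_cube (p q0 x : V) (r : R) h : (forall i, abound i (cube p r) h) ->
  cube p r q0 -> (\near q0, h q0 = 0) -> cube p r x -> h x = 0.
Proof.
move=> ah q0r h0 xr.
have step q i (t : R) : cube p r q -> cube p r (q + t *: e_ i) ->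
    (\near q, h q = 0) -> \forall z \near (q + t *: e_ i), h z = 0.
  move=> qr qtr hq.
  have [d d0 Hd] : exists2 d : R, 0 < d & forall z, cube q d z -> h z = 0 /\ cube p r z.
    have qr' : \near q, cube p r q by exact: open_nbhs_nbhs (conj (@cube_open R p r) qr).
    have : \forall z \near q, h z = 0 /\ cube p r z by near=> z; split; near: z.
    move=> /nbhs_ballP[d /= d0 H]; exists d => // z zq; apply: H.
    by rewrite -ball_normE /= distrC.
  have qtr' : \forall z \near (q + t *: e_ i), cube p r z.
    exact: open_nbhs_nbhs (conj (@cube_open R p r) qtr).
  have qd : \forall z \near (q + t *: e_ i), cube (q + t *: e_ i) d z.
    exact: open_nbhs_nbhs (conj (@cube_open R _ _) (cube_center _ d0)).
  near=> z.
  have zd : cube q d (z - t *: e_ i).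
    have : cube (q + t *: e_ i) d z by near: z.
    by rewrite /cube /= opprD addrA addrAC.
  have [_ zr] := Hd _ zd.
  have fl : flat i h (z - t *: e_ i).
    move=> n; rewrite (citer_ext i n (@cube_open R q d) (h := fun=> 0) _ zd); last by move=> y /Hd[].
    elim: n (z - t *: e_ i) {zr} zd => [//|n IHn] y yd /=.
    by rewrite (cpartial_ext _ (@cube_open R q d) IHn yd) cpartial_cst.
  have := flat_segment (t := t) (ah i) zr fl; rewrite subrK => /(_ _ 0%N); apply.
  by near: z.
pose P (n : nat) : V := \row_i (if (i < n)%N then x 0 i else q0 0 i).
have r0 : 0 < r by exact: le_lt_trans (normr_ge0 _) xr.
have Pr n : cube p r (P n).
  apply/rv_norm_lt => // i; rewrite !mxE; move: xr q0r => /(rv_norm_lt _ r0)/(_ i) + /(rv_norm_lt _ r0)/(_ i).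
  by rewrite !mxE; case: ifP.
have key n : (n <= 4)%N -> \forall z \near (P n), h z = 0.
  elim: n => [_|n IH n4].
    by have -> : P 0%N = q0 by apply/rowP => i; rewrite mxE.
  pose i := Ordinal n4.
  have E : P n.+1 = P n + (x 0 i - q0 0 i) *: e_ i.
    apply/rowP => j; rewrite !mxE eqxx /= ltnS leq_eqVlt.
    have -> : (j == n :> nat) = (j == i) by [].
    have [->|ji] := eqVneq j i; first by rewrite ltnn mulr1 addrC subrK.
    by rewrite mulr0 addr0.
  have := step (P n) i (x 0 i - q0 0 i) (Pr n); rewrite -E; apply=> //.
  exact: IH (ltnW n4).
have := nbhs_singleton (key 4%N (leqnn 4)).
by have -> : P 4%N = x by apply/rowP => i; rewrite mxE ltn_ord.
Unshelve. all: by end_near. Qed.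

End Identity.

(** * Complex power series: convergence with a rate, and differentiability *)

Section PowerSeries.
Variable R : realType.
Local Notation C := (Cx R).
Implicit Types (a b : nat -> C) (z w h : C).

Lemma norm_le_norm1c z : `|z| <= Complex (norm1c z) 0.
Proof.
rewrite normc_def lecR /norm1c.
rewrite -[leRHS]ger0_norm ?addr_ge0// -[leRHS]sqrtr_sqr; apply: ler_wsqrtr.
rewrite -(real_normK (num_real (complex.Re z))) -(real_normK (num_real (complex.Im z))).
by have := mulr_ge0 (normr_ge0 (complex.Re z)) (normr_ge0 (complex.Im z)); nra.
Qed.

Lemma norm1c_le_norm z : Complex (norm1c z) 0 <= 2 * `|z|.
Proof.
rewrite normc_def.
have -> : 2 * Complex (Num.sqrt (complex.Re z ^+ 2 + complex.Im z ^+ 2)) 0 =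
   Complex (2 * Num.sqrt (complex.Re z ^+ 2 + complex.Im z ^+ 2)) 0 :> C.
  by rewrite !mulr_natl; rewrite !mulr2n CxD addr0.
rewrite lecR /norm1c mulr_natl mulr2n; apply: lerD.
  by rewrite -[leLHS]sqrtr_sqr; apply: ler_wsqrtr; rewrite lerDl sqr_ge0.
by rewrite -[leLHS]sqrtr_sqr; apply: ler_wsqrtr; rewrite lerDr sqr_ge0.
Qed.

Definition psn a z n : C := \sum_(k < n) a k * z ^+ k.

Lemma psnS a z n : psn a z n.+1 = psn a z n + a n * z ^+ n.
Proof. by rewrite /psn big_ord_recr. Qed.

Lemma term_bound a c L x z k : 0 <= c -> 0 <= L -> 0 <= x ->
  (forall k, norm1c (a k) <= c * L ^+ k) -> norm1c z * L <= x ->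
  norm1c (a k * z ^+ k) <= c * x ^+ k.
Proof.
move=> c0 L0 x0 ha hz; apply: le_trans (norm1cM _ _) _.
apply: le_trans (ler_pM (norm1c_ge0 _) (norm1c_ge0 _) (ha k) (norm1cX _ _)) _.
rewrite -mulrA -exprMn; apply: ler_wpM2l => //.
by apply: lerXn2r; rewrite ?nnegrE// 1?mulrC// mulr_ge0 ?norm1c_ge0.
Qed.

Lemma psn_cauchy a c L z n m : 0 <= c -> 0 <= L ->
  (forall k, norm1c (a k) <= c * L ^+ k) -> norm1c z * L <= 2^-1 ->
  norm1c (psn a z (n + m) - psn a z n) <= 2 * c * (2^-1) ^+ n.
Proof.
move=> c0 L0 ha hz.
(* Subtracting the tail of the geometric series makes the bound inductive in [m]. *)
suff : norm1c (psn a z (n + m) - psn a z n) <= 2 * c * (2^-1) ^+ n - 2 * c * (2^-1) ^+ (n + m).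
  by move=> /le_trans; apply; rewrite gerBl mulr_ge0 ?mulr_ge0// exprn_ge0// invr_ge0.
elim: m => [|m IH]; first by rewrite addn0 !subrr norm1c0.
rewrite addnS psnS addrAC; apply: le_trans (norm1cD _ _) _.
have h2 : (0 : R) <= 2^-1 by rewrite invr_ge0.
apply: le_trans (lerD IH (term_bound (n + m) c0 L0 h2 ha hz)) _.
rewrite exprS; set y := _ ^+ (n + m); lra.
Qed.

Lemma psn_cvg a c L : 0 <= c -> 0 <= L -> (forall k, norm1c (a k) <= c * L ^+ k) ->
  exists rho : C -> C, forall z, norm1c z * L <= 2^-1 ->
    forall n, norm1c (rho z - psn a z n) <= 4 * c * (2^-1) ^+ n.
Proof.
move=> c0 L0 ha.
pose rho z : C := Complex (limn (fun n => complex.Re (psn a z n))) (limn (fun n => complex.Im (psn a z n))).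
exists rho => z hz n.
have cau (u : C -> R) : (forall x y, u x - u y = u (x - y)) ->
    (forall x, `|u x| <= norm1c x) ->
    `|limn (fun n => u (psn a z n)) - u (psn a z n)| <= 2 * c * (2^-1) ^+ n.
  move=> ub un.
  have near0 k m : `|u (psn a z (k + m)) - u (psn a z k)| <= 2 * c * (2^-1) ^+ k.
    by rewrite ub; apply: le_trans (un _) _; exact: psn_cauchy hz.
  have cv : cvgn (fun n => u (psn a z n)).
    apply/cauchy_cvgP/cauchy_exP => eps e0.
    have g0 : geometric (2 * c) (2^-1 : R) @ \oo --> (0 : R).
      by apply: cvg_geometric; rewrite ger0_norm ?invr_ge0// invf_lt1// ltr1n.
    have [N _ HN] : \forall k \near \oo, `|geometric (2 * c) (2^-1 : R) k| < eps.
      by move/cvgr0Pnorm_lt: g0; apply.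
    have bN k : (N <= k)%N -> `|u (psn a z N) - u (psn a z k)| < eps.
      move=> Nk; rewrite distrC -(subnKC Nk); apply: le_lt_trans (near0 _ _) _.
      by have := HN N (leqnn N); apply: le_lt_trans; exact: ler_norm.
    exists (u (psn a z N)).
    suff : \forall k \near \oo, ball (u (psn a z N)) eps (u (psn a z k)) by [].
    near=> k.
    by rewrite -ball_normE /=; apply: bN; near: k; exact: nbhs_infty_ge.
  have cv2 : `|u (psn a z m) - u (psn a z n)| @[m --> \oo] -->
      `|limn (fun n => u (psn a z n)) - u (psn a z n)|.
    by apply: cvg_norm; apply: cvgB => //; exact: cvg_cst.
  apply: (cvgr_to_le cv2); near=> m.
  have nm : (n <= m)%N by near: m; exact: nbhs_infty_ge.
  by rewrite -(subnKC nm); exact: near0.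
rewrite /norm1c !raddfB /=.
have hR := cau (@complex.Re R); have hI := cau (@complex.Im R).
apply: le_trans (lerD (hR _ _) (hI _ _)) _.
- by move=> x y; rewrite raddfB.
- by move=> x; rewrite lerDl.
- by move=> x y; rewrite raddfB.
- by move=> x; rewrite lerDr.
by move: (_ ^+ n) => y; lra.
Unshelve. all: by end_near. Qed.

(** The second-order remainder for k + 1 is z + h times that for k, plus k h^2 z^(k-1). The
    coefficient k^2 is chosen so that k^2 + k <= (k+1)^2 closes the induction. *)
Lemma exp_increment z h X k : 0 < X -> norm1c z <= X -> norm1c (z + h) <= X ->
  norm1c ((z + h) ^+ k - z ^+ k - k%:R * h * z ^+ k.-1) <=
    norm1c h ^+ 2 * X ^- 2 * k%:R ^+ 2 * X ^+ k.
Proof.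
move=> X0 zX zhX; elim: k => [|k IH].
  by rewrite subrr !mul0r subr0 norm1c0 expr0n /= mulr0 mul0r.
have -> : (z + h) ^+ k.+1 - z ^+ k.+1 - k.+1%:R * h * z ^+ k.+1.-1 =
    (z + h) * ((z + h) ^+ k - z ^+ k - k%:R * h * z ^+ k.-1) + h ^+ 2 * (k%:R * z ^+ k.-1).
  by rewrite !exprS expr0 -natr1; case: k {IH} => [|k] /=; rewrite ?exprS; ring.
apply: le_trans (norm1cD _ _) _.
apply: le_trans (lerD (norm1cM _ _) (norm1cM _ _)) _.
have h1 := ler_pM (norm1c_ge0 _) (norm1c_ge0 _) zhX IH.
have h2 : norm1c (k%:R * z ^+ k.-1) <= X ^- 2 * k%:R * X ^+ k.+1.
  case: k {IH h1} => [|k]; first by rewrite mul0r norm1c0 mulr0 mul0r.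
  rewrite mulr_natl norm1cMn -[leLHS]mulr_natr /= [leLHS]mulrC.
  have -> : X ^- 2 * k.+1%:R * X ^+ k.+2 = k.+1%:R * X ^+ k.
    by rewrite !exprS; field; exact: lt0r_neq0.
  apply: ler_wpM2l => //; apply: le_trans (norm1cX _ _) _.
  by apply: lerXn2r; rewrite ?nnegrE ?norm1c_ge0// ltW.
have h3 : norm1c (h ^+ 2) <= norm1c h ^+ 2 by exact: norm1cX.
have h4 := ler_pM (norm1c_ge0 _) (norm1c_ge0 _) h3 h2.
apply: le_trans (lerD h1 h4) _.
have -> : X * (norm1c h ^+ 2 * X ^- 2 * k%:R ^+ 2 * X ^+ k) +
   norm1c h ^+ 2 * (X ^- 2 * k%:R * X ^+ k.+1) =
   norm1c h ^+ 2 * X ^- 2 * X ^+ k.+1 * (k%:R ^+ 2 + k%:R) by rewrite (exprS X k); ring.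
have -> : norm1c h ^+ 2 * X ^- 2 * k.+1%:R ^+ 2 * X ^+ k.+1 =
   norm1c h ^+ 2 * X ^- 2 * X ^+ k.+1 * k.+1%:R ^+ 2 by ring.
apply: ler_wpM2l.
  by rewrite !mulr_ge0 ?invr_ge0 ?exprn_ge0 ?norm1c_ge0// ltW.
by rewrite -!natrX -natrD ler_nat; nia.
Qed.

Lemma sqr_le_expn4 k : (k ^ 2 <= 4 ^ k)%N.
Proof.
have -> : (4 ^ k = (2 ^ k) ^ 2)%N by rewrite -expnM mulnC expnM.
by rewrite leq_exp2r// ltnW// ltn_expl.
Qed.

(** The candidate derivative is the sum of the formally differentiated series. The quadratic error
    estimate is proved for partial sums, uniformly in n, and then passes to the limit. *)
Lemma pseries_derivable a c L : 0 <= c -> 0 < L ->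
  (forall k, norm1c (a k) <= c * L ^+ k) ->
  exists rho : C -> C, (forall z, norm1c z * L <= 16^-1 ->
    forall n, norm1c (rho z - psn a z n) <= 4 * c * (2^-1) ^+ n) /\
    (forall z, norm1c z * L < 16^-1 -> derivable rho z 1).
Proof.
move=> c0 L0 ha; have L0' := ltW L0.
have [rho Hrho] := psn_cvg c0 L0' ha.
have rhoB z : norm1c z * L <= 16^-1 -> forall n, norm1c (rho z - psn a z n) <= 4 * c * (2^-1) ^+ n.
  by move=> hz; apply: Hrho; lra.
exists rho; split=> // z hz.
pose b k : C := k.+1%:R * a k.+1.
have cL0 : 0 <= c * L by rewrite mulr_ge0.
have hb k : norm1c (b k) <= (c * L) * (2 * L) ^+ k.
  rewrite /b mulr_natl norm1cMn -[leLHS]mulr_natr [leLHS]mulrC.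
  apply: le_trans (ler_wpM2l _ (ha _)) _ => //.
  have h8 : k.+1%:R <= 2 ^+ k :> R by rewrite -natrX ler_nat natS_le_expn.
  have := ler_wpM2r (_ : 0 <= c * L ^+ k.+1) h8.
  rewrite mulr_ge0 ?exprn_ge0// => /(_ isT) /le_trans; apply.
  by rewrite exprMn exprS le_eqVlt; apply/orP; left; apply/eqP; ring.
have [rho' Hrho'] := psn_cvg cL0 (mulr_ge0 (ler0n R 2) L0') hb.
have hz' : norm1c z * (2 * L) <= 2^-1 by lra.
(* At this radius the k-th remainder carries k^2 16^-k <= (4/16)^k <= 2^-k, which is summable. The
   small disc of the statement comes from here. *)
pose X := (16 * L)^-1; have X0 : 0 < X by rewrite invr_gt0 mulr_gt0.
have LX : L * X = 16^-1 by rewrite /X; field; exact: lt0r_neq0.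
have leX y : norm1c y * L <= 16^-1 -> norm1c y <= X.
  by move=> h; rewrite /X invfM ler_pdivlMr.
pose M := 2 * c * X ^- 2; have M0 : 0 <= M.
  by rewrite !mulr_ge0// invr_ge0 exprn_ge0// ltW.
have quad h : norm1c (z + h) * L <= 16^-1 ->
    norm1c (rho (z + h) - rho z - h * rho' z) <= M * norm1c h ^+ 2.
  move=> hzh.
  have E n : psn a (z + h) n.+1 - psn a z n.+1 - h * psn b z n =
     \sum_(k < n.+1) a k * ((z + h) ^+ k - z ^+ k - k%:R * h * z ^+ k.-1).
    rewrite /psn [in RHS](eq_bigr (fun k : 'I_n.+1 => a k * (z + h) ^+ k - a k * z ^+ k
      - h * (k%:R * a k * z ^+ k.-1))); last by move=> k _; ring.
    rewrite !sumrB; congr (_ - _ - _).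
    rewrite [in RHS]big_ord_recl /= !mul0r mulr0 add0r mulr_sumr.
    by apply: eq_bigr => k _; rewrite /b.
  have fin n : norm1c (psn a (z + h) n.+1 - psn a z n.+1 - h * psn b z n) <= M * norm1c h ^+ 2.
    rewrite E; apply: le_trans (norm1c_sum _ _) _.
    have tb (k : nat) : norm1c (a k * ((z + h) ^+ k - z ^+ k - k%:R * h * z ^+ k.-1)) <=
        c * X ^- 2 * norm1c h ^+ 2 * (2^-1) ^+ k.
      apply: le_trans (norm1cM _ _) _.
      have inc := exp_increment k X0 (leX _ (ltW hz)) (leX _ hzh).
      apply: le_trans (ler_pM (norm1c_ge0 _) (norm1c_ge0 _) (ha k) inc) _.
      have -> : c * L ^+ k * (norm1c h ^+ 2 * X ^- 2 * k%:R ^+ 2 * X ^+ k) =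
         c * X ^- 2 * norm1c h ^+ 2 * (k%:R ^+ 2 * (L * X) ^+ k) by rewrite exprMn; ring.
      apply: ler_wpM2l.
        by rewrite !mulr_ge0 ?invr_ge0 ?exprn_ge0 ?norm1c_ge0// ltW.
      rewrite LX.
      have h9 : k%:R ^+ 2 <= 4 ^+ k :> R by rewrite -!natrX ler_nat sqr_le_expn4.
      apply: le_trans (ler_wpM2r _ h9) _; first by rewrite exprn_ge0// invr_ge0.
      by rewrite -exprMn; apply: lerXn2r; rewrite ?nnegrE; lra.
    apply: (@le_trans _ _ (\sum_(k < n.+1) c * X ^- 2 * norm1c h ^+ 2 * (2^-1) ^+ k)).
      by apply: ler_sum => k _; exact: tb.
    rewrite -mulr_sumr.
    have geo m : \sum_(k < m) (2^-1 : R) ^+ k <= 2 - (2^-1) ^+ m *+ 2.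
      elim: m => [|m IHm]; first by rewrite big_ord0 expr0 subrr.
      rewrite big_ord_recr /= exprS; move: IHm; move: (\sum_(k < m) _) (2^-1 ^+ m) => S y; lra.
    have g2 : \sum_(k < n.+1) (2^-1 : R) ^+ k <= 2.
      apply: le_trans (geo _) _; rewrite gerBl mulrn_wge0// exprn_ge0// invr_ge0//.
    have := ler_wpM2l (_ : 0 <= c * X ^- 2 * norm1c h ^+ 2) g2.
    rewrite !mulr_ge0 ?invr_ge0 ?exprn_ge0 ?norm1c_ge0 ?(ltW X0)// => /(_ isT) /le_trans; apply.
    by rewrite /M le_eqVlt; apply/orP; left; apply/eqP; ring.
  rewrite -subr_le0.
  pose M2 := 8 * c + 4 * (c * L) * norm1c h.
  apply: (@le0_of_geometric _ _ M2) => n; rewrite lerBlDr.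
  have -> : rho (z + h) - rho z - h * rho' z =
     (psn a (z + h) n.+1 - psn a z n.+1 - h * psn b z n) +
     ((rho (z + h) - psn a (z + h) n.+1) - (rho z - psn a z n.+1) - h * (rho' z - psn b z n)) by ring.
  apply: le_trans (norm1cD _ _) _; rewrite addrC; apply: lerD; last exact: fin.
  apply: le_trans (norm1cD _ _) _; rewrite norm1cN.
  apply: le_trans (lerD (norm1cD _ _) (norm1cM _ _)) _; rewrite norm1cN.
  have h1 := rhoB _ hzh n.+1; have h2 := rhoB _ (ltW hz) n.+1.
  have h3 := ler_wpM2l (norm1c_ge0 h) (Hrho' _ hz' n).
  apply: le_trans (lerD (lerD h1 h2) h3) _.
  rewrite /M2 exprS; have y0 : 0 <= (2^-1 : R) ^+ n by rewrite exprn_ge0// invr_ge0.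
  have := mulr_ge0 c0 y0; move: (_ ^+ n) y0 => y y0 cy; lra.
apply/cvg_ex; exists (rho' z); apply/cvgrPdist_le => /= eps e0.
have [er E] : exists er : R, eps = Complex er 0 /\ 0 < er.
  by case: eps e0 => x y; rewrite ltcE /= => /andP[/eqP -> ?]; exists x.
case: E => -> er0.
pose del := Num.min ((16^-1 - norm1c z * L) / L) (er / (2 * (M + 1))).
have del0 : 0 < del.
  rewrite lt_min !divr_gt0 ?subr_gt0//; lra.
near=> h.
have h0 : h != 0 by near: h; exact: (@nbhs_dnbhs_neq C 0).
have hd : norm1c h < del.
  have : `|h| < Complex (del / 2) 0.
    near: h; apply: (@dnbhs0_lt C C (Complex (del / 2) 0)); rewrite ltcE /= eqxx /=; exact: divr_gt0.
  have := norm1c_le_norm h; rewrite normc_def; move: (Num.sqrt _) => s.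
  have -> : 2 * Complex s 0 = Complex (2 * s) 0 :> C by rewrite !mulr_natl !mulr2n CxD addr0.
  rewrite lecR ltcR => h1 h2; lra.
have hzh : norm1c (z + h) * L <= 16^-1.
  have : norm1c h * L < 16^-1 - norm1c z * L.
    by rewrite -ltr_pdivlMr//; apply: lt_le_trans hd _; rewrite ge_min lexx.
  have := ler_wpM2r L0' (norm1cD z h); lra.
have Q := quad h hzh.
have -> : rho' z - h^-1 *: (rho (h *: 1 + z) - rho z) =
   - (h^-1 * (rho (z + h) - rho z - h * rho' z)).
  rewrite (_ : h *: (1 : C) = h) ?(addrC h z); last exact: mulr1.
  rewrite -[h^-1 *: _]/(h^-1 * _); move: (rho (z + h)) (rho z) (rho' z) => A B D.
  by field.
rewrite normrN normrM normfV ler_pdivrMl ?normr_gt0//.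
apply: le_trans (norm_le_norm1c _) _.
have := norm1c_le_norm h; rewrite normc_def; move: (Num.sqrt _) => s.
have -> : 2 * Complex s 0 = Complex (2 * s) 0 :> C by rewrite !mulr_natl !mulr2n CxD addr0.
have -> : Complex s 0 * Complex er 0 = Complex (s * er) 0 :> C.
  by apply/eqP; rewrite eq_complex /= !mulr0 !mul0r subr0 addr0 !eqxx.
rewrite !lecR => hs; apply: le_trans Q _.
have hnn := norm1c_ge0 h.
have Mh : norm1c h * (2 * (M + 1)) <= er.
  rewrite -ler_pdivlMr ?mulr_gt0 ?ltr_wpDl//; apply: le_trans (ltW hd) _.
  by rewrite ge_min lexx orbT.
by move: (norm1c h) hs hnn Mh => n hs hnn Mh; nra.
Unshelve. all: by end_near. Qed.

End PowerSeries.

(** * A function whose differential is proportional to df is a holomorphic function of f *)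

Section FactorThrough.
Variable R : realType.
Local Notation V := (M4 R).
Local Notation C := (Cx R).
Local Notation e_ := (@basis4 R).
Implicit Types (f g h v : V -> C) (O : set V) (i j e : 'I_4).

Definition proportional_on O g f := forall i j q, O q ->
  cpartial i g q * cpartial j f q = cpartial j g q * cpartial i f q.

Lemma cube_norm_bound O i h q c K : cbound i O c K 0 h -> O q -> norm1c (h q) <= c.
Proof. by move=> b /(b 0%N); rewrite risings0 !mulr1. Qed.

Definition quotient_derivative e f v : V -> C :=
  fun x => cpartial e v x * (cpartial e f x)^-1.

(** The coefficients of [rho] are the successive derivatives of [v] with respect to [f] at [p],
    divided by factorials. The work lies in showing that they grow at most geometrically, with a
    ratio valid on the whole cube. *)
Lemma factor_through (p : V) (r F : R) f v e : 0 < r ->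
  csmooth (cube p r) f -> (forall q, cube p r q -> cpartial e f q != 0) ->
  (forall i q, cube p r q -> norm1c (cpartial i f q) <= F) ->
  abound e (cube p r) v -> abound e (cube p r) (fun x => (cpartial e f x)^-1) ->
  proportional_on (cube p r) v f ->
  exists (r' rad : R) (rho : C -> C), [/\ 0 < r', r' <= r,
    (forall z, norm1c (z - f p) < rad -> derivable rho z 1) &
    forall q, cube p r' q -> norm1c (f q - f p) < rad /\ v q = rho (f q)].
Proof.
move=> r0 sf fe0 HF [sv [cv [Kv [cv0 Kv0 bv]]]] [sm [M [Km [M0 Km0 bm]]]] prop.
have oB := @cube_open R p r; have pB := cube_center p r0.
have F0 : 0 <= F by apply: le_trans (HF e p pB); exact: norm1c_ge0.
pose K := Num.max Kv Km; have K0 : 0 <= K by rewrite le_max Kv0.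
have {}bv : cbound e (cube p r) cv K 0 v by apply: cbound_le_K bv; rewrite ?le_max ?lexx.
have {}bm : cbound e (cube p r) M K 0 (fun x => (cpartial e f x)^-1).
  by apply: cbound_le_K bm; rewrite ?le_max ?lexx ?orbT.
pose al k := iter k (quotient_derivative e f) v.
have sal k : csmooth (cube p r) (al k).
  by elim: k => [//|k IH] /=; apply: csmoothM => //; exact: csmooth_partial.
have dal i k q : cube p r q -> cpartial i (al k) q = al k.+1 q * cpartial i f q.
  move=> Bq.
  (* Proportionality propagates: if d(al k) = al (k+1) df, then taking the exterior derivative gives
     d(al (k+1)) /\ df = 0. In coordinates this is the symmetry of second derivatives. *)
  suff pk : proportional_on (cube p r) (al k) f.
    by rewrite /= /quotient_derivative mulrAC -(pk i e q Bq) mulfK ?fe0.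
  elim: k {q Bq} => [//|k IH] i1 i2 q Bq.
  have D j x : cube p r x -> cpartial j (al k) x = al k.+1 x * cpartial j f x.
    by move=> Bx; rewrite /= /quotient_derivative mulrAC -(IH j e x Bx) mulfK ?fe0.
  have D2 j1 j2 : cpartial j1 (cpartial j2 (al k)) q =
     cpartial j1 (al k.+1) q * cpartial j2 f q + al k.+1 q * cpartial j1 (cpartial j2 f) q.
    rewrite (cpartial_ext _ oB (D j2) Bq).
    by rewrite (cpartialM _ (sal k.+1) (csmooth_partial j2 sf) Bq).
  have := cpartial_comm i1 i2 oB (sal k) Bq.
  by rewrite !D2 (cpartial_comm i1 i2 oB sf Bq) => /addIr.
(* Each passage from k to k + 1 raises the pole order by 2 and multiplies the constant by (2k+1) K
   M, which is at most 2 K M (k+1); the ratio [K] is preserved. *)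
have bal k : exists ck, [/\ 0 <= ck, ck <= cv * (2 * K * M) ^+ k * k`!%:R &
    cbound e (cube p r) ck K k.*2 (al k)].
  elim: k => [|k [ck [ck0 ckle bk]]].
    by exists cv; split=> //; rewrite expr0 fact0 !mulr1.
  have bk' := cbound_partial bk.
  have c1 : 0 <= ck * K * (k.*2.+1)%:R by rewrite !mulr_ge0.
  exists (ck * K * (k.*2.+1)%:R * M); split.
  - exact: mulr_ge0.
  - rewrite exprS factS natrM.
    have KM : 0 <= K * M * (k.*2.+1)%:R by rewrite !mulr_ge0.
    have := ler_wpM2r KM ckle.
    set X := _ ^+ k; set Y := (k`!)%:R => h.
    have X0 : 0 <= X by rewrite exprn_ge0// !mulr_ge0.
    have h2 : (k.*2.+1)%:R <= 2 * k.+1%:R :> R by rewrite -natrM ler_nat mulnS -mul2n addnC -addn1 leq_add2l.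
    have h3 : 0 <= cv * X * Y * (K * M) by rewrite !mulr_ge0.
    have := ler_wpM2l h3 h2; move: h.
    move: (k.*2.+1)%:R (k.+1%:R : R) => a b; lra.
  - have := cboundM oB c1 M0 K0 (csmooth_partial e (sal k)) sm bk' bm.
    by rewrite addn0 doubleS.
pose L := 2 * K * M + 1.
have L0 : 0 < L by rewrite ltr_wpDl// !mulr_ge0.
have nal k q : cube p r q -> norm1c (al k q) <= cv * L ^+ k * k`!%:R.
  move=> Bq; have [ck [ck0 ckle bk]] := bal k.
  have := bk 0%N q Bq; rewrite risings0 !mulr1 => /le_trans; apply; apply: le_trans ckle _.
  apply: ler_wpM2r => //; apply: ler_wpM2l => //.
  by apply: lerXn2r; rewrite ?nnegrE ?(ltW L0) ?lerDl// !mulr_ge0.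
pose a k : C := al k p * (k`!%:R)^-1.
have ha k : norm1c (a k) <= cv * L ^+ k.
  rewrite /a norm1c_divn ?fact_gt0// ler_pdivrMr ?fact_gt0R//; exact: nal.
have [rho0 [rhoE rhod]] := pseries_derivable cv0 L0 ha.
(* Two points of the smaller cube are at most 2r' apart, so f varies by at most 16 r' (F+1); with
   512 this is at most 1/(32 L), inside the disc of radius 1/(16 L). *)
have [c [c0 cE]] : exists c : R, 0 < c /\ c = 512 by exists 512; split; [rewrite ltr0n|exact: erefl].
pose r' := Num.min r (c * (F + 1) * L)^-1.
have F10 : 0 < F + 1 by rewrite ltr_wpDl.
have r'0 : 0 < r' by rewrite lt_min r0 invr_gt0 !mulr_gt0.
have r'r : r' <= r by rewrite ge_min lexx.
have small x y : cube p r' x -> cube p r' y -> norm1c (f y - f x) * L < 16^-1.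
  move=> xr yr.
  have xB := cube_sub r'r xr; have yB := cube_sub r'r yr.
  have := cube_increment sf xB yB HF.
  have yx : `|y - x| <= r' + r'.
    by rewrite -(subrKA p); apply: le_trans (ler_normD _ _) _; apply: lerD; [|rewrite distrC]; exact: ltW.
  have h : r' * (c * (F + 1) * L) <= 1.
    by rewrite -ler_pdivlMr ?mulr_gt0// mul1r ge_min lexx orbT.
  have h2 : 8 * `|y - x| * F <= 8 * (r' + r') * (F + 1).
    apply: ler_pM => //; rewrite ?mulr_ge0 ?lerDl//; exact: ler_wpM2l.
  rewrite cE in h; move=> /le_trans/(_ h2)/(ler_wpM2r (ltW L0)); lra.
exists r', (16 * L)^-1, (fun z => rho0 (z - f p)); split=> //.
  move=> z; rewrite invfM ltr_pdivlMr// => /rhod; rewrite /derivable.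
  rewrite (_ : (fun h : C => h^-1 *: (((fun z0 => rho0 (z0 - f p)) \o shift z) (h *: 1) - rho0 (z - f p)))
     = (fun h : C => h^-1 *: ((rho0 \o shift (z - f p)) (h *: 1) - rho0 (z - f p)))) //.
  by apply/funext => h /=; rewrite addrA.
move=> q qr'; have pr' := cube_center p r'0.
split; first by rewrite invfM ltr_pdivlMr//; exact: small.
have Bq := cube_sub r'r qr'.
have sf' := csmooth_sub (cube_sub r'r) sf.
have sal' k := csmooth_sub (cube_sub r'r) (sal k).
(* The Taylor sum aimed at the value f(q): centred at q it is v(q), centred at p it is a partial sum
   of [rho0]. The difference is controlled by its telescoped derivative. *)
pose T n := taylor al f (f q) n.+1.
have Tq n : T n q = v q.
  rewrite /T /taylor big_ord_recl big1 ?addr0 /=; last first.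
    by move=> k _; rewrite subrr expr0n /= mul0r mulr0.
  by rewrite expr0 fact0 invr1 !mulr1.
have Tp n : T n p = psn a (f q - f p) n.+1.
  by apply: eq_bigr => k _; rewrite /a; ring.
have sT n : csmooth (cube p r') (T n).
  exact: csmooth_taylor (@cube_open R p r') sal' sf'.
apply/eqP; rewrite -subr_eq0 -norm1c_eq0 eq_le norm1c_ge0 andbT.
apply: (@le0_of_geometric _ _ (8 * r' * (cv * L * F) + 4 * cv)) => n.
rewrite -(subrKA (psn a (f q - f p) n.+1)) mulrDl.
apply: le_trans (norm1cD _ _) _; apply: lerD; last first.
  rewrite -opprB norm1cN; apply: le_trans (rhoE _ (ltW (small _ _ pr' qr')) n.+1) _.
  apply: ler_wpM2l; first by rewrite mulr_ge0.
  by rewrite exprS -[leRHS]mul1r ler_wpM2r ?exprn_ge0 ?invr_ge0// invf_le1// ler1n.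
rewrite -Tp -(Tq n).
have inc : forall i x, cube p r' x -> norm1c (cpartial i (T n) x) <= cv * L * F * (2^-1) ^+ n.
  move=> i x xr'; have Bx := cube_sub r'r xr'.
  rewrite (cpartial_taylor (f q) n oB sal sf Bx (fun k y => dal i k y)).
  apply: le_trans (norm1cM _ _) _; rewrite norm1c_divn ?fact_gt0//.
  have h1 : norm1c (al n.+1 x * cpartial i f x) <= cv * L ^+ n.+1 * n.+1`!%:R * F.
    by apply: le_trans (norm1cM _ _) _; apply: ler_pM; rewrite ?norm1c_ge0 ?nal ?HF.
  have h2 : norm1c ((f q - f x) ^+ n) <= (16^-1 / L) ^+ n.
    apply: le_trans (norm1cX _ _) _; apply: lerXn2r; rewrite ?nnegrE ?norm1c_ge0//.
      by rewrite divr_ge0// ?invr_ge0// ltW.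
    by rewrite ler_pdivlMr//; apply/ltW/small.
  have h3 : 0 <= (n`!%:R : R)^-1 by rewrite invr_ge0.
  apply: le_trans (ler_pM (norm1c_ge0 _) _ h1 (ler_wpM2r h3 h2)) _.
    by rewrite mulr_ge0// norm1c_ge0.
  have -> : cv * L ^+ n.+1 * n.+1`!%:R * F * ((16^-1 / L) ^+ n * n`!%:R^-1) =
     cv * L * F * (n.+1%:R * 16^-1 ^+ n).
    rewrite factS natrM exprMn exprVn exprS exprVn.
    have f0 := lt0r_neq0 (fact_gt0R R n).
    have LN := expf_neq0 n (lt0r_neq0 L0).
    have t0 : (16 : R) ^+ n != 0 by rewrite expf_neq0.
    by move: (n`!%:R : R) f0 (L ^+ n) LN (16 ^+ n) t0 => z z0 y y0 w w0; field; rewrite z0 y0 w0.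
  apply: ler_wpM2l; first by rewrite !mulr_ge0// ltW.
  have h8 : n.+1%:R <= 2 ^+ n :> R by rewrite -natrX ler_nat natS_le_expn.
  apply: le_trans (ler_wpM2r _ h8) _; first by rewrite exprn_ge0// invr_ge0.
  by rewrite -exprMn; apply: lerXn2r; rewrite ?nnegrE; lra.
apply: le_trans (cube_increment (sT n) pr' qr' inc) _.
rewrite -[leRHS]mulrA; apply: ler_wpM2r.
  by rewrite !mulr_ge0// ?exprn_ge0 ?invr_ge0// ltW.
by apply: ler_wpM2l => //; exact: ltW.
Qed.

End FactorThrough.

(** * Linear algebra of a Hessian that kills a null gradient *)

Section NullHessian.
Variable K : fieldType.

Definition proportional4 (p q r s wp wq wr ws : K) :=
  exists l, [/\ wp = l * p, wq = l * q, wr = l * r & ws = l * s].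

(** p, q, r, s are the components of the gradient along null vectors D1, D2, D, D', and the double
    letters are the Hessian in that frame. H descends to the two-dimensional quotient of the
    orthogonal complement of the gradient by the gradient, whose null lines come from p D - r D1 and
    p D' - s D1. There tr H = 0 kills the mixed entry and tr H^2 = 0 the product of the diagonal
    entries [a] and [b]. The entry that vanishes selects the plane. *)
Lemma null_hessian_p (p q r s pp pq pr ps qq qr qs rr rs ss : K) :
  p != 0 -> p * q = r * s ->
  p * pq + q * pp = r * ps + s * pr -> p * qq + q * pq = r * qs + s * qr ->
  p * qr + q * pr = r * rs + s * rr -> p * qs + q * ps = r * ss + s * rs ->
  pq = rs ->
  pp * qq + pq ^+ 2 + rr * ss + rs ^+ 2 - 2 * pr * qs - 2 * ps * qr = 0 ->
  (proportional4 p q r s (s * pp - p * ps) (s * pq - p * qs) (s * pr - p * rs) (s * ps - p * ss) /\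
   proportional4 p q r s (q * pr - r * pq) (q * qr - r * qq) (q * rr - r * qr) (q * rs - r * qs)) \/
  (proportional4 p q r s (r * pp - p * pr) (r * pq - p * qr) (r * pr - p * rr) (r * ps - p * rs) /\
   proportional4 p q r s (q * ps - s * pq) (q * qs - s * qq) (q * rs - s * qr) (q * ss - s * qs)).
Proof.
move=> p0 N Ep Eq Er Es tr tr2.
have Eqv : q = r * s / p by rewrite -N mulrAC divff// mul1r.
have Epq : pq = (r * ps + s * pr - q * pp) / p by rewrite -Ep addrK mulrAC divff// mul1r.
have Eqr : qr = (r * rs + s * rr - q * pr) / p by rewrite -Er addrK mulrAC divff// mul1r.
have Eqs : qs = (r * ss + s * rs - q * ps) / p by rewrite -Es addrK mulrAC divff// mul1r.
have Eqq : qq = (r * qs + s * qr - q * pq) / p by rewrite -Eq addrK mulrAC divff// mul1r.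
clear N Ep Eq Er Es; subst rs.
pose a := p ^+ 2 * rr - 2 * p * r * pr + r ^+ 2 * pp.
pose b := p ^+ 2 * ss - 2 * p * s * ps + s ^+ 2 * pp.
have : a * b = 0.
  rewrite -[RHS](mulr0 (p ^+ 4)) -tr2 ?Eqq ?Eqr ?Eqs ?Epq ?Eqv /a /b; by field.
move=> /eqP; rewrite mulf_eq0 => /orP[] /eqP Z; [right|left]; split.
- exists ((r * pp - p * pr) / p); split; first by rewrite mulfVK.
  + apply: subr0_eq; rewrite -[RHS](mul0r (- (s / p ^+ 2))) -Z /a ?Eqq ?Eqr ?Eqs ?Epq ?Eqv; by field.
  + apply: subr0_eq; rewrite -[RHS](mul0r (- (p^-1))) -Z /a ?Eqq ?Eqr ?Eqs ?Epq ?Eqv; by field.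
  + apply: subr0_eq; rewrite ?Eqq ?Eqr ?Eqs ?Epq ?Eqv; by field.
- exists ((q * ps - s * pq) / p); split; first by rewrite mulfVK.
  + apply: subr0_eq; rewrite -[RHS](mul0r (- (s ^+ 3 / p ^+ 4))) -Z /a ?Eqq ?Eqr ?Eqs ?Epq ?Eqv; by field.
  + apply: subr0_eq; rewrite -[RHS](mul0r (- (s ^+ 2 / p ^+ 3))) -Z /a ?Eqq ?Eqr ?Eqs ?Epq ?Eqv; by field.
  + apply: subr0_eq; rewrite ?Eqq ?Eqr ?Eqs ?Epq ?Eqv; by field.
- exists ((s * pp - p * ps) / p); split; first by rewrite mulfVK.
  + apply: subr0_eq; rewrite -[RHS](mul0r (- (r / p ^+ 2))) -Z /b ?Eqq ?Eqr ?Eqs ?Epq ?Eqv; by field.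
  + apply: subr0_eq; rewrite ?Eqq ?Eqr ?Eqs ?Epq ?Eqv; by field.
  + apply: subr0_eq; rewrite -[RHS](mul0r (- (p^-1))) -Z /b ?Eqq ?Eqr ?Eqs ?Epq ?Eqv; by field.
- exists ((q * pr - r * pq) / p); split; first by rewrite mulfVK.
  + apply: subr0_eq; rewrite -[RHS](mul0r (- (r ^+ 3 / p ^+ 4))) -Z /b ?Eqq ?Eqr ?Eqs ?Epq ?Eqv; by field.
  + apply: subr0_eq; rewrite ?Eqq ?Eqr ?Eqs ?Epq ?Eqv; by field.
  + apply: subr0_eq; rewrite -[RHS](mul0r (- (r ^+ 2 / p ^+ 3))) -Z /b ?Eqq ?Eqr ?Eqs ?Epq ?Eqv; by field.
Qed.

Local Ltac close_component :=
  match goal with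
  | A : ?e = ?l * ?x |- _ = _ * ?x =>
    first [ transitivity e; [by ring | by rewrite A; ring]
          | transitivity (- e); [by ring | by rewrite A; ring] ]
  end.

Local Ltac close_proportional l1 l2 :=
  first [ by exists l1; split; close_component
        | by exists (- l1); split; close_component
        | by exists l2; split; close_component
        | by exists (- l2); split; close_component ].

(** Four relabellings of p, q, r, s preserve pq = rs and each of the two planes, so any non-zero
    component can play the part of p. The conclusion names two vectors in each plane so as to be
    stable, up to sign, under these relabellings. *)
Lemma null_hessian (p q r s pp pq pr ps qq qr qs rr rs ss : K) :
  [|| p != 0, q != 0, r != 0 | s != 0] -> p * q = r * s ->
  p * pq + q * pp = r * ps + s * pr -> p * qq + q * pq = r * qs + s * qr ->
  p * qr + q * pr = r * rs + s * rr -> p * qs + q * ps = r * ss + s * rs ->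
  pq = rs ->
  pp * qq + pq ^+ 2 + rr * ss + rs ^+ 2 - 2 * pr * qs - 2 * ps * qr = 0 ->
  (proportional4 p q r s (s * pp - p * ps) (s * pq - p * qs) (s * pr - p * rs) (s * ps - p * ss) /\
   proportional4 p q r s (q * pr - r * pq) (q * qr - r * qq) (q * rr - r * qr) (q * rs - r * qs)) \/
  (proportional4 p q r s (r * pp - p * pr) (r * pq - p * qr) (r * pr - p * rr) (r * ps - p * rs) /\
   proportional4 p q r s (q * ps - s * pq) (q * qs - s * qq) (q * rs - s * qr) (q * ss - s * qs)).
Proof.
move=> /or4P nz N Ep Eq Er Es tr tr2; case: nz => nz.
- exact: null_hessian_p.
- have [] := @null_hessian_p q p s r qq pq qs qr pp ps pr ss rs rr nz.
  + by rewrite mulrC N mulrC.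
  + by rewrite addrC Eq addrC.
  + by rewrite addrC Ep addrC.
  + by rewrite addrC Es addrC.
  + by rewrite addrC Er addrC.
  + exact: tr.
  + by rewrite -[RHS]tr2; ring.
  + by move=> [[l1 [? ? ? ?]] [l2 [? ? ? ?]]]; left; split; close_proportional l1 l2.
  + by move=> [[l1 [? ? ? ?]] [l2 [? ? ? ?]]]; right; split; close_proportional l1 l2.
- have [] := @null_hessian_p r s p q rr rs pr qr ss ps qs pp pq qq nz.
  + by rewrite N.
  + by rewrite -Er.
  + by rewrite -Es.
  + by rewrite -Ep.
  + by rewrite -Eq.
  + by rewrite tr.
  + by rewrite -[RHS]tr2; ring.
  + by move=> [[l1 [? ? ? ?]] [l2 [? ? ? ?]]]; left; split; close_proportional l1 l2.
  + by move=> [[l1 [? ? ? ?]] [l2 [? ? ? ?]]]; right; split; close_proportional l1 l2.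
- have [] := @null_hessian_p s r q p ss rs qs ps rr qr pr qq pq pp nz.
  + by rewrite mulrC -N mulrC.
  + by rewrite addrC -Es addrC.
  + by rewrite addrC -Er addrC.
  + by rewrite addrC -Eq addrC.
  + by rewrite addrC -Ep addrC.
  + by rewrite tr.
  + by rewrite -[RHS]tr2; ring.
  + by move=> [[l1 [? ? ? ?]] [l2 [? ? ? ?]]]; left; split; close_proportional l1 l2.
  + by move=> [[l1 [? ? ? ?]] [l2 [? ? ? ?]]]; right; split; close_proportional l1 l2.
Qed.

Definition i0 : 'I_4 := ord0.
Definition i1 : 'I_4 := lift ord0 ord0.
Definition i2 : 'I_4 := lift ord0 (lift ord0 ord0).
Definition i3 : 'I_4 := lift ord0 (lift ord0 (lift ord0 ord0)).

Lemma ord4P (P : 'I_4 -> Prop) : P i0 -> P i1 -> P i2 -> P i3 -> forall i, P i.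
Proof.
move=> P0 P1 P2 P3 [[|[|[|[|n]]]] //= n4].
- by have <- : i0 = Ordinal n4 by exact: val_inj.
- by have <- : i1 = Ordinal n4 by exact: val_inj.
- by have <- : i2 = Ordinal n4 by exact: val_inj.
- by have <- : i3 = Ordinal n4 by exact: val_inj.
Qed.

Lemma sum4E (V : nmodType) (F : 'I_4 -> V) : \sum_i F i = F i0 + F i1 + F i2 + F i3.
Proof. by rewrite !big_ord_recl big_ord0 addr0 !addrA. Qed.

(* Put D1 = d_0 + d_1, D2 = d_0 - d_1, D = d_2 + ep d_3, D' = d_2 - ep d_3. For
   either [k], A = [lA ep k x] and B = [lB ep k x] give the totally null plane
   spanned by D1 - (A/B) D' and D - (A/B) D2 that the null gradient [x]
   annihilates; the other one comes from -ep. *)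
Definition lA (ep : K) (k : bool) (x : 'I_4 -> K) : K :=
  if k then x i2 + ep * x i3 else x i0 + x i1.
Definition lB (ep : K) (k : bool) (x : 'I_4 -> K) : K :=
  if k then x i0 - x i1 else x i2 - ep * x i3.

Definition msign (i : 'I_4) : K := if i == i0 then -1 else 1.

Lemma proportional4_coord (im : K) (x w : 'I_4 -> K) : im != 0 -> (2 : K) != 0 ->
  proportional4 (x i0 + x i1) (x i0 - x i1) (x i2 + im * x i3) (x i2 - im * x i3)
    (w i0 + w i1) (w i0 - w i1) (w i2 + im * w i3) (w i2 - im * w i3) ->
  exists l, forall i, w i = l * x i.
Proof.
move=> im0 two0 [l [E0 E1 E2 E3]]; exists l; apply: ord4P; apply: (mulfI two0).
- transitivity ((w i0 + w i1) + (w i0 - w i1)); [by ring | by rewrite E0 E1; ring].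
- transitivity ((w i0 + w i1) - (w i0 - w i1)); [by ring | by rewrite E0 E1; ring].
- transitivity ((w i2 + im * w i3) + (w i2 - im * w i3)); [by ring | by rewrite E2 E3; ring].
- apply: (mulfI im0).
  transitivity ((w i2 + im * w i3) - (w i2 - im * w i3)); [by ring | by rewrite E2 E3; ring].
Qed.

Lemma null_hessian_coord (im : K) (x : 'I_4 -> K) (H : 'I_4 -> 'I_4 -> K) :
  im ^+ 2 = -1 -> (2 : K) != 0 -> (exists i, x i != 0) ->
  (forall i j, H i j = H j i) ->
  \sum_i msign i * x i ^+ 2 = 0 ->
  (forall k, \sum_i msign i * (x i * H k i) = 0) ->
  \sum_i msign i * H i i = 0 ->
  \sum_k msign k * (\sum_i msign i * H k i ^+ 2) = 0 ->
  (forall k, exists l, forall i, lB im k x * lA im k (H i) - lA im k x * lB im k (H i) = l * x i) \/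
  (forall k, exists l, forall i, lB (- im) k x * lA (- im) k (H i) - lA (- im) k x * lB (- im) k (H i) = l * x i).
Proof.
move=> im2 two0 xnz sym nul Ek tr tr2.
have im0 : im != 0 by apply: contra_eq_neq im2 => ->; rewrite expr0n /= eq_sym oppr_eq0 oner_eq0.
move: nul tr tr2; rewrite !sum4E /msign /= => nul tr tr2.
have := Ek i0; have := Ek i1; have := Ek i2; have := Ek i3.
rewrite !sum4E /msign /= !mulN1r !mul1r => E3 E2 E1 E0.
rewrite !mulN1r !mul1r in nul tr tr2.
rewrite (sym i1 i0) (sym i2 i0) (sym i3 i0) (sym i2 i1) (sym i3 i1) (sym i3 i2) in E0 E1 E2 E3 tr2.
(* Scaling the last coordinate by [im] gives the metric the split form -x0^2 + x1^2 + x2^2 - y3^2,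
   whose null frame has coefficients 1 and -1. *)
pose y3 := im * x i3.
pose G03 := im * H i0 i3; pose G13 := im * H i1 i3; pose G23 := im * H i2 i3.
pose G33 := - H i3 i3.
have imx a b : im * a * (im * b) = - (a * b) by rewrite mulrACA -expr2 im2 mulN1r.
have imxx a : (im * a) ^+ 2 = - a ^+ 2 by rewrite exprMn im2 mulN1r.
pose p := x i0 + x i1; pose q := x i0 - x i1; pose r := x i2 + y3; pose s := x i2 - y3.
have Npq : p * q = r * s.
  have : (im * x i3) ^+ 2 = - x i3 ^+ 2 by exact: imxx.
  rewrite -/y3 /p /q /r /s => E; apply: subr0_eq.
  transitivity (- (- x i0 ^+ 2 + x i1 ^+ 2 + x i2 ^+ 2 - y3 ^+ 2)); first by ring.
  by rewrite E opprK nul oppr0.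
have E0' : - (x i0 * H i0 i0) + x i1 * H i0 i1 + x i2 * H i0 i2 - y3 * G03 = 0.
  by rewrite imx opprK.
have E1' : - (x i0 * H i0 i1) + x i1 * H i1 i1 + x i2 * H i1 i2 - y3 * G13 = 0.
  by rewrite imx opprK.
have E2' : - (x i0 * H i0 i2) + x i1 * H i1 i2 + x i2 * H i2 i2 - y3 * G23 = 0.
  by rewrite imx opprK.
have E3' : - (x i0 * G03) + x i1 * G13 + x i2 * G23 - y3 * G33 = 0.
  by rewrite /G03 /G13 /G23 /G33 /y3 -[RHS](mulr0 im) -E3; ring.
have tr' : - H i0 i0 + H i1 i1 + H i2 i2 - G33 = 0 by rewrite /G33 opprK.
have tr2' : H i0 i0 ^+ 2 + H i1 i1 ^+ 2 + H i2 i2 ^+ 2 + G33 ^+ 2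
   + 2 * (- H i0 i1 ^+ 2 - H i0 i2 ^+ 2 + G03 ^+ 2 + H i1 i2 ^+ 2 - G13 ^+ 2 - G23 ^+ 2) = 0.
  by rewrite !imxx /G33 -[RHS]tr2; ring.
pose pp := H i0 i0 + 2 * H i0 i1 + H i1 i1; pose pq := H i0 i0 - H i1 i1.
pose qq := H i0 i0 - 2 * H i0 i1 + H i1 i1.
pose pr := H i0 i2 + G03 + H i1 i2 + G13; pose ps := H i0 i2 - G03 + H i1 i2 - G13.
pose qr := H i0 i2 + G03 - H i1 i2 - G13; pose qs := H i0 i2 - G03 - H i1 i2 + G13.
pose rr := H i2 i2 + 2 * G23 + G33; pose rs := H i2 i2 - G33.
pose ss := H i2 i2 - 2 * G23 + G33.
have nz : [|| p != 0, q != 0, r != 0 | s != 0].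
  apply: contraPT xnz; rewrite !negb_or !negbK /p /q /r /s => /and4P[/eqP p0 /eqP q0 /eqP r0 /eqP s0].
  move=> [i xi].
  have x0 : x i0 = 0 by apply: (mulfI two0); rewrite mulr0 -(addr0 0) -{1}p0 -q0; ring.
  have x1 : x i1 = 0 by move: p0; rewrite x0 add0r.
  have x2 : x i2 = 0 by apply: (mulfI two0); rewrite mulr0 -(addr0 0) -{1}r0 -s0; ring.
  have x3 : x i3 = 0 by move: r0; rewrite x2 add0r => /eqP; rewrite mulf_eq0 (negbTE im0) => /eqP.
  by move: i xi; apply: ord4P; rewrite ?x0 ?x1 ?x2 ?x3 eqxx.
have [] := @null_hessian p q r s pp pq pr ps qq qr qs rr rs ss nz Npq.
- apply: subr0_eq; rewrite /p /q /r /s /pp /pq /pr /ps -[RHS](mulr0 (-2)) -[X in -2 * X](addr0 0) -{1}E0' -E1'; ring.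
- apply: subr0_eq; rewrite /p /q /r /s /qq /pq /qr /qs -[RHS](mulr0 (-2)) -[X in -2 * X](subr0 0) -{1}E0' -E1'; ring.
- apply: subr0_eq; rewrite /p /q /r /s /rr /rs /qr /pr -[RHS](mulr0 (-2)) -[X in -2 * X](addr0 0) -{1}E2' -E3'; ring.
- apply: subr0_eq; rewrite /p /q /r /s /ss /rs /qs /ps -[RHS](mulr0 (-2)) -[X in -2 * X](subr0 0) -{1}E2' -E3'; ring.
- apply: subr0_eq; rewrite /pq /rs -[RHS](mulr0 (-1)) -tr'; ring.
- by rewrite /pp /qq /pq /rr /ss /rs /pr /qs /ps /qr -[RHS](mulr0 2) -tr2'; ring.
- have G33E : G33 = im ^+ 2 * H i3 i3 by rewrite im2 mulN1r.
  have HN : - im != 0 by rewrite oppr_eq0.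
  move=> [[l1 [A1 A2 A3 A4]] [l2 [B1 B2 B3 B4]]]; left; case;
    apply: (@proportional4_coord im) => //; rewrite /lA /lB /=.
  + exists l2; split; [transitivity (q * pr - r * pq)|transitivity (q * qr - r * qq)
      |transitivity (q * rr - r * qr)|transitivity (q * rs - r * qs)] => //;
    rewrite ?(sym i1 i0) ?(sym i2 i0) ?(sym i3 i0) ?(sym i2 i1) ?(sym i3 i1) ?(sym i3 i2);
    by rewrite /p /q /r /s /pp /pq /pr /ps /qq /qr /qs /rr /rs /ss ?G33E /G03 /G13 /G23 /y3; ring.
  + exists l1; split; [transitivity (s * pp - p * ps)|transitivity (s * pq - p * qs)
      |transitivity (s * pr - p * rs)|transitivity (s * ps - p * ss)] => //;
    rewrite ?(sym i1 i0) ?(sym i2 i0) ?(sym i3 i0) ?(sym i2 i1) ?(sym i3 i1) ?(sym i3 i2);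
    by rewrite /p /q /r /s /pp /pq /pr /ps /qq /qr /qs /rr /rs /ss ?G33E /G03 /G13 /G23 /y3; ring.
- have G33E : G33 = im ^+ 2 * H i3 i3 by rewrite im2 mulN1r.
  move=> [[l1 [A1 A2 A3 A4]] [l2 [B1 B2 B3 B4]]]; right; case;
    apply: (@proportional4_coord im) => //; rewrite /lA /lB /=.
  + exists l2; split; [transitivity (q * ps - s * pq)|transitivity (q * qs - s * qq)
      |transitivity (q * rs - s * qr)|transitivity (q * ss - s * qs)] => //;
    rewrite ?(sym i1 i0) ?(sym i2 i0) ?(sym i3 i0) ?(sym i2 i1) ?(sym i3 i1) ?(sym i3 i2);
    by rewrite /p /q /r /s /pp /pq /pr /ps /qq /qr /qs /rr /rs /ss ?G33E /G03 /G13 /G23 /y3; ring.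
  + exists l1; split; [transitivity (r * pp - p * pr)|transitivity (r * pq - p * qr)
      |transitivity (r * pr - p * rr)|transitivity (r * ps - p * rs)] => //;
    rewrite ?(sym i1 i0) ?(sym i2 i0) ?(sym i3 i0) ?(sym i2 i1) ?(sym i3 i1) ?(sym i3 i2);
    by rewrite /p /q /r /s /pp /pq /pr /ps /qq /qr /qs /rr /rs /ss ?G33E /G03 /G13 /G23 /y3; ring.
Qed.

End NullHessian.

(** * Solutions of the null wave equations: the obstruction and its vanishing *)

Section NullWave.
Variable R : realType.
Local Notation V := (M4 R).
Local Notation C := (Cx R).
Implicit Types (f g h : V -> C) (O : set V) (i j : 'I_4) (b k : bool).

Definition grad f x : 'I_4 -> C := fun i => cpartial i f x.

(** The sign selects the duality of the null plane; [true] is the case in which the conjugation [cj]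
    intervenes later. *)
Definition epsb b : C := if b then Complex 0 (-1) else Complex 0 1.

Lemma epsb_sqr b : epsb b ^+ 2 = -1.
Proof.
by case: b; apply/eqP; rewrite expr2 eq_complex /=; apply/andP; split; apply/eqP; ring.
Qed.

Lemma epsbN b : - epsb b = epsb (~~ b).
Proof. by case: b; rewrite /epsb /= CxN oppr0 ?opprK. Qed.

Definition numer b k f x := lA (epsb b) k (grad f x).
Definition denom b k f x := lB (epsb b) k (grad f x).

(** This is h^2 d_i(g/h), which makes sense where h vanishes. *)
Definition wronskian f g h i x : C := h x * cpartial i g x - g x * cpartial i h x.

(** A coefficient of B^2 d(A/B) /\ df, where A/B is the position of the null plane. As a polynomial
    in the derivatives of f it inherits their bounds, so the identity theorem applies to it without
    any condition on B. *)
Definition obstruction b k i j f x : C :=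
  wronskian f (numer b k f) (denom b k f) i x * cpartial j f x -
  wronskian f (numer b k f) (denom b k f) j x * cpartial i f x.

Definition unobstructed b f x := forall k i j, obstruction b k i j f x = 0.

Definition null_wave O f := [/\ csmooth O f,
  forall x, O x -> \sum_i msign C i * cpartial i f x ^+ 2 = 0 &
  forall x, O x -> \sum_i msign C i * cpartial i (cpartial i f) x = 0].

Lemma csmooth_numer O b k f : open O -> csmooth O f -> csmooth O (numer b k f).
Proof.
move=> oO sf; have sp i := csmooth_partial i sf.
case: k; first exact: csmoothD oO (sp i2) (csmoothM oO (csmooth_cst O (epsb b)) (sp i3)).
exact: csmoothD oO (sp i0) (sp i1).
Qed.

Lemma csmooth_denom O b k f : open O -> csmooth O f -> csmooth O (denom b k f).
Proof.
move=> oO sf; have sp i := csmooth_partial i sf.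
case: k; first exact: csmoothD oO (sp i0) (csmoothN oO (sp i1)).
exact: csmoothD oO (sp i2) (csmoothN oO (csmoothM oO (csmooth_cst O (epsb b)) (sp i3))).
Qed.

Lemma cpartial_numer O b k f i x : open O -> csmooth O f -> O x ->
  cpartial i (numer b k f) x = lA (epsb b) k (fun j => cpartial i (cpartial j f) x).
Proof.
move=> oO sf Ox; have sp j := csmooth_partial j sf; case: k.
  rewrite [LHS](cpartialD _ (sp i2) (csmoothM oO (csmooth_cst O (epsb b)) (sp i3)) Ox).
  by rewrite (cpartialM _ (csmooth_cst O (epsb b)) (sp i3) Ox) cpartial_cst mul0r add0r.
by rewrite [LHS](cpartialD _ (sp i0) (sp i1) Ox).
Qed.

Lemma cpartial_denom O b k f i x : open O -> csmooth O f -> O x ->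
  cpartial i (denom b k f) x = lB (epsb b) k (fun j => cpartial i (cpartial j f) x).
Proof.
move=> oO sf Ox; have sp j := csmooth_partial j sf; case: k.
  by rewrite [LHS](cpartialD _ (sp i0) (csmoothN oO (sp i1)) Ox) (cpartialN _ (sp i1) Ox).
have s3 := csmoothM oO (csmooth_cst O (epsb b)) (sp i3).
rewrite [LHS](cpartialD _ (sp i2) (csmoothN oO s3) Ox) (cpartialN _ s3 Ox).
by rewrite (cpartialM _ (csmooth_cst O (epsb b)) (sp i3) Ox) cpartial_cst mul0r add0r.
Qed.

Local Opaque cpartial.

Lemma null_wave_pointwise O f x : open O -> null_wave O f -> O x ->
  (exists i, cpartial i f x != 0) -> unobstructed false f x \/ unobstructed true f x.
Proof.
move=> oO [sf nul wav] Ox nz.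
have sp i := csmooth_partial i sf.
have spp i j := csmooth_partial i (sp j).
have E (k : 'I_4) y : O y -> \sum_i msign C i * (cpartial i f y * cpartial k (cpartial i f) y) = 0.
  move=> Oy; have sq i : csmooth O (fun x => msign C i * cpartial i f x ^+ 2).
    exact: csmoothM oO (csmooth_cst O _) (csmooth_exp 2 oO (sp i)).
  have := cpartial_sum k oO Oy sq.
  rewrite (cpartial_ext k oO nul Oy) cpartial_cst => /esym E2.
  have two0 : (2 : C) != 0 by rewrite pnatr_eq0.
  apply: (mulfI two0); rewrite mulr0 -[RHS]E2 mulr_sumr; apply: eq_bigr => i _.
  rewrite (cpartialM _ (csmooth_cst O _) (csmooth_exp 2 oO (sp i)) Oy) cpartial_cst mul0r add0r.
  by rewrite (cpartial_exp _ _ oO (sp i) Oy) /= expr1; ring.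
(* Differentiating [E k] along k once more expresses the squares of the k-th row by third
   derivatives; summed with signs over k, these are derivatives of the wave equation. *)
have tr2 : \sum_k msign C k * (\sum_i msign C i * cpartial k (cpartial i f) x ^+ 2) = 0.
  have D (k : 'I_4) : \sum_i msign C i * cpartial k (cpartial i f) x ^+ 2 =
     - \sum_i msign C i * (cpartial i f x * cpartial k (cpartial k (cpartial i f)) x).
    have sq i : csmooth O (fun x => msign C i * (cpartial i f x * cpartial k (cpartial i f) x)).
      exact: csmoothM oO (csmooth_cst O _) (csmoothM oO (sp i) (spp k i)).
    have := cpartial_sum k oO Ox sq.
    rewrite (cpartial_ext k oO (E k) Ox) cpartial_cst => /esym E2.
    apply/eqP; rewrite -addr_eq0 -big_split /= -[X in _ == X]E2; apply/eqP.
    apply: eq_bigr => i _.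
    rewrite (cpartialM _ (csmooth_cst O _) (csmoothM oO (sp i) (spp k i)) Ox) cpartial_cst.
    rewrite (cpartialM _ (sp i) (spp k i) Ox).
    by rewrite -mulrDr expr2 mul0r add0r.
  under eq_bigr => k _ do rewrite D mulrN mulr_sumr.
  rewrite sumrN exchange_big /= big1 ?oppr0// => i _.
  rewrite -[RHS](mulr0 (msign C i * cpartial i f x)).
  have sq (k : 'I_4) : csmooth O (fun x => msign C k * cpartial k (cpartial k f) x).
    exact: csmoothM oO (csmooth_cst O _) (spp k k).
  have := cpartial_sum i oO Ox sq.
  rewrite (cpartial_ext i oO wav Ox) cpartial_cst => E3.
  rewrite [X in _ = _ * X]E3 mulr_sumr; apply: eq_bigr => k _.
  rewrite (cpartialM _ (csmooth_cst O _) (spp k k) Ox) cpartial_cst mul0r add0r.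
  rewrite (cpartial_comm i k oO (sp k) Ox).
  have cm y : O y -> cpartial i (cpartial k f) y = cpartial k (cpartial i f) y.
    by move=> Oy; exact: (cpartial_comm i k oO sf Oy).
  have E4 := @cpartial_ext R O (cpartial i (cpartial k f)) (cpartial k (cpartial i f)) x k oO cm Ox.
  have swap (a b c d : C) : a * (b * (c * d)) = b * c * (a * d) by ring.
  exact: (etrans (swap _ _ _ _)
    (congr1 (fun z => msign C i * cpartial i f x * (msign C k * z)) (esym E4))).
have two0 : (2 : C) != 0 by rewrite pnatr_eq0.
have key b : (forall k, exists l, forall i, lB (epsb b) k (grad f x) *
      lA (epsb b) k (fun j => cpartial i (cpartial j f) x) - lA (epsb b) k (grad f x) *
      lB (epsb b) k (fun j => cpartial i (cpartial j f) x) = l * grad f x i) ->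
    unobstructed b f x.
  move=> H k i j; have [l Hl] := H k.
  have W i' : wronskian f (numer b k f) (denom b k f) i' x = l * cpartial i' f x.
    by rewrite /wronskian (cpartial_numer _ _ _ oO sf Ox) (cpartial_denom _ _ _ oO sf Ox); exact: Hl.
  have alg (a1 a2 a3 : C) : a1 * a2 * a3 - a1 * a3 * a2 = 0 by ring.
  exact: (etrans (f_equal2 (fun a c => a * cpartial j f x - c * cpartial i f x) (W i) (W j))
    (alg _ _ _)).
have [] := @null_hessian_coord C (epsb false) (grad f x) (fun i j => cpartial i (cpartial j f) x)
  (epsb_sqr _) two0 nz (fun i j => cpartial_comm i j oO sf Ox) (nul _ Ox) (fun k : 'I_4 => E k _ Ox)
  (wav _ Ox) tr2.
  by move=> /key; left.
by rewrite epsbN => /key; right.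
Qed.

Definition jet_bounded O f := forall i l, abound i O (cpartials l f).

Lemma jet_bounded_csmooth O f : jet_bounded O f -> csmooth O f.
Proof. by move=> /(_ ord0 [::])[]. Qed.

Lemma jet_bounded_sub O O' f : O' `<=` O -> jet_bounded O f -> jet_bounded O' f.
Proof. by move=> s j i l; exact: abound_sub s (j i l). Qed.

Lemma abound_numer O b k f i : open O -> jet_bounded O f -> abound i O (numer b k f).
Proof.
move=> oO jf; have sp j : abound i O (cpartial j f) := jf i [:: j].
case: k; first exact: aboundD oO (sp i2) (aboundM oO (abound_cst i (epsb b) oO) (sp i3)).
exact: aboundD oO (sp i0) (sp i1).
Qed.

Lemma abound_denom O b k f i : open O -> jet_bounded O f -> abound i O (denom b k f).
Proof.
move=> oO jf; have sp j : abound i O (cpartial j f) := jf i [:: j].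
case: k; first exact: aboundD oO (sp i0) (aboundN oO (sp i1)).
exact: aboundD oO (sp i2) (aboundN oO (aboundM oO (abound_cst i (epsb b) oO) (sp i3))).
Qed.

Lemma abound_partial O i j f b k : open O -> jet_bounded O f ->
  abound i O (cpartial j (numer b k f)) /\ abound i O (cpartial j (denom b k f)).
Proof.
move=> oO jf; have sf := jet_bounded_csmooth jf.
have sp m : abound i O (cpartial j (cpartial m f)) := jf i [:: j; m].
split.
  apply: (abound_ext oO (fun x Ox => esym (cpartial_numer b k j oO sf Ox))).
  case: k; first exact: aboundD oO (sp i2) (aboundM oO (abound_cst i (epsb b) oO) (sp i3)).
  exact: aboundD oO (sp i0) (sp i1).
apply: (abound_ext oO (fun x Ox => esym (cpartial_denom b k j oO sf Ox))).
case: k; first exact: aboundD oO (sp i0) (aboundN oO (sp i1)).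
exact: aboundD oO (sp i2) (aboundN oO (aboundM oO (abound_cst i (epsb b) oO) (sp i3))).
Qed.

Lemma abound_obstruction O b k i j f m : open O -> jet_bounded O f ->
  abound m O (obstruction b k i j f).
Proof.
move=> oO jf; have sp j' : abound m O (cpartial j' f) := jf m [:: j'].
have w j' : abound m O (wronskian f (numer b k f) (denom b k f) j').
  have [dn dd] := abound_partial m j' b k oO jf.
  apply: (aboundD oO (aboundM oO (abound_denom b k m oO jf) dn)).
  exact: aboundN oO (aboundM oO (abound_numer b k m oO jf) dd).
by apply: aboundD oO (aboundM oO (w i) (sp j)) (aboundN oO (aboundM oO (w j) (sp i))).
Qed.

Lemma csmooth_near_norm O h p (e : R) : csmooth O h -> O p -> 0 < e ->
  \forall q \near p, norm1c (h q - h p) < e.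
Proof.
move=> [rh ih] Op e0.
have cr : {for p, continuous (re_part h)} by have [c _] := rh 0%N; exact: c.
have ci : {for p, continuous (im_part h)} by have [c _] := ih 0%N; exact: c.
have e20 : 0 < e / 2 by rewrite divr_gt0.
have hr : \forall q \near p, `|re_part h p - re_part h q| < e / 2.
  by move: cr; rewrite /prop_for /continuous_at => /cvgrPdist_lt; exact.
have hi : \forall q \near p, `|im_part h p - im_part h q| < e / 2.
  by move: ci; rewrite /prop_for /continuous_at => /cvgrPdist_lt; exact.
near=> q; rewrite /norm1c !raddfB /= (splitr e); apply: ltrD; rewrite distrC.
  by near: q.
by near: q.
Unshelve. all: by end_near. Qed.

Lemma norm1cB_le (z w : C) : norm1c z - norm1c w <= norm1c (w - z).
Proof. by rewrite lerBlDl -{1}(subrKC w z) -[norm1c (w - z)]norm1cN opprB norm1cD. Qed.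

Lemma csmooth_neq0_near O h p : csmooth O h -> O p -> h p != 0 ->
  \forall q \near p, norm1c (h p) / 2 < norm1c (h q).
Proof.
move=> sh Op hp0.
have n0 : 0 < norm1c (h p) by rewrite lt_neqAle eq_sym norm1c_eq0 hp0 norm1c_ge0.
have n20 : 0 < norm1c (h p) / 2 by rewrite divr_gt0.
apply: filterS (csmooth_near_norm sh Op n20) => q hq.
have := norm1cB_le (h p) (h q); lra.
Qed.

Lemma unobstructed_cube (p q : V) (r : R) f b : jet_bounded (cube p r) f ->
  cube p r q -> (\near q, unobstructed b f q) -> forall x, cube p r x -> unobstructed b f x.
Proof.
move=> jf qr nq x xr k i j.
apply: (identity_cube (fun m => abound_obstruction b k i j m (@cube_open R p r) jf) qr _ xr).
by apply: filterS nq => y; exact.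
Qed.

(** The pointwise alternative becomes uniform: where an obstruction of the first kind is non-zero it
    stays so nearby, hence the second kind vanishes on an open set and, by the identity theorem,
    everywhere on the cube. *)
Lemma null_wave_cube (p : V) (r : R) f : jet_bounded (cube p r) f ->
  null_wave (cube p r) f -> (forall x, cube p r x -> exists i, cpartial i f x != 0) ->
  (forall x, cube p r x -> unobstructed false f x) \/
  (forall x, cube p r x -> unobstructed true f x).
Proof.
move=> jf nw nz; have [|/existsNP[x0 /not_implyP[x0r nu]]] :=
  pselect (forall x, cube p r x -> unobstructed false f x); first by left.
right; apply: (@unobstructed_cube p x0 r f true) => //.
move: nu => /existsNP[k /existsNP[i /existsNP[j /eqP nu]]].
have [so _] := abound_obstruction false k i j ord0 (@cube_open R p r) jf.
have B0 : \forall q \near x0, cube p r q by exact: open_nbhs_nbhs (conj (@cube_open R p r) x0r).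
have := csmooth_neq0_near so x0r nu; move: B0; apply: filterS2 => q qr hq.
have [uf|//] := null_wave_pointwise (@cube_open R p r) nw qr (nz _ qr).
have E : norm1c (obstruction false k i j f q) = 0 := etrans (congr1 (@norm1c R) (uf k i j)) (norm1c0 R).
have h0 := divr_ge0 (norm1c_ge0 (obstruction false k i j f x0)) (ler0n R 2).
have E0 : norm1c (obstruction false k i j f q) <= 0 by rewrite E.
exfalso; have := lt_le_trans (le_lt_trans h0 hq) E0; by rewrite ltxx.
Qed.

Lemma norm1cV (z : C) : z != 0 -> norm1c z^-1 <= 2 / norm1c z.
Proof.
move=> z0; have n0 := complex_neq0 z0.
have nz : 0 < norm1c z by rewrite lt_neqAle eq_sym norm1c_eq0 z0 norm1c_ge0.
rewrite ler_pdivlMr//; move: z0 n0 nz; case: z => a b z0 n0 nz.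
have n1 : 0 < a ^+ 2 + b ^+ 2 by rewrite lt_neqAle eq_sym n0 addr_ge0 ?sqr_ge0.
rewrite /norm1c /= !normrM normrN !normrM normfV (gtr0_norm n1) -mulrDl mulrAC ler_pdivrMr//.
rewrite -(real_normK (num_real a)) -(real_normK (num_real b)).
by have := sqr_ge0 (`|a| - `|b|); nra.
Qed.

Lemma shrink_neq0 (p : V) (r : R) h : 0 < r -> csmooth (cube p r) h -> h p != 0 ->
  exists r' beta : R, [/\ 0 < r', r' <= r, 0 <= beta &
    forall q, cube p r' q -> h q != 0 /\ norm1c (h q)^-1 <= beta].
Proof.
move=> r0 sh hp0.
have n0 : 0 < norm1c (h p) by rewrite lt_neqAle eq_sym norm1c_eq0 hp0 norm1c_ge0.
have /nbhs_ballP[d /= d0 H] := csmooth_neq0_near sh (cube_center p r0) hp0.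
exists (Num.min d r), (4 / norm1c (h p)); split.
- by rewrite lt_min d0.
- by rewrite ge_min lexx orbT.
- by rewrite divr_ge0// ltW.
move=> q qd; have hq : norm1c (h p) / 2 < norm1c (h q).
  apply: H; rewrite -ball_normE /= distrC; apply: lt_le_trans qd _.
  by rewrite ge_min lexx.
have hq0 : h q != 0.
  by rewrite -norm1c_eq0 gt_eqF//; apply: le_lt_trans hq; rewrite divr_ge0// ltW.
split=> //; apply: le_trans (norm1cV hq0) _.
have hqp : 0 < norm1c (h q) by apply: le_lt_trans hq; rewrite divr_ge0// ltW.
rewrite ler_pdivrMr// mulrAC ler_pdivlMr//; lra.
Qed.

(** Dividing the hypothesis by h^2 says that d(g/h) is proportional to df; the cube is shrunk so
    that h and some d_e f have bounded inverses. *)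
Lemma local_factor (p : V) (r : R) f g h : 0 < r -> jet_bounded (cube p r) f ->
  (exists i, cpartial i f p != 0) ->
  (forall i, abound i (cube p r) g) -> (forall i, abound i (cube p r) h) ->
  h p != 0 ->
  (forall i j x, cube p r x ->
     wronskian f g h i x * cpartial j f x = wronskian f g h j x * cpartial i f x) ->
  exists (r' rad : R) (rho : C -> C), [/\ 0 < r', r' <= r,
    (forall z, norm1c (z - f p) < rad -> derivable rho z 1) &
    forall q, cube p r' q -> [/\ norm1c (f q - f p) < rad, h q != 0 & g q / h q = rho (f q)]].
Proof.
move=> r0 jf [e fe0] ag ah hp0 W.
have sf := jet_bounded_csmooth jf.
have [r1 [be1 [r10 r1r be10 H1]]] := shrink_neq0 r0 (ah e).1 hp0.
have [r2 [be2 [r20 r2r be20 H2]]] := shrink_neq0 r0 (csmooth_partial e sf) fe0.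
pose s := Num.min r1 r2.
have s0 : 0 < s by rewrite lt_min r10.
have sub1 : cube p s `<=` cube p r1 by apply: cube_sub; rewrite ge_min lexx.
have sub2 : cube p s `<=` cube p r2 by apply: cube_sub; rewrite ge_min lexx orbT.
have subr : cube p s `<=` cube p r by apply: subset_trans sub1 _; exact: cube_sub.
have oS := @cube_open R p s.
have ahV : abound e (cube p s) (fun x => (h x)^-1).
  apply: (aboundV (beta := be1)) => //; last exact: abound_sub subr (ah e).
    by move=> q /sub1/H1[].
  by move=> q /sub1/H1[].
have afV : abound e (cube p s) (fun x => (cpartial e f x)^-1).
  apply: (aboundV (beta := be2)) => //; last exact: abound_sub subr (jf e [:: e]).
    by move=> q /sub2/H2[].
  by move=> q /sub2/H2[].
have agS := abound_sub subr (ag e); have ahS := abound_sub subr (ah e).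
have av : abound e (cube p s) (fun x => g x / h x) by exact: aboundM.
have [F HF] : exists F, forall i q, cube p s q -> norm1c (cpartial i f q) <= F.
  have /all_sig[c Hc] (i : 'I_4) : {c : R | 0 <= c /\ forall q, cube p s q -> norm1c (cpartial i f q) <= c}.
    apply: cid; have [_ [c [K [c0 K0 b]]]] := jf ord0 [:: i].
    by exists c; split=> // q /subr; exact: cube_norm_bound b.
  exists (\sum_i c i) => i q qs; have [_ H] := Hc i.
  apply: le_trans (H q qs) _; rewrite (bigD1 i)//= lerDl; apply: sumr_ge0 => j _.
  by have [] := Hc j.
have prop : proportional_on (cube p s) (fun x => g x / h x) f.
  have D i x : cube p s x -> cpartial i (fun x => g x / h x) x =
       wronskian f g h i x * ((h x)^-1 ^+ 2).
    move=> sx; have hx0 : h x != 0 by have [] := H1 _ (sub1 _ sx).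
    rewrite (cpartialM _ agS.1 ahV.1 sx) (cpartialV _ oS _ ahS.1 sx); last first.
      by move=> q /sub1/H1[].
    rewrite /wronskian; move: (cpartial i g x) (cpartial i h x) (g x) (h x) hx0 => a b u v v0.
    by field.
  have alg (w1 w2 f1 f2 t : C) : w1 * f1 = w2 * f2 -> w1 * t * f1 = w2 * t * f2.
    by move=> E; rewrite mulrAC E mulrAC.
  move=> i j x sx.
  exact: (etrans (congr1 (fun z => z * cpartial j f x) (D i x sx))
    (etrans (alg _ _ _ _ _ (W i j x (subr _ sx)))
      (esym (congr1 (fun z => z * cpartial i f x) (D j x sx))))).
have [r' [rad [rho [r'0 r's dr Hr]]]] := factor_through s0 (csmooth_sub subr sf)
  (fun q qs => (H2 q (sub2 q qs)).1) HF av afV prop.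
exists r', rad, rho; split=> //.
  by apply: le_trans r's _; apply: le_trans r1r; rewrite ge_min lexx.
move=> q qr'; have [a b] := Hr q qr'; split=> //.
by have [] := H1 q (sub1 q (cube_sub r's qr')).
Qed.

End NullWave.

(** * The real null direction in a null plane, and stereographic projection *)

Section Direction.
Variable R : realType.
Local Notation V := (M4 R).
Local Notation C := (Cx R).
Implicit Types (b k : bool).

Lemma mk3_lift (a b c : R) : (mk3 a b c 0 ord0 = a) * (mk3 a b c 0 (lift ord0 ord0) = b)
  * (mk3 a b c 0 (lift ord0 (lift ord0 ord0)) = c).
Proof. by rewrite !mxE. Qed.

Lemma row3E (x : 'rV[R]_3) : x = mk3 (x 0 ord0) (x 0 (lift ord0 ord0)) (x 0 (lift ord0 (lift ord0 ord0))).
Proof.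
apply/rowP => -[[|[|[|n]]] //= n3]; rewrite mxE /=; congr (x 0 _); exact: val_inj.
Qed.

Lemma inord3 : (inord 0 = ord0 :> 'I_3) * (inord 1 = lift ord0 ord0 :> 'I_3)
  * (inord 2 = lift ord0 (lift ord0 ord0) :> 'I_3).
Proof. by do ![split]; apply: val_inj; rewrite /= inordK. Qed.

Lemma scale_mk3 (t a b c : R) : t *: mk3 a b c = mk3 (t * a) (t * b) (t * c).
Proof. by rewrite [LHS]row3E !mxE. Qed.

Definition nsq (z : C) : R := complex.Re z ^+ 2 + complex.Im z ^+ 2.

Lemma nsq_ge0 z : 0 <= nsq z. Proof. by rewrite addr_ge0 ?sqr_ge0. Qed.

Lemma nsq_gt0 z : z != 0 -> 0 < nsq z.
Proof. by move=> z0; rewrite lt_neqAle nsq_ge0 eq_sym andbT; exact: complex_neq0. Qed.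

(** The stereographic image of the point -A/B of the projective line, computed from two proportional
    pairs at once. Only one of the pairs has to be non-zero. *)
Definition hopf (A0 B0 A1 B1 : C) : 'rV[R]_3 :=
  (nsq A0 + nsq B0 + nsq A1 + nsq B1)^-1 *:
  mk3 (nsq B0 + nsq B1 - nsq A0 - nsq A1)
    (- 2 * (complex.Re B0 * complex.Re A0 + complex.Im B0 * complex.Im A0
          + (complex.Re B1 * complex.Re A1 + complex.Im B1 * complex.Im A1)))
    (- 2 * (complex.Re B0 * complex.Im A0 - complex.Im B0 * complex.Re A0
          + (complex.Re B1 * complex.Im A1 - complex.Im B1 * complex.Re A1))).

Lemma mk3_congr (a b c a' b' c' : R) : a = a' -> b = b' -> c = c' ->
  mk3 a b c = mk3 a' b' c'.
Proof. by move=> -> -> ->. Qed.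

Lemma hopf_swap A0 B0 A1 B1 : hopf A0 B0 A1 B1 = hopf A1 B1 A0 B0.
Proof.
rewrite /hopf (_ : nsq A1 + nsq B1 + nsq A0 + nsq B0 = nsq A0 + nsq B0 + nsq A1 + nsq B1).
  by congr (_ *: _); apply: mk3_congr; ring.
by ring.
Qed.

(** The half-turn about the x_2 axis, which is u -> 1/u in the stereographic coordinate. It
    preserves orientation, hence cross products. *)
Definition reflect13 (x : 'rV[R]_3) : 'rV[R]_3 :=
  mk3 (- x 0 ord0) (x 0 (lift ord0 ord0)) (- x 0 (lift ord0 (lift ord0 ord0))).

Lemma hopf_reflect A0 B0 A1 B1 : hopf A0 B0 A1 B1 = reflect13 (hopf B0 A0 B1 A1).
Proof.
rewrite /reflect13 /hopf !scale_mk3 !mk3_lift.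
rewrite (_ : nsq B0 + nsq A0 + nsq B1 + nsq A1 = nsq A0 + nsq B0 + nsq A1 + nsq B1); last by ring.
by apply: mk3_congr; rewrite -?mulrN; congr (_ * _); ring.
Qed.

Definition sigma (u : C) : 'rV[R]_3 := sigma_inv (Some u).

Lemma sigmaE (a b : R) : sigma (Complex a b) =
  mk3 ((1 - (a ^+ 2 + b ^+ 2)) / (1 + (a ^+ 2 + b ^+ 2))) (2 * a / (1 + (a ^+ 2 + b ^+ 2)))
    (2 * b / (1 + (a ^+ 2 + b ^+ 2))).
Proof. by rewrite /sigma /= scale_mk3; apply: mk3_congr; rewrite mulrC. Qed.

Lemma one_nsq (a b : R) : 1 + (a ^+ 2 + b ^+ 2) != 0.
Proof. by rewrite gt_eqF// ltr_pwDl// addr_ge0 ?sqr_ge0. Qed.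

Lemma sigma_sphere_inv (w : C) : sigma_inv (sphere_inv w) = reflect13 (sigma w).
Proof.
rewrite /sphere_inv; case: w => a b; have n0 := one_nsq a b.
rewrite sigmaE /reflect13 !mk3_lift.
case: eqP => [[-> ->]|/eqP z0].
  by apply: mk3_congr; rewrite ?expr0n /= ?mulr0 ?mul0r ?oppr0 ?addr0 ?subr0 ?divr1 ?oppr0.
have m0 := complex_neq0 z0; rewrite /= in m0.
have E : 1 + ((a / (a ^+ 2 + b ^+ 2)) ^+ 2 + (- (b / (a ^+ 2 + b ^+ 2))) ^+ 2) =
   (1 + (a ^+ 2 + b ^+ 2)) / (a ^+ 2 + b ^+ 2) by field.
rewrite -[Some _^-1]/(Some (Complex (a / (a ^+ 2 + b ^+ 2)) (- (b / (a ^+ 2 + b ^+ 2))))).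
rewrite -/(sigma _) sigmaE E; apply: mk3_congr; field; by rewrite n0 m0.
Qed.

Lemma hopf_sigma A0 B0 A1 B1 : A0 * B1 = A1 * B0 -> B0 != 0 ->
  hopf A0 B0 A1 B1 = sigma (- A0 / B0).
Proof.
move=> E B00; have EA : A1 = A0 * B1 / B0 by rewrite E mulfK.
have m0 := lt0r_neq0 (nsq_gt0 B00).
have d0 : nsq A0 + nsq B0 != 0 by rewrite gt_eqF// ltr_wpDl ?nsq_ge0// nsq_gt0.
have f0 : nsq B0 + nsq B1 != 0 by rewrite gt_eqF// ltr_wpDr ?nsq_ge0// nsq_gt0.
have nA : nsq A1 = nsq A0 * nsq B1 / nsq B0.
  move: m0; rewrite EA /nsq; case: (A0) (B0) (B1) => a0 a0' [b0 b0'] [b1 b1'] /= m0.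
  by field.
have F : nsq A0 + nsq B0 + nsq A1 + nsq B1 = (nsq A0 + nsq B0) * (nsq B0 + nsq B1) / nsq B0.
  by rewrite nA; move: (nsq A0) (nsq B0) (nsq B1) m0 => x y z y0; field.
have -> : - A0 / B0 = Complex (- (complex.Re B0 * complex.Re A0 + complex.Im B0 * complex.Im A0) / nsq B0)
                   (- (complex.Re B0 * complex.Im A0 - complex.Im B0 * complex.Re A0) / nsq B0).
  move: m0; rewrite /nsq; case: (A0) (B0) => a0 a0' [b0 b0'] /= m0.
  apply/eqP; rewrite eq_complex /=; apply/andP; split; apply/eqP; by field.
have N : (- (complex.Re B0 * complex.Re A0 + complex.Im B0 * complex.Im A0) / nsq B0) ^+ 2 +
  (- (complex.Re B0 * complex.Im A0 - complex.Im B0 * complex.Re A0) / nsq B0) ^+ 2 = nsq A0 / nsq B0.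
  move: m0; rewrite /nsq; case: (A0) (B0) => a0 a0' [b0 b0'] /= m0.
  by field.
have X1 : complex.Re B1 * complex.Re A1 + complex.Im B1 * complex.Im A1 =
   nsq B1 * (complex.Re B0 * complex.Re A0 + complex.Im B0 * complex.Im A0) / nsq B0.
  move: m0; rewrite EA /nsq; case: (A0) (B0) (B1) => a0 a0' [b0 b0'] [b1 b1'] /= m0.
  by field.
have X2 : complex.Re B1 * complex.Im A1 - complex.Im B1 * complex.Re A1 =
   nsq B1 * (complex.Re B0 * complex.Im A0 - complex.Im B0 * complex.Re A0) / nsq B0.
  move: m0; rewrite EA /nsq; case: (A0) (B0) (B1) => a0 a0' [b0 b0'] [b1 b1'] /= m0.
  by field.
have g0 : nsq B0 + nsq A0 != 0 by rewrite addrC.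
rewrite sigmaE N /hopf F scale_mk3 X1 X2 nA; apply: mk3_congr.
- move: (nsq A0) (nsq B0) (nsq B1) m0 d0 g0 f0 => x y z m0 d0 g0 f0; field.
  by rewrite ?m0 ?d0 ?g0 ?f0.
- move: (_ + _ : R) (nsq A0) (nsq B0) (nsq B1) m0 d0 g0 f0 => w x y z m0 d0 g0 f0; field.
  by rewrite ?m0 ?d0 ?g0 ?f0.
- move: (_ - _ : R) (nsq A0) (nsq B0) (nsq B1) m0 d0 g0 f0 => w x y z m0 d0 g0 f0; field.
  by rewrite ?m0 ?d0 ?g0 ?f0.
Qed.

Definition cj b (z : C) : C := if b then z^*%C else z.

Definition nsq4 (x : 'I_4 -> C) : R := nsq (x i0) + nsq (x i1) + nsq (x i2) + nsq (x i3).

Lemma nsq4_gt0 (x : 'I_4 -> C) : (exists i, x i != 0) -> 0 < nsq4 x.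
Proof.
have h := (nsq_ge0 (x i0), nsq_ge0 (x i1), nsq_ge0 (x i2), nsq_ge0 (x i3)).
move=> [i xi]; have := nsq_gt0 xi; rewrite /nsq4.
move: h; move: i xi; apply: ord4P => _ [[[h0 h1] h2] h3] hp; lra.
Qed.

(** A closed form of the direction in terms of the gradient, with no chart of the sphere involved:
    its smoothness is visible wherever the gradient is non-zero. The two dualities differ by the
    sign of the cross product. *)
Definition gdir b (x : 'I_4 -> C) : 'rV[R]_3 :=
  let c := complex.Re (x i0) in let d := complex.Im (x i0) in
  let a1 := complex.Re (x i1) in let b1 := complex.Im (x i1) in
  let a2 := complex.Re (x i2) in let b2 := complex.Im (x i2) in
  let a3 := complex.Re (x i3) in let b3 := complex.Im (x i3) in
  let s := if b then -1 else 1 in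
  (2 / nsq4 x) *:
  mk3 (s * (a2 * b3 - a3 * b2) - (c * a1 + d * b1))
      (s * (a3 * b1 - a1 * b3) - (c * a2 + d * b2))
      (s * (a1 * b2 - a2 * b1) - (c * a3 + d * b3)).

Lemma gdir_hopf b x : (exists i, x i != 0) -> gdir b x =
  hopf (cj b (lA (epsb R b) false x)) (cj b (lB (epsb R b) false x))
       (cj b (lA (epsb R b) true x)) (cj b (lB (epsb R b) true x)).
Proof.
move=> /nsq4_gt0/lt0r_neq0 D0.
rewrite /gdir /hopf !scale_mk3.
have E : nsq (cj b (lA (epsb R b) false x)) + nsq (cj b (lB (epsb R b) false x)) +
   nsq (cj b (lA (epsb R b) true x)) + nsq (cj b (lB (epsb R b) true x)) = 2 * nsq4 x.
  rewrite /nsq4; case: b; rewrite /epsb /lA /lB /nsq /cj;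
    by case: (x i0) (x i1) (x i2) (x i3) => c d [a1 b1] [a2 b2] [a3 b3] /=; ring.
rewrite E; move: (nsq4 x) D0 => D D0.
case: b {E}; rewrite /epsb /lA /lB /nsq /cj;
  case: (x i0) (x i1) (x i2) (x i3) => c d [a1 b1] [a2 b2] [a3 b3] /=;
  by apply: mk3_congr; field.
Qed.

Definition null_vector (x : 'I_4 -> C) := \sum_i msign C i * x i ^+ 2 = 0.

(** Nullity factors as (x0+x1)(x0-x1) = (x2+ep x3)(x2-ep x3), so both values of [k] describe the
    same point of the projective line. *)
Lemma null_pairs b x : null_vector x ->
  lA (epsb R b) false x * lB (epsb R b) true x = lA (epsb R b) true x * lB (epsb R b) false x.
Proof.
rewrite /null_vector sum4E /msign /= !mulN1r !mul1r => N; rewrite /lA /lB.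
apply: subr0_eq; transitivity (- (- x i0 ^+ 2 + x i1 ^+ 2 + x i2 ^+ 2 - epsb R b ^+ 2 * x i3 ^+ 2)).
  by ring.
by rewrite epsb_sqr mulN1r opprK N oppr0.
Qed.

Lemma cjM b (z w : C) : cj b (z * w) = cj b z * cj b w.
Proof. by case: b => //; exact: rmorphM. Qed.

Lemma cjV b (z : C) : cj b z^-1 = (cj b z)^-1.
Proof. by case: b => //; exact: conjc_inv. Qed.

Lemma cjN b (z : C) : cj b (- z) = - cj b z.
Proof. by case: b => //; exact: raddfN. Qed.

Lemma cj_eq0 b (z : C) : (cj b z == 0) = (z == 0).
Proof. by case: b => //; exact: conjc_eq0. Qed.

Lemma gdir_sigma b k x : null_vector x -> lB (epsb R b) k x != 0 ->
  gdir b x = sigma (cj b (- (lA (epsb R b) k x / lB (epsb R b) k x))).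
Proof.
move=> nx B0.
have nz : exists i, x i != 0.
  apply: contrapT => /forallNP z; move: B0.
  have x0 i : x i = 0 by have /negP := z i; rewrite negbK => /eqP.
  by rewrite /lB; case: k; rewrite !x0 ?mulr0 subrr eqxx.
have P := null_pairs b nx.
rewrite (gdir_hopf b nz) cjN cjM cjV -mulNr.
case: k B0 => B0; last first.
  by apply: hopf_sigma; rewrite ?cj_eq0// -!cjM P.
by rewrite hopf_swap; apply: hopf_sigma; rewrite ?cj_eq0// -!cjM P.
Qed.

Lemma gdir_sigma_inf b k x : null_vector x -> lA (epsb R b) k x != 0 ->
  gdir b x = reflect13 (sigma (cj b (- (lB (epsb R b) k x / lA (epsb R b) k x)))).
Proof.
move=> nx B0.
have nz : exists i, x i != 0.
  apply: contrapT => /forallNP z; move: B0.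
  have x0 i : x i = 0 by have /negP := z i; rewrite negbK => /eqP.
  by rewrite /lA; case: k; rewrite !x0 ?mulr0 addr0 eqxx.
have P := null_pairs b nx.
rewrite (gdir_hopf b nz) cjN cjM cjV -mulNr hopf_reflect; congr reflect13.
case: k B0 => B0; last first.
  by apply: hopf_sigma; rewrite ?cj_eq0// -!cjM [X in cj b X = _]mulrC -P mulrC.
by rewrite hopf_swap; apply: hopf_sigma; rewrite ?cj_eq0// -!cjM [X in cj b X = _]mulrC P mulrC.
Qed.

(** Numerator and denominator both acquire the factor |h|^2. This is what makes the direction
    independent of the chart of the surface. *)
Lemma gdirZ b (h : C) x : h != 0 -> (exists i, x i != 0) ->
  gdir b (fun i => h * x i) = gdir b x.
Proof.
move=> h0 nz; have D0 := lt0r_neq0 (nsq4_gt0 nz); have H0 := lt0r_neq0 (nsq_gt0 h0).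
have E : nsq4 (fun i => h * x i) = nsq h * nsq4 x.
  rewrite /nsq4 /nsq; case: h {h0 H0} => h1 h2.
  by case: (x i0) (x i1) (x i2) (x i3) => c d [a1 b1] [a2 b2] [a3 b3] /=; ring.
rewrite /gdir E !scale_mk3; move: (nsq4 x) D0 H0 => D D0; rewrite /nsq.
case: h {h0 E} => h1 h2 /=.
case: (x i0) (x i1) (x i2) (x i3) => c d [a1 b1] [a2 b2] [a3 b3] /= H0.
by move: (if b then -1 else 1) => s; apply: mk3_congr; field; rewrite D0 H0.
Qed.

Lemma sum3E (F : 'I_3 -> R) : \sum_j F j = F ord0 + F (lift ord0 ord0) + F (lift ord0 (lift ord0 ord0)).
Proof. by rewrite !big_ord_recl big_ord0 addr0 !addrA. Qed.

Lemma sigma_unit (u : C) : dot (sigma u) (sigma u) = 1.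
Proof.
case: u => a b; rewrite /dot sum3E sigmaE !mk3_lift; have := one_nsq a b => n0; by field.
Qed.

Lemma reflect13_dot (x y : 'rV[R]_3) : dot (reflect13 x) (reflect13 y) = dot x y.
Proof. by rewrite /dot !sum3E /reflect13 !mk3_lift; ring. Qed.

Lemma pair_neq0 b x : (exists i, x i != 0) ->
  exists k, lB (epsb R b) k x != 0 \/ lA (epsb R b) k x != 0.
Proof.
move=> [i xi]; apply: contrapT => /forallNP H.
have HB k : lB (epsb R b) k x = 0.
  by have /not_orP[/negP + _] := H k; rewrite negbK => /eqP.
have HA k : lA (epsb R b) k x = 0.
  by have /not_orP[_ /negP] := H k; rewrite negbK => /eqP.
have e0 : epsb R b != 0.
  by apply: contra_eq_neq (epsb_sqr R b) => ->; rewrite expr0n /= eq_sym oppr_eq0 oner_eq0.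
have two0 : (2 : C) != 0 by rewrite pnatr_eq0.
have := HA false; have := HA true; have := HB false; have := HB true.
rewrite /lA /lB => B1 B0 A1 A0.
have x0 : x i0 = 0 by apply: (mulfI two0); rewrite mulr0 -(addr0 0) -{1}A0 -B1; ring.
have x1 : x i1 = 0 by move: A0; rewrite x0 add0r.
have x2 : x i2 = 0 by apply: (mulfI two0); rewrite mulr0 -(addr0 0) -{1}A1 -B0; ring.
have x3 : x i3 = 0 by move: A1; rewrite x2 add0r => /eqP; rewrite mulf_eq0 (negbTE e0) => /eqP.
by move: i xi; apply: ord4P; rewrite ?x0 ?x1 ?x2 ?x3 eqxx.
Qed.

Lemma gdir_unit b x : null_vector x -> (exists i, x i != 0) -> dot (gdir b x) (gdir b x) = 1.
Proof.
move=> nx /(pair_neq0 b)[k [B0|A0]].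
  by rewrite (gdir_sigma nx B0) sigma_unit.
by rewrite (gdir_sigma_inf nx A0) reflect13_dot sigma_unit.
Qed.

(* The plane annihilated by the gradient, expressed in the affine
   coordinate u of the null direction *)
Definition annihilates (u : C) (x : 'I_4 -> C) :=
  x i0 + x i1 + u * (x i2 - Complex 0 1 * x i3) = 0 /\
  x i2 + Complex 0 1 * x i3 + u * (x i0 - x i1) = 0.

Lemma annihilates_pairs k (x : 'I_4 -> C) : null_vector x -> lB (epsb R false) k x != 0 ->
  annihilates (- (lA (epsb R false) k x / lB (epsb R false) k x)) x.
Proof.
move=> nx; have := null_pairs false nx; rewrite /annihilates /lA /lB /=.
case: k; set a := x i0 + x i1; set b := x i0 - x i1; set c := x i2 + Complex 0 1 * x i3; set d := x i2 - Complex 0 1 * x i3 => E B0.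
  split; last by field.
  rewrite -[RHS](mul0r b^-1) -(subrr (c * d)) -{1}E; by field.
split; first by field.
rewrite -[RHS](mul0r d^-1) -(subrr (c * d)) -{2}E; by field.
Qed.

(** The free parameters are the real and imaginary parts of x0 - x1 and x2 - i x3; the two equations
    determine x0 + x1 and x2 + i x3 from them. *)
Lemma annihilates_param (a b : R) (x : 'I_4 -> C) : annihilates (Complex a b) x ->
  exists al1 al2 be1 be2 : R,
  [/\ x i0 = Complex ((al1 - a * be1 + b * be2) / 2) ((al2 - a * be2 - b * be1) / 2),
      x i1 = Complex ((- al1 - a * be1 + b * be2) / 2) ((- al2 - a * be2 - b * be1) / 2),
      x i2 = Complex ((be1 - a * al1 + b * al2) / 2) ((be2 - a * al2 - b * al1) / 2) &
      x i3 = Complex ((- be2 - a * al2 - b * al1) / 2) ((be1 + a * al1 - b * al2) / 2)].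
Proof.
rewrite /annihilates; case: (x i0) (x i1) (x i2) (x i3) => c d [a1 b1] [a2 b2] [a3 b3] /=.
move=> [[E1 E2] [E3 E4]]; exists (c - a1), (d - b1), (a2 + b3), (b2 - a3).
by split; congr Complex; lra.
Qed.

Definition dotc (X : 'rV[R]_3) (x : 'I_4 -> C) : C :=
  \sum_j Complex (X 0 j) 0 * x (lift ord0 j).

Lemma dotcE X x : dotc X x = Complex (X 0 ord0) 0 * x i1 +
  Complex (X 0 (lift ord0 ord0)) 0 * x i2 + Complex (X 0 (lift ord0 (lift ord0 ord0))) 0 * x i3.
Proof. by rewrite /dotc !big_ord_recl big_ord0 addr0 !addrA. Qed.

Lemma crossE (X Y : 'rV[R]_3) : cross X Y = mk3
  (X 0 (lift ord0 ord0) * Y 0 (lift ord0 (lift ord0 ord0)) - X 0 (lift ord0 (lift ord0 ord0)) * Y 0 (lift ord0 ord0))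
  (X 0 (lift ord0 (lift ord0 ord0)) * Y 0 ord0 - X 0 ord0 * Y 0 (lift ord0 (lift ord0 ord0)))
  (X 0 ord0 * Y 0 (lift ord0 ord0) - X 0 (lift ord0 ord0) * Y 0 ord0).
Proof. by rewrite /cross !inord3. Qed.

Lemma sigma_annihilates (u : C) (x : 'I_4 -> C) : annihilates u x ->
  x i0 + dotc (sigma u) x = 0.
Proof.
case: u => a b /annihilates_param[al1 [al2 [be1 [be2 [E0 E1 E2 E3]]]]].
rewrite dotcE sigmaE !mk3_lift E0 E1 E2 E3; have n0 := one_nsq a b.
by apply/eqP; rewrite eq_complex /=; apply/andP; split; apply/eqP; field.
Qed.

(** On the plane orthogonal to U, the covector intertwines the rotation with multiplication by i.
    Real and imaginary parts hold modulo the orthogonality of X and U, with the explicit multiples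
    used below. *)
Lemma sigma_conformal (u : C) (x : 'I_4 -> C) (X : 'rV[R]_3) : annihilates u x ->
  dot X (sigma u) = 0 -> dotc (cross (sigma u) X) x = Complex 0 1 * dotc X x.
Proof.
case: u => a b /annihilates_param[al1 [al2 [be1 [be2 [E0 E1 E2 E3]]]]].
rewrite /dot sum3E !dotcE crossE !mk3_lift sigmaE !mk3_lift E1 E2 E3; have n0 := one_nsq a b.
move: (X 0 ord0) (X 0 _) (X 0 _) => X1 X2 X3 T.
apply/eqP; rewrite eq_complex /=; apply/andP; split; apply/eqP; apply: subr0_eq.
  rewrite -[RHS](mulr0 (- ((al2 - a * be2 - b * be1) / 2))) -[X in _ = _ * X]T; by field.
rewrite -[RHS](mulr0 ((al1 - a * be1 + b * be2) / 2)) -[X in _ = _ * X]T; by field.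
Qed.

(** The action of [reflect13] on covectors; it exchanges the numerators [lA] with the denominators
    [lB] of opposite [k], hence inverts their ratio. *)
Definition reflect4 (x : 'I_4 -> C) : 'I_4 -> C :=
  fun i => if (i == i1) || (i == i3) then - x i else x i.

Lemma annihilates_reflect k (x : 'I_4 -> C) : null_vector x -> lA (epsb R false) k x != 0 ->
  annihilates (- (lB (epsb R false) k x / lA (epsb R false) k x)) (reflect4 x).
Proof.
move=> nx; have := null_pairs false nx; rewrite /annihilates /lA /lB /reflect4 /= ?opprK ?mulrN ?opprK.
case: k; set a := x i0 + x i1; set b := x i0 - x i1; set c := x i2 + Complex 0 1 * x i3; set d := x i2 - Complex 0 1 * x i3 => E B0.
  split; first by field.
  rewrite -[RHS](mul0r c^-1) -(subrr (c * d)) -{2}E; by field.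
split; last by field.
rewrite -[RHS](mul0r a^-1) -(subrr (c * d)) -{1}E; by field.
Qed.

Lemma dotc_reflect X x : dotc (reflect13 X) x = dotc X (reflect4 x).
Proof.
rewrite !dotcE /reflect13 !mk3_lift /reflect4 /=.
have E (r : R) (z : C) : Complex (- r) 0 * z = Complex r 0 * - z.
  by case: z => z1 z2; congr Complex; rewrite /=; ring.
by rewrite !E.
Qed.

Lemma cross_reflect X Y : cross (reflect13 X) (reflect13 Y) = reflect13 (cross X Y).
Proof. by rewrite !crossE /reflect13 !mk3_lift; apply: mk3_congr; ring. Qed.

Lemma reflect13K X : reflect13 (reflect13 X) = X.
Proof. by rewrite /reflect13 !mk3_lift !opprK -row3E. Qed.

(** Conjugation exchanges the two dualities, which reduces every statement on [gdir] to
    [b = false]. *)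
Lemma gdir_conj (x : 'I_4 -> C) : gdir true x = gdir false (fun i => (x i)^*%C).
Proof.
rewrite /gdir; congr (2 / _ *: _).
  by rewrite /nsq4 /nsq; case: (x i0) (x i1) (x i2) (x i3) => c d [a1 b1] [a2 b2] [a3 b3] /=; rewrite !sqrrN.
by case: (x i0) (x i1) (x i2) (x i3) => c d [a1 b1] [a2 b2] [a3 b3] /=; apply: mk3_congr; ring.
Qed.

Lemma gdir_cj b (x : 'I_4 -> C) : gdir b x = gdir false (fun i => cj b (x i)).
Proof. by case: b => //; exact: gdir_conj. Qed.

Lemma null_conj (x : 'I_4 -> C) : null_vector x -> null_vector (fun i => (x i)^*%C).
Proof.
rewrite /null_vector !sum4E /msign /= !mulN1r !mul1r !expr2.
case: (x i0) (x i1) (x i2) (x i3) => c d [a1 b1] [a2 b2] [a3 b3] /= [E1 E2].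
apply/eqP; rewrite eq_complex /=; apply/andP; split; apply/eqP.
  by rewrite -[RHS]E1; ring.
by rewrite -[RHS]oppr0 -[X in _ = - X]E2; ring.
Qed.

Lemma gdir_tangent b x : null_vector x -> (exists i, x i != 0) ->
  cj b (x i0) + dotc (gdir b x) (fun i => cj b (x i)) = 0.
Proof.
move=> nx nz; rewrite gdir_cj.
have nx' : null_vector (fun i => cj b (x i)) by case: b => //; exact: null_conj.
have nz' : exists i, cj b (x i) != 0 by case: nz => i; rewrite -(cj_eq0 b); exists i.
have [k [B0|A0]] := pair_neq0 false nz'.
  by rewrite (gdir_sigma nx' B0); exact: sigma_annihilates (annihilates_pairs nx' B0).
rewrite (gdir_sigma_inf nx' A0) dotc_reflect.
exact: sigma_annihilates (annihilates_reflect nx' A0).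
Qed.

Lemma gdir_conformal b x X : null_vector x -> (exists i, x i != 0) ->
  dot X (gdir b x) = 0 ->
  dotc (cross (gdir b x) X) (fun i => cj b (x i)) = Complex 0 1 * dotc X (fun i => cj b (x i)).
Proof.
move=> nx nz; rewrite gdir_cj.
have nx' : null_vector (fun i => cj b (x i)) by case: b => //; exact: null_conj.
have nz' : exists i, cj b (x i) != 0 by case: nz => i; rewrite -(cj_eq0 b); exists i.
have [k [B0|A0]] := pair_neq0 false nz'.
  by rewrite (gdir_sigma nx' B0); exact: sigma_conformal (annihilates_pairs nx' B0).
rewrite (gdir_sigma_inf nx' A0) -{1 2}(reflect13K X) reflect13_dot cross_reflect dotc_reflect => T.
rewrite (sigma_conformal (annihilates_reflect nx' A0) T).
by rewrite -dotc_reflect reflect13K.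
Qed.

(** The differential of [sigma] at u applied to w, in the form that the quotient rule gives. *)
Definition dsigma (u w : C) : 'rV[R]_3 :=
  let a := complex.Re u in let b := complex.Im u in
  let dn := 2 * (a * complex.Re w + b * complex.Im w) in
  (1 + (a ^+ 2 + b ^+ 2))^-1 *:
  mk3 (- dn - sigma u 0 ord0 * dn)
      (2 * complex.Re w - sigma u 0 (lift ord0 ord0) * dn)
      (2 * complex.Im w - sigma u 0 (lift ord0 (lift ord0 ord0)) * dn).

Lemma dsigma_conformal (u w : C) : cross (sigma u) (dsigma u w) = dsigma u (Complex 0 1 * w).
Proof.
case: u w => a b [p q]; rewrite /dsigma crossE sigmaE !scale_mk3 !mk3_lift /=.
by have n0 := one_nsq a b; apply: mk3_congr; field.
Qed.

End Direction.

(** * Smoothness of the direction field and the shear-free condition *)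

Section DirectionField.
Variable R : realType.
Local Notation V := (M4 R).
Local Notation C := (Cx R).
Implicit Types (f g h u : V -> C) (O : set V) (i j : 'I_4) (b k : bool).

Lemma Ck_row m O n (F : V -> 'rV[R]_m.+1) : open O ->
  (forall j : 'I_m.+1, Ck n O (fun x => F x 0 j)) -> Ck n O F.
Proof.
move=> oO; elim: n F => [|n IH] F HF.
  split=> // p Op; rewrite /prop_for /continuous_at; apply: (iffRL (@cvgrPdist_le R _ V (nbhs p) (nbhs_filter p) F (F p))) => eps e0.
  have : \forall x \near p, forall j : 'I_m.+1, `|F p 0 j - F x 0 j| <= eps.
    apply: (@filter_forall _ _ _ (nbhs p)) => j; have [c _] := HF j.
    by have := c p Op; rewrite /prop_for /continuous_at => /cvgrPdist_le; exact.
  apply: filterS => x H; rewrite [`|_|]mx_normrE; apply/bigmax_leP; split; first exact: ltW.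
  by move=> -[a j] _ /=; rewrite (ord1 a) !mxE; exact: H.
have C0 := IH F (fun j : 'I_m.+1 => Ck_pred (HF j)).
split=> [p Op|i].
  by case: n C0 {IH HF} => [|n] [c _]; exact: c.
have dF p : O p -> derivable F p (basis4 R i).
  move=> Op; apply/derivable_mxP => a j; rewrite (ord1 a).
  by have [_ /(_ i)[d _]] := HF j; exact: d.
split=> //; apply: (@Ck_ext _ _ _ _ (fun p => \row_j 'D_(basis4 R i) (fun x => F x 0 j) p)) => //.
  move=> p Op; rewrite (derive_mx (dF p Op)); apply/rowP => j.
  by rewrite !mxE.
apply: IH => j; have [_ /(_ i)[_]] := HF j; apply: Ck_ext => // p Op.
by rewrite mxE.
Qed.

Lemma gdir_smooth O b f : open O -> csmooth O f ->
  (forall x, O x -> exists i, cpartial i f x != 0) ->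
  smooth_on O (fun x => gdir b (grad f x)).
Proof.
move=> oO sf nz n; apply: Ck_row => // j.
have re i : Ck n O (fun x => complex.Re (grad f x i)) by have [] := csmooth_partial i sf.
have im i : Ck n O (fun x => complex.Im (grad f x i)) by have [] := csmooth_partial i sf.
have D : Ck n O (fun x => (nsq4 (grad f x))^-1).
  apply: CkV => //; first by move=> x /nz/nsq4_gt0/lt0r_neq0.
  have sq i : Ck n O (fun x => nsq (grad f x i)).
    apply: Ck_ext oO _ (CkD oO (CkM oO (re i) (re i)) (CkM oO (im i) (im i))) => x _.
    by rewrite /nsq !expr2.
  by apply: (CkD oO (CkD oO (CkD oO (sq i0) (sq i1)) (sq i2)) (sq i3)).
have D2 : Ck n O (fun x => 2 / nsq4 (grad f x)) by exact: (CkM oO (Ck_cst O n 2) D).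
have term (s : R) (a b' c d e g' h' m : 'I_4) : Ck n O (fun x => 2 / nsq4 (grad f x) *
   (s * (complex.Re (grad f x a) * complex.Im (grad f x b') - complex.Re (grad f x c) * complex.Im (grad f x d))
    - (complex.Re (grad f x e) * complex.Re (grad f x g') + complex.Im (grad f x h') * complex.Im (grad f x m)))).
  pose M1 := CkD oO (CkM oO (re a) (im b')) (CkN oO (CkM oO (re c) (im d))).
  pose M2 := CkN oO (CkD oO (CkM oO (re e) (re g')) (CkM oO (im h') (im m))).
  exact: (CkM oO D2 (CkD oO (CkM oO (Ck_cst O n s) M1) M2)).
case: j => -[|[|[|//]]] j3.
- apply: Ck_ext oO _ (term (if b then -1 else 1) i2 i3 i3 i2 i0 i1 i0 i1) => x _.
  by rewrite /gdir scale_mk3 mxE.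
- apply: Ck_ext oO _ (term (if b then -1 else 1) i3 i1 i1 i3 i0 i2 i0 i2) => x _.
  by rewrite /gdir scale_mk3 mxE.
- apply: Ck_ext oO _ (term (if b then -1 else 1) i1 i2 i2 i1 i0 i3 i0 i3) => x _.
  by rewrite /gdir scale_mk3 mxE.
Qed.

Definition cdir (Y : V) u p : C := \sum_i Complex (Y 0 i) 0 * cpartial i u p.

Lemma cdir_is_derive O u p (Y : V) : open O -> csmooth O u -> O p ->
  is_derive p Y (re_part u) (complex.Re (cdir Y u p)) /\
  is_derive p Y (im_part u) (complex.Im (cdir Y u p)).
Proof.
move=> oO [ru iu] Op.
have E : cdir Y u p = Complex (directional (re_part u) Y p) (directional (im_part u) Y p).
  rewrite /cdir /directional; elim: (index_enum _) => [|i s IH]; first by rewrite !big_nil.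
  rewrite !big_cons IH -CxD; congr (_ + _).
  by apply/eqP; rewrite eq_complex /= !mul0r subr0 addr0 !eqxx.
by rewrite E /=; split; [exact: C1_is_derive oO (ru 1%N) Op|exact: C1_is_derive oO (iu 1%N) Op].
Qed.

Lemma derive_quotient (g S N : V -> R) (p Y : V) (dS dN : R) :
  (forall q, g q = N q / S q) -> (forall q, S q != 0) ->
  is_derive p Y S dS -> is_derive p Y N dN ->
  is_derive p Y g ((dN - g p * dS) / S p).
Proof.
move=> gE S0 DS DN.
have dv : derivable (fun q => (S q)^-1) p Y by apply: derivableV => //; have [] := DS.
have E : g = N * (fun q => (S q)^-1) by apply/funext => q; rewrite gE.
have [dN1 dN2] := DN; have [dS1 dS2] := DS.
rewrite {1}E; apply: DeriveDef; first exact: (derivableM dN1 dv).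
rewrite (deriveM dN1 dv) (deriveV (S0 p) dS1) dN2 dS2 gE /GRing.scale /=.
by have := S0 p => s0; field.
Qed.

Lemma sigma_derive O u p (Y : V) : open O -> csmooth O u -> O p ->
  derivable (fun q => sigma (u q)) p Y /\
  'D_Y (fun q => sigma (u q)) p = dsigma (u p) (cdir Y u p).
Proof.
move=> oO su Op; have [Dr Di] := cdir_is_derive Y oO su Op.
pose S : V -> R := cst 1 + (re_part u * re_part u + im_part u * im_part u).
have SE q : S q = 1 + (complex.Re (u q) ^+ 2 + complex.Im (u q) ^+ 2) by rewrite !expr2.
have S0 q : S q != 0 by rewrite SE; exact: one_nsq.
pose dn : R := 2 * (complex.Re (u p) * complex.Re (cdir Y u p) + complex.Im (u p) * complex.Im (cdir Y u p)).
have DS : is_derive p Y S dn.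
  have H := is_deriveD (is_derive_cst (1 : R) p Y) (is_deriveD (is_deriveM Dr Dr) (is_deriveM Di Di)).
  have alg (a b r s : R) : 0 + (a *: r + a *: r + (b *: s + b *: s)) = 2 * (a * r + b * s).
    by rewrite /GRing.scale /=; ring.
  exact: (is_derive_eq H (alg _ _ _ _)).
have sE q : sigma (u q) = mk3
  ((1 - (complex.Re (u q) ^+ 2 + complex.Im (u q) ^+ 2)) / S q)
  (2 * complex.Re (u q) / S q) (2 * complex.Im (u q) / S q).
  by rewrite SE; case: (u q) => a b; rewrite sigmaE.
have D (j : 'I_3) : is_derive p Y (fun q => sigma (u q) 0 j) (dsigma (u p) (cdir Y u p) 0 j).
  have sub (x y : R) : is_derive p Y (fun q => sigma (u q) 0 j) x -> x = y ->
     is_derive p Y (fun q => sigma (u q) 0 j) y by move=> + <-.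
  have [->|[->|->]] : j = ord0 \/ j = lift ord0 ord0 \/ j = lift ord0 (lift ord0 ord0).
    case: j {sub} => -[|[|[|//]]] j3; [left|right; left|right; right]; exact: val_inj.
  - have DN : is_derive p Y (cst 1 - (re_part u * re_part u + im_part u * im_part u)) (- dn).
      have H := is_deriveB (is_derive_cst (1 : R) p Y) (is_deriveD (is_deriveM Dr Dr) (is_deriveM Di Di)).
      have alg (a b r s : R) : 0 - (a *: r + a *: r + (b *: s + b *: s)) = - (2 * (a * r + b * s)).
        by rewrite /GRing.scale /=; ring.
      exact: (is_derive_eq H (alg _ _ _ _)).
    have gE q : sigma (u q) 0 ord0 = (cst 1 - (re_part u * re_part u + im_part u * im_part u)) q / S q.
      by rewrite sE mk3_lift !expr2.
    have := derive_quotient gE S0 DS DN.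
    by rewrite /dsigma scale_mk3 !mk3_lift -SE -/dn mulrC.
  - have DN : is_derive p Y (cst 2 * re_part u) (2 * complex.Re (cdir Y u p)).
      have alg (a r : R) : (2 : R) *: r + a *: (0 : R) = 2 * r by rewrite scaler0 addr0.
      exact: (is_derive_eq (is_deriveM (is_derive_cst (2 : R) p Y) Dr) (alg _ _)).
    have gE q : sigma (u q) 0 (lift ord0 ord0) = (cst 2 * re_part u) q / S q.
      by rewrite sE mk3_lift.
    have := derive_quotient gE S0 DS DN.
    by rewrite /dsigma scale_mk3 !mk3_lift -SE -/dn mulrC.
  - have DN : is_derive p Y (cst 2 * im_part u) (2 * complex.Im (cdir Y u p)).
      have alg (a r : R) : (2 : R) *: r + a *: (0 : R) = 2 * r by rewrite scaler0 addr0.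
      exact: (is_derive_eq (is_deriveM (is_derive_cst (2 : R) p Y) Di) (alg _ _)).
    have gE q : sigma (u q) 0 (lift ord0 (lift ord0 ord0)) = (cst 2 * im_part u) q / S q.
      by rewrite sE mk3_lift.
    have := derive_quotient gE S0 DS DN.
    by rewrite /dsigma scale_mk3 !mk3_lift -SE -/dn mulrC.
have d : derivable (fun q => sigma (u q)) p Y.
  by apply/derivable_mxP => a j; rewrite (ord1 a); have [] := D j.
split=> //; rewrite (derive_mx d); apply/rowP => j; rewrite mxE.
by have [_ ->] := D j.
Qed.

Lemma reflect13_derive (F : V -> 'rV[R]_3) p (Y : V) : derivable F p Y ->
  derivable (fun q => reflect13 (F q)) p Y /\
  'D_Y (fun q => reflect13 (F q)) p = reflect13 ('D_Y F p).
Proof.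
move=> dF; have c (j : 'I_3) : derivable (fun q => F q 0 j) p Y by exact: (derivable_mxP F p Y).1 dF 0 j.
have D (j : 'I_3) : is_derive p Y (fun q => reflect13 (F q) 0 j) (reflect13 ('D_Y F p) 0 j).
  have DF (j' : 'I_3) : is_derive p Y (fun q => F q 0 j') ('D_Y F p 0 j').
    by apply: DeriveDef => //; rewrite (derive_mx dF) mxE.
  have [->|[->|->]] : j = ord0 \/ j = lift ord0 ord0 \/ j = lift ord0 (lift ord0 ord0).
    case: j => -[|[|[|//]]] j3; [left|right; left|right; right]; exact: val_inj.
  - rewrite mk3_lift (_ : (fun q => _) = - (fun q => F q 0 ord0)); first exact: is_deriveN.
    by apply/funext => q; rewrite mk3_lift.
  - rewrite mk3_lift (_ : (fun q => reflect13 (F q) 0 _) = (fun q => F q 0 (lift ord0 ord0))) //.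
    by apply/funext => q; rewrite mk3_lift.
  - rewrite mk3_lift (_ : (fun q => reflect13 (F q) 0 _) = - (fun q => F q 0 (lift ord0 (lift ord0 ord0)))); first exact: is_deriveN.
    by apply/funext => q; rewrite mk3_lift.
have d : derivable (fun q => reflect13 (F q)) p Y.
  by apply/derivable_mxP => a j; rewrite (ord1 a); have [] := D j.
split=> //; rewrite (derive_mx d); apply/rowP => j; rewrite mxE.
by have [_ ->] := D j.
Qed.

Lemma tangent_field_derive (U : V -> 'rV[R]_3) p (Y : V) : derivable U p Y ->
  'D_Y (tangent_field U) p = mkM4 0 ('D_Y U p).
Proof.
move=> dU.
have D i : is_derive p Y (fun q => tangent_field U q 0 i) (mkM4 0 ('D_Y U p) 0 i).
  rewrite /tangent_field mxE.
  case E : (unlift 0 i) => [j|].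
    rewrite (_ : (fun q => mkM4 1 (U q) 0 i) = fun q => U q 0 j); last first.
      by apply/funext => q; rewrite mxE E.
    apply: DeriveDef; first exact: (derivable_mxP U p Y).1 dU 0 j.
    by rewrite (derive_mx dU) mxE.
  rewrite (_ : (fun q => mkM4 1 (U q) 0 i) = cst 1); last first.
    by apply/funext => q; rewrite mxE E.
  exact: is_derive_cst.
have d : derivable (tangent_field U) p Y.
  by apply/derivable_mxP => a i; rewrite (ord1 a); have [] := D i.
rewrite (derive_mx d); apply/rowP => i; rewrite mxE.
by have [_ ->] := D i.
Qed.

Lemma space_part_mkM4 (t : R) x : space_part (mkM4 t x) = x.
Proof. by apply/rowP => j; rewrite !mxE liftK. Qed.

Lemma time_part_mkM4 (t : R) x : time_part (mkM4 t x) = t.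
Proof. by rewrite /time_part mxE unlift_none. Qed.

Lemma proj_Sigma_mkM4 U (p : V) y : proj_Sigma U p (mkM4 0 y) = mkM4 0 y.
Proof. by rewrite /proj_Sigma time_part_mkM4 scale0r subr0. Qed.

Lemma cdir_space (Y : V) u p : time_part Y = 0 ->
  cdir Y u p = dotc (space_part Y) (grad u p).
Proof.
rewrite /time_part => t0; rewrite /cdir big_ord_recl t0 mul0r add0r.
by apply: eq_bigr => j _; rewrite mxE.
Qed.

(** U is the stereographic image of a u with du proportional to df, or to its conjugate. By
    [gdir_conformal], df turns the rotation of X into multiplication by i; so does du, and the
    conformality of [sigma] turns it back into the rotation of dU(X). *)
Lemma shear_free_point O f b (U : V -> 'rV[R]_3) p X : open O -> O p -> null_wave O f ->
  (forall x, O x -> exists i, cpartial i f x != 0) -> unobstructed b f p ->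
  (forall x, O x -> U x = gdir b (grad f x)) -> in_Sigma U p X ->
  proj_Sigma U p (nabla (Jperp U p X) (tangent_field U) p) =
    Jperp U p (proj_Sigma U p (nabla X (tangent_field U) p)).
Proof.
move=> oO Op [sf nul wav] nz uo UE [tX dX].
have nx : null_vector (grad f p) by exact: nul.
have nzp : exists i, grad f p i != 0 by exact: nz.
have TJ : time_part (Jperp U p X) = 0 by rewrite time_part_mkM4.
suff [dU HU] : (forall Y, derivable U p Y) /\
    'D_(Jperp U p X) U p = cross (U p) ('D_X U p).
  have E1 := etrans (congr1 (proj_Sigma U p) (tangent_field_derive (dU X))) (proj_Sigma_mkM4 U p _).
  have E2 := etrans (congr1 (proj_Sigma U p) (tangent_field_derive (dU (Jperp U p X))))
    (proj_Sigma_mkM4 U p _).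
  refine (etrans E2 (etrans _ (congr1 (Jperp U p) (esym E1)))).
  by rewrite /Jperp space_part_mkM4 HU.
have [r r0 rO] := open_cube oO Op.
have oB := @cube_open R p r; have pB := cube_center p r0.
have sfB := csmooth_sub rO sf.
have [k hk] := pair_neq0 b nzp.
(* T is the identity in the chart u = -A/B and the half-turn in the chart -B/A, so one argument
   serves both. *)
have core g h (T : 'rV[R]_3 -> 'rV[R]_3) : csmooth (cube p r) g -> csmooth (cube p r) h -> h p != 0 ->
    (forall F Y, derivable F p Y -> derivable (fun q => T (F q)) p Y /\
        'D_Y (fun q => T (F q)) p = T ('D_Y F p)) ->
    (forall x y, cross (T x) (T y) = T (cross x y)) ->
    (forall i j, wronskian f g h i p * cpartial j f p = wronskian f g h j p * cpartial i f p) ->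
    (forall x, cube p r x -> h x != 0 -> U x = T (sigma (cj b (- (g x / h x))))) ->
    (forall Y, derivable U p Y) /\ 'D_(Jperp U p X) U p = cross (U p) ('D_X U p).
  move=> sg sh hp0 TD TC W UT.
  have [r1 [be [r10 r1r _ H1]]] := shrink_neq0 r0 sh hp0.
  have sub1 := cube_sub r1r : cube p r1 `<=` cube p r.
  have oB1 := @cube_open R p r1; have pB1 := cube_center p r10.
  have h0 x : cube p r1 x -> h x != 0 by move=> /H1[].
  have sg1 := csmooth_sub sub1 sg; have sh1 := csmooth_sub sub1 sh.
  have shV := csmoothV oB1 h0 sh1; have sgh := csmoothM oB1 sg1 shV.
  have sv := csmoothN oB1 sgh.
  pose v x := - (g x / h x).
  have su : csmooth (cube p r1) (fun x => cj b (v x)).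
    by case: (b) => //; exact: csmooth_conj.
  have Ue : \forall x \near p, T (sigma (cj b (v x))) = U x.
    apply: open_nearP oB1 pB1 _ => x xr; rewrite UT//; [exact: sub1|exact: h0].
  have SD Y := sigma_derive Y oB1 su pB1.
  have TS Y := TD _ _ (SD Y).1.
  have DU Y : 'D_Y U p = T (dsigma (cj b (v p)) (cdir Y (fun x => cj b (v x)) p)).
    by rewrite -(near_eq_derive _ Ue) (TS Y).2 (SD Y).2.
  split=> [Y|]; first exact: near_eq_derivable Ue (TS Y).1.
  rewrite !DU (UT _ pB hp0) TC dsigma_conformal; congr (T (dsigma _ _)).
  have [e fe0] := nzp.
  pose lam := cpartial e v p / cpartial e f p.
  have dv i : cpartial i v p = - (wronskian f g h i p * (h p)^-1 ^+ 2).
    rewrite [LHS](cpartialN _ sgh pB1) (cpartialM _ sg1 shV pB1) (cpartialV _ oB1 h0 sh1 pB1).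
    rewrite /wronskian; move: (cpartial i g p) (cpartial i h p) (g p) (h p) hp0 => a b' u' v' v0.
    by field.
  have dvl i : cpartial i v p = lam * cpartial i f p.
    have alg (wi we fi fe t : C) : fe != 0 -> wi * fe = we * fi -> - (wi * t) = - (we * t) / fe * fi.
      move=> fe00 E; apply: (mulIf fe00).
      transitivity (- (wi * fe * t)); first by ring.
      by rewrite E; field.
    exact: (etrans (dv i) (etrans (alg _ _ _ _ _ fe0 (W i e))
      (congr1 (fun z => z / cpartial e f p * cpartial i f p) (esym (dv e))))).
  have du i : grad (fun x => cj b (v x)) p i = cj b lam * cj b (cpartial i f p).
    rewrite -cjM -dvl /grad; case: (b) => //.
    exact: cpartial_conj sv pB1.
  rewrite (cdir_space _ _ TJ) (cdir_space _ _ tX) space_part_mkM4.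
  have lin Z : dotc Z (grad (fun x => cj b (v x)) p) =
     cj b lam * dotc Z (fun i => cj b (grad f p i)).
    rewrite /dotc mulr_sumr; apply: eq_bigr => j _; rewrite du mulrCA //.
  rewrite !lin (UE _ Op) gdir_conformal//; first by rewrite mulrCA.
  by rewrite -(UE _ Op).
have uoW i j : wronskian f (numer b k f) (denom b k f) i p * cpartial j f p =
    wronskian f (numer b k f) (denom b k f) j p * cpartial i f p.
  by apply: subr0_eq; exact: uo.
have nB x : cube p r x -> null_vector (grad f x) by move=> /rO; exact: nul.
case: hk => [B0|A0].
  apply: (core (numer b k f) (denom b k f) id) => //.
  - exact: csmooth_numer.
  - exact: csmooth_denom.
  - by move=> x xr h0; rewrite (UE _ (rO _ xr)); exact: gdir_sigma (nB _ xr) h0.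
refine (core (denom b k f) (numer b k f) (@reflect13 R) _ _ A0 _ _ _ _).
- exact: csmooth_denom.
- exact: csmooth_numer.
- by move=> F Y; exact: reflect13_derive.
- exact: cross_reflect.
- move=> i j; have alg (w1 w2 f1 f2 : C) : w1 * f1 = w2 * f2 -> - w1 * f1 = - w2 * f2.
    by rewrite !mulNr => ->.
  have E m : wronskian f (denom b k f) (numer b k f) m p = - wronskian f (numer b k f) (denom b k f) m p.
    by rewrite /wronskian opprB.
  exact: (etrans (congr1 (fun z => z * cpartial j f p) (E i)) (etrans (alg _ _ _ _ (uoW i j))
    (congr1 (fun z => z * cpartial i f p) (esym (E j))))).
- by move=> x xr h0; rewrite (UE _ (rO _ xr)); exact: gdir_sigma_inf (nB _ xr) h0.
Qed.

End DirectionField.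

(** * The chain rule for a holomorphic function of a complex-valued map *)

Section ChainRule.
Variable R : realType.
Local Notation V := (M4 R).
Local Notation C := (Cx R).
Local Notation e_ := (@basis4 R).
Implicit Types (f g h u : V -> C) (O : set V) (i j : 'I_4) (b k : bool).

(** First-order expansions with t = 0 allowed compose even where the increment of f vanishes, which
    difference quotients do not. *)
Definition expansion i f (q : V) (w : C) := forall eps : R, 0 < eps ->
  exists2 del : R, 0 < del & forall t : R, `|t| < del ->
    norm1c (f (t *: e_ i + q) - f q - Complex t 0 * w) <= eps * `|t|.

Lemma real_expansion (g : V -> R) (q v : V) d : is_derive q v g d ->
  forall eps : R, 0 < eps -> exists2 del : R, 0 < del & forall t : R, `|t| < del ->
    `|g (t *: v + q) - g q - t * d| <= eps * `|t|.
Proof.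
move=> [dg dE] eps e0.
have /cvgrPdist_le/(_ eps e0) : (fun t : R => t^-1 *: ((g \o shift q) (t *: v) - g q)) @ 0^' --> d.
  by rewrite -dE; exact: dg.
rewrite /dnbhs near_withinE => /nbhs_ballP[del /= d0 H]; exists del => // t td.
have [->|t0] := eqVneq t 0; first by rewrite scale0r add0r subrr mul0r subrr !normr0 mulr0.
have := H t; rewrite -ball_normE /= sub0r normrN => /(_ td t0).
rewrite /GRing.scale /= => h.
have -> : g (t *: v + q) - g q - t * d = - (t * (d - t^-1 * (g (t *: v + q) - g q))) by field.
by rewrite normrN normrM mulrC; apply: ler_wpM2r.
Qed.

Lemma expansion_real (g : V -> R) (q v : V) d :
  (forall eps : R, 0 < eps -> exists2 del : R, 0 < del & forall t : R, `|t| < del ->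
    `|g (t *: v + q) - g q - t * d| <= eps * `|t|) -> 'D_v g q = d.
Proof.
move=> H; apply: cvg_lim => //; apply/cvgrPdist_le => eps e0.
have [del d0 Hd] := H eps e0; near=> t.
have t0 : t != 0 by near: t; exact: nbhs_dnbhs_neq.
have td : `|t| < del by near: t; exact: dnbhs0_lt.
have := Hd t td; rewrite /GRing.scale /= => h.
have -> : d - t^-1 * (g (t *: v + q) - g q) = - ((g (t *: v + q) - g q - t * d) / t) by field.
by rewrite normrN normrM normfV ler_pdivrMr ?normr_gt0.
Unshelve. all: by end_near. Qed.

Lemma cpartial_expansion i f q :
  derivable (re_part f) q (e_ i) -> derivable (im_part f) q (e_ i) ->
  expansion i f q (cpartial i f q).
Proof.
move=> /derivableP dr /derivableP di eps e0; have e20 : 0 < eps / 2 by rewrite divr_gt0.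
have [d1 d10 H1] := real_expansion dr e20; have [d2 d20 H2] := real_expansion di e20.
exists (Num.min d1 d2); first by rewrite lt_min d10.
move=> t; rewrite lt_min => /andP[t1 t2].
have h1 := H1 t t1; have h2 := H2 t t2.
rewrite [eps]splitr mulrDl /norm1c /cpartial !raddfB /= !mul0r opprK !addr0; exact: lerD.
Qed.

Lemma expansion_cpartial i f q w : expansion i f q w -> cpartial i f q = w.
Proof.
move=> H; case: w H => a b H; congr Complex; apply: expansion_real => eps e0;
  have [del d0 Hd] := H eps e0; exists del => // t /Hd.
  rewrite /norm1c !raddfB /= !mul0r opprK !addr0 => /(le_trans _); apply.
  by rewrite lerDl.
rewrite /norm1c !raddfB /= !mul0r opprK !addr0 => /(le_trans _); apply.
by rewrite lerDr.
Qed.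

Lemma complex_expansion (h : C -> C) z : derivable h z 1 -> exists d : C,
  forall eps : R, 0 < eps -> exists2 del : R, 0 < del & forall k : C, norm1c k < del ->
    norm1c (h (k + z) - h z - d * k) <= eps * norm1c k.
Proof.
move=> /cvg_ex[/= d H0]; have H := iffLR (@cvgrPdist_le C C C (0^') _ _ d) H0; exists d => eps e0.
have e1 : 0 < Complex (eps / 2) 0 by rewrite ltcE /= eqxx /= divr_gt0.
move/(_ _ _ e1): H; rewrite /dnbhs near_withinE => /nbhs_ballP[del /= d0 H].
have [dr [dE dr0]] : exists r : R, del = Complex r 0 /\ 0 < r.
  by case: del d0 {H} => x y; rewrite ltcE /= => /andP[/eqP -> ?]; exists x.
exists dr => // k kd.
have [->|k0] := eqVneq k 0; first by rewrite add0r subrr mulr0 subrr norm1c0 mulr0.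
have kin : `|k| < del.
  by rewrite dE; apply: le_lt_trans (norm_le_norm1c _) _; rewrite ltcR.
have := H k; rewrite -ball_normE /= sub0r normrN => /(_ kin k0).
rewrite (_ : k *: (1 : C) = k); last exact: mulr1.
rewrite -[k^-1 *: _]/(k^-1 * _) => hk.
have E : h (k + z) - h z - d * k = - (k * (d - k^-1 * (h (k + z) - h z))).
  by move: (h (k + z)) (h z) => x y; field.
rewrite E norm1cN.
have n1 := norm1c_le_norm (k * (d - k^-1 * (h (k + z) - h z))).
have n2 : 2 * `|k * (d - k^-1 * (h (k + z) - h z))| <= 2 * (`|k| * Complex (eps / 2) 0).
  by rewrite normrM; apply: ler_wpM2l => //; apply: ler_wpM2l.
have n3 : 2 * (`|k| * Complex (eps / 2) 0) <= 2 * (Complex (norm1c k) 0 * Complex (eps / 2) 0).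
  apply: ler_wpM2l => //; apply: ler_wpM2r; [exact: ltW|exact: norm_le_norm1c].
have := le_trans n1 (le_trans n2 n3).
have -> : 2 * (Complex (norm1c k) 0 * Complex (eps / 2) 0) = Complex (eps * norm1c k) 0 :> C.
  rewrite mulr_natl mulr2n -mulrDr CxD addr0 -splitr.
  by apply/eqP; rewrite eq_complex /= !mulr0 !mul0r subr0 addr0 mulrC !eqxx.
by rewrite lecR.
Qed.

Lemma cpartial_comp (h : C -> C) f q : derivable h (f q) 1 ->
  (forall i, derivable (re_part f) q (e_ i) /\ derivable (im_part f) q (e_ i)) ->
  exists d, forall i, cpartial i (fun x => h (f x)) q = d * cpartial i f q.
Proof.
move=> /complex_expansion[d H] df; exists d => i; apply: expansion_cpartial => eps e0.
have [dr di] := df i; have Ef := cpartial_expansion dr di.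
set w := cpartial i f q in Ef *.
pose M := norm1c w + 1 + norm1c d; have M0 : 0 < M.
  by rewrite ltr_wpDr ?norm1c_ge0// ltr_wpDl ?norm1c_ge0.
(* The bound eta <= 1 controls the increment of f by (|w| + 1) |t|; the errors of h and f then total
   at most eta M |t|. *)
pose eta := Num.min 1 (eps / M).
have eta0 : 0 < eta by rewrite lt_min ltr01 divr_gt0.
have [eta1 etaM] : eta <= 1 /\ eta * M <= eps.
  by rewrite -ler_pdivlMr// !ge_min !lexx orbT.
have [d1 d10 H1] := H _ eta0; have [d2 d20 H2] := Ef _ eta0.
have N0 : 0 < norm1c w + 1 by rewrite ltr_wpDl ?norm1c_ge0.
exists (Num.min d2 (d1 / (norm1c w + 1))); first by rewrite lt_min d20 divr_gt0.
move=> t; rewrite lt_min => /andP[t2 t1].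
have h2 := H2 t t2; set k := f (t *: e_ i + q) - f q in h2.
have kb : norm1c k <= (norm1c w + 1) * `|t|.
  rewrite -(subrK (Complex t 0 * w) k); apply: le_trans (norm1cD _ _) _.
  have := norm1cM (Complex t 0) w; rewrite norm1c_real => h3.
  apply: le_trans (lerD h2 h3) _; rewrite mulrDl mul1r addrC [norm1c w * _]mulrC lerD2l.
  by rewrite -[leRHS]mul1r ler_wpM2r.
have kd : norm1c k < d1.
  by apply: le_lt_trans kb _; rewrite mulrC -ltr_pdivlMr.
have h1 := H1 k kd; rewrite subrK in h1.
have -> : h (f (t *: e_ i + q)) - h (f q) - Complex t 0 * (d * w) =
   (h (f (t *: e_ i + q)) - h (f q) - d * k) + d * (k - Complex t 0 * w) by ring.
apply: le_trans (norm1cD _ _) _.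
apply: le_trans (lerD h1 (norm1cM _ _)) _.
have h4 := ler_wpM2l (norm1c_ge0 d) h2.
have h5 := ler_wpM2l (ltW eta0) kb.
have h6 := ler_wpM2r (normr_ge0 t) etaM.
apply: le_trans (lerD h5 h4) _; apply: le_trans h6.
by rewrite /M le_eqVlt; apply/orP; left; apply/eqP; ring.
Qed.

End ChainRule.

(** * Behaviour of the obstruction under a change of chart *)

Section ChartIndependence.
Variable R : realType.
Local Notation V := (M4 R).
Local Notation C := (Cx R).
Local Notation e_ := (@basis4 R).
Implicit Types (f g h : V -> C) (O : set V) (i j : 'I_4) (b k : bool).

(** The derivatives of the factor h cancel in the Wronskian, which scales by h^2; the gradient
    contributes the third factor. *)
Lemma obstruction_scale O f g h b k i j p : open O -> O p -> csmooth O f -> csmooth O g ->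
  csmooth O h -> (forall x, O x -> forall i, cpartial i g x = h x * cpartial i f x) ->
  obstruction b k i j g p = h p ^+ 3 * obstruction b k i j f p.
Proof.
move=> oO Op sf sg sh gf.
have lin (t eps : C) (y : 'I_4 -> C) : lA eps k (fun m => t * y m) = t * lA eps k y /\
    lB eps k (fun m => t * y m) = t * lB eps k y.
  by rewrite /lA /lB; move: (y i0) (y i1) (y i2) (y i3) => y0 y1 y2 y3; split; case: (k); ring.
have gE x : O x -> grad g x = fun m => h x * grad f x m.
  by move=> Ox; apply/funext => m; exact: gf.
have nE x : O x -> numer b k g x = h x * numer b k f x.
  move=> Ox; exact: (etrans (congr1 (lA _ k) (gE x Ox)) (lin _ _ _).1).
have dE x : O x -> denom b k g x = h x * denom b k f x.
  move=> Ox; exact: (etrans (congr1 (lB _ k) (gE x Ox)) (lin _ _ _).2).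
have sn := csmooth_numer b k oO sf; have sd := csmooth_denom b k oO sf.
have pn i' : cpartial i' (numer b k g) p =
    cpartial i' h p * numer b k f p + h p * cpartial i' (numer b k f) p.
  exact: etrans (cpartial_ext i' oO nE Op) (cpartialM i' sh sn Op).
have pd i' : cpartial i' (denom b k g) p =
    cpartial i' h p * denom b k f p + h p * cpartial i' (denom b k f) p.
  exact: etrans (cpartial_ext i' oO dE Op) (cpartialM i' sh sd Op).
have w i' : wronskian g (numer b k g) (denom b k g) i' p =
    h p ^+ 2 * wronskian f (numer b k f) (denom b k f) i' p.
  have alg (a n d a' n' d' : C) : a * d * (a' * n + a * n') - a * n * (a' * d + a * d') =
     a ^+ 2 * (d * n' - n * d') by ring.
  apply: etrans (alg _ _ _ (cpartial i' h p) _ _).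
  exact: (f_equal2 (fun x y => x - y) (f_equal2 *%R (dE p Op) (pn i'))
                                      (f_equal2 *%R (nE p Op) (pd i'))).
have alg (a u v c d : C) : a ^+ 2 * u * (a * c) - a ^+ 2 * v * (a * d) =
   a ^+ 3 * (u * c - v * d) by ring.
apply: etrans (alg _ _ _ _ _).
exact: (f_equal2 (fun x y => x - y) (f_equal2 *%R (w i) (gf p Op j))
                                    (f_equal2 *%R (w j) (gf p Op i))).
Qed.

(** The factor t is only given pointwise; near p it equals d_e g / d_e f, which is smooth, and
    [obstruction_scale] applies. *)
Lemma unobstructed_change O f g b p : open O -> O p -> csmooth O f -> csmooth O g ->
  (exists i, cpartial i f p != 0) ->
  (forall x, O x -> exists t, forall i, cpartial i g x = t * cpartial i f x) ->
  unobstructed b f p -> unobstructed b g p.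
Proof.
move=> oO Op sf sg [e fe0] gf uf k i j.
have se := csmooth_partial e sf; have sge := csmooth_partial e sg.
have [r r0 rO] := open_cube oO Op.
have [r' [beta [r'0 r'r _ H]]] := shrink_neq0 r0 (csmooth_sub rO se) fe0.
have sub : cube p r' `<=` O by apply: subset_trans rO; exact: cube_sub.
have oC := @cube_open R p r'.
have nz q : cube p r' q -> cpartial e f q != 0 by move=> /H[].
have sh := csmoothM oC (csmooth_sub sub sge) (csmoothV oC nz (csmooth_sub sub se)).
have E x : cube p r' x -> forall i,
    cpartial i g x = cpartial e g x * (cpartial e f x)^-1 * cpartial i f x.
  move=> xr i'; have [t Ht] := gf x (sub x xr).
  have alg (y z : C) : y != 0 -> t * z = t * y * y^-1 * z by move=> y0; rewrite mulfK.
  apply: etrans (Ht i') _; apply: etrans (alg _ _ (nz x xr)) _.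
  exact: (congr1 (fun z => z * _ * _) (esym (Ht e))).
have := obstruction_scale b k i j oC (cube_center p r'0) (csmooth_sub sub sf)
  (csmooth_sub sub sg) sh E.
move=> h; apply: etrans h _.
exact: (etrans (congr1 (fun z => _ * z) (uf k i j)) (mulr0 _)).
Qed.

End ChartIndependence.

(** * Lipschitz estimates, connectedness arguments and the sphere *)

Section Preliminaries.
Variable R : realType.
Local Notation V := (M4 R).
Local Notation C := (Cx R).
Implicit Types (p q : V) (b inf : bool).

Definition finite_or_inv inf (w : C) : sphere R := if inf then sphere_inv w else Some w.

Lemma line_continuous p (v : V) : continuous (fun s : R => p + s *: v).
Proof.
by move=> s; apply: cvgD; [exact: cvg_cst|exact: scalel_continuous].
Qed.

(** The squared chordal distance is 4 |u-v|^2 / ((1+|u|^2)(1+|v|^2)). *)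
Lemma sigma_lipschitz (u v : C) (j : 'I_3) :
  `|sigma u 0 j - sigma v 0 j| <= 2 * norm1c (u - v).
Proof.
suff H : dot (sigma u - sigma v) (sigma u - sigma v) <= (2 * norm1c (u - v)) ^+ 2.
  have n0 : 0 <= 2 * norm1c (u - v) by rewrite mulr_ge0 ?norm1c_ge0.
  rewrite -(ger0_norm n0) -ler_sqr ?nnegrE// !real_normK ?num_real//; apply: le_trans H.
  rewrite /dot (bigD1 j)//= !mxE -expr2 lerDl sumr_ge0// => i _.
  by rewrite -expr2 sqr_ge0.
have E (x y : 'rV[R]_3) i : (x - y) 0 i = x 0 i - y 0 i by rewrite !mxE.
case: u v => a b [c d]; rewrite /dot sum3E !E !sigmaE !mk3_lift /norm1c !raddfB /=.
have [n1 n2] : 1 <= 1 + (a ^+ 2 + b ^+ 2) /\ 1 <= 1 + (c ^+ 2 + d ^+ 2).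
  by rewrite !lerDl !addr_ge0 ?sqr_ge0.
have [m1 m2] := (one_nsq a b, one_nsq c d).
have -> : ((1 - (a ^+ 2 + b ^+ 2)) / (1 + (a ^+ 2 + b ^+ 2)) - (1 - (c ^+ 2 + d ^+ 2)) / (1 + (c ^+ 2 + d ^+ 2))) *
  ((1 - (a ^+ 2 + b ^+ 2)) / (1 + (a ^+ 2 + b ^+ 2)) - (1 - (c ^+ 2 + d ^+ 2)) / (1 + (c ^+ 2 + d ^+ 2))) +
  (2 * a / (1 + (a ^+ 2 + b ^+ 2)) - 2 * c / (1 + (c ^+ 2 + d ^+ 2))) *
  (2 * a / (1 + (a ^+ 2 + b ^+ 2)) - 2 * c / (1 + (c ^+ 2 + d ^+ 2))) +
  (2 * b / (1 + (a ^+ 2 + b ^+ 2)) - 2 * d / (1 + (c ^+ 2 + d ^+ 2))) *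
  (2 * b / (1 + (a ^+ 2 + b ^+ 2)) - 2 * d / (1 + (c ^+ 2 + d ^+ 2))) =
  4 * ((a - c) ^+ 2 + (b - d) ^+ 2) / ((1 + (a ^+ 2 + b ^+ 2)) * (1 + (c ^+ 2 + d ^+ 2))).
  by field; rewrite m1 m2.
rewrite ler_pdivrMr; last by rewrite mulr_gt0// (lt_le_trans ltr01).
have k1 : 1 <= (1 + (a ^+ 2 + b ^+ 2)) * (1 + (c ^+ 2 + d ^+ 2)) by exact: mulr_ege1.
apply: le_trans (ler_wpM2l _ k1); last by rewrite sqr_ge0.
rewrite mulr1 exprMn -(real_normK (num_real (a - c))) -(real_normK (num_real (b - d))).
rewrite (_ : 2 ^+ 2 = 4); last by rewrite expr2 -natrM.
rewrite ler_pM2l// sqrrD lerD2r lerDl mulrn_wge0// mulr_ge0//.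
Qed.

Lemma sigma_inv_lipschitz inf (u v : C) (j : 'I_3) :
  `|sigma_inv (finite_or_inv inf u) 0 j - sigma_inv (finite_or_inv inf v) 0 j| <= 2 * norm1c (u - v).
Proof.
case: inf => /=; last exact: sigma_lipschitz.
rewrite !sigma_sphere_inv; apply: le_trans (sigma_lipschitz u v j).
suff [s ss E] : exists2 s : R, `|s| = 1 & forall x : 'rV[R]_3, reflect13 x 0 j = s * x 0 j.
  by rewrite !E -mulrBr normrM ss mul1r.
exists (if j == lift ord0 ord0 then 1 else -1); first by case: ifP; rewrite ?normrN normr1.
move=> x; rewrite mxE; case: j => -[|[|[|//]]] i /=; rewrite ?mulN1r ?mul1r; do ?congr (- _);
  by congr (x _ _); exact: val_inj.
Qed.

Lemma norm1c_cjB b (u v : C) : norm1c (cj b u - cj b v) = norm1c (u - v).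
Proof.
case: b => //; case: u v => x y [z w]; rewrite /norm1c !raddfB /=.
by rewrite -opprD normrN.
Qed.

Lemma derivable_lipschitz (h : C -> C) (z : C) : derivable h z 1 ->
  exists K del : R, [/\ 0 <= K, 0 < del &
    forall y : C, norm1c (y - z) < del -> norm1c (h y - h z) <= K * norm1c (y - z)].
Proof.
move=> /complex_expansion[d /(_ 1 ltr01)[del del0 H]].
exists (1 + norm1c d), del; split=> //; first by rewrite addr_ge0 ?norm1c_ge0.
move=> y /H; rewrite subrK mul1r => h1.
rewrite -(subrK (d * (y - z)) (h y - h z)); apply: le_trans (norm1cD _ _) _.
by rewrite mulrDl mul1r lerD// norm1cM.
Qed.

Lemma cdirB (Y Z : V) (f : V -> C) q : cdir (Y - Z) f q = cdir Y f q - cdir Z f q.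
Proof.
rewrite /cdir -sumrB; apply: eq_bigr => i _.
by rewrite !mxE -mulrBl CxN CxD oppr0 addr0.
Qed.

Lemma cdir_norm (Y : V) (f : V -> C) q (F M : R) : 0 <= F ->
  (forall i, norm1c (cpartial i f q) <= F) -> (forall i, `|Y 0 i| <= M) ->
  norm1c (cdir Y f q) <= 4 * (M * F).
Proof.
move=> F0 hF hM; rewrite /cdir; apply: le_trans (norm1c_sum _ _) _.
apply: (@le_trans _ _ (\sum_(i < 4) M * F)); last by rewrite sumr_const card_ord mulr_natl.
apply: ler_sum => i _; apply: le_trans (norm1cM _ _) _; rewrite norm1c_real.
by apply: ler_pM => //; exact: norm1c_ge0.
Qed.

Lemma tangent_fieldB (U : V -> 'rV[R]_3) p q i (M : R) : (forall j, `|U p 0 j - U q 0 j| <= M) ->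
  `|(tangent_field U p - tangent_field U q) 0 i| <= M :> R.
Proof.
move=> H; rewrite !mxE; case: (unlift 0 i) => [j|]; first exact: H.
by rewrite subrr normr0; apply: le_trans (H ord0).
Qed.

Lemma component_open_real (T : set R) s : (forall t, T t -> nbhs t T) ->
  open (connected_component T s).
Proof.
move=> oT; rewrite openE => t ct; have Tt := connected_component_sub ct.
have /nbhs_ballP[e /= e0 He] := oT t Tt; apply/nbhs_ballP; exists e => //.
apply: subset_trans (_ : connected_component T t `<=` _).
  apply: connected_component_max => //; first exact: ballxx.
  apply/connected_intervalP => x y; rewrite -!ball_normE /= => hx hy z /andP[xz zy].
  move: hx hy; rewrite !ltr_norml => /andP[a1 a2] /andP[b1 b2].
  by apply/andP; split; lra.
by rewrite (same_connected_component ct).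
Qed.

(** An open and closed argument; the last premise is closedness of P relative to I, in a form that
    suits uniqueness of limits in a Hausdorff space. *)
Lemma connected_ind (T : topologicalType) (I : set T) (P : T -> Prop) s0 :
  connected I -> I s0 -> P s0 ->
  (forall s, I s -> P s -> \forall t \near s, I t -> P t) ->
  (forall s, I s -> (forall B, nbhs s B -> exists t, [/\ B t, I t & P t]) -> P s) ->
  forall s, I s -> P s.
Proof.
move=> cI I0 P0 oP cP; have E : I `&` P = I.
  apply: cI; first by exists s0.
    exists ([set t | I t -> P t]^°); first exact: open_interior.
    apply/seteqP; split=> s [Is Ps]; split=> //; first exact: oP.
    exact: (interior_subset Ps Is).
  exists (closure (I `&` P)); first exact: closed_closure.
  apply/seteqP; split=> s [Is Ps]; split=> //; first by apply: subset_closure.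
  by apply: cP => // B /Ps[t [[It Pt] Bt]]; exists t.
by move=> s; rewrite -{1}E => -[].
Qed.

Lemma connected_locally_constant (T : topologicalType) (Y : Type) (I : set T) (g : T -> Y) s0 :
  connected I -> I s0 -> (forall s, I s -> \forall t \near s, I t -> g t = g s) ->
  forall s, I s -> g s = g s0.
Proof.
move=> cI I0 H; apply: (connected_ind cI I0) => // s Is.
  by move=> Ps; apply: filterS (H s Is) => t h /h ->.
move=> /(_ _ (H s Is))[t [h It Pt]].
by rewrite -Pt h.
Qed.

(** This factor undoes the multiplication by i in [represents]; in the chart 1/u the inversion
    changes i into -i, hence the two signs. *)
Definition turn inf : C := if inf then 'i else - 'i.

Lemma turnK inf (u : C) :
  omap (fun z : C => 'i * z) (finite_or_inv inf (turn inf * u)) = finite_or_inv inf u.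
Proof.
case: inf => /=; last by rewrite mulrA mulrN -expr2 sqrCi opprK mul1r.
rewrite /sphere_inv mulf_eq0 (negPf (neq0Ci _)) /=; case: eqP => //= _.
by rewrite invfM mulrA divff ?mul1r ?neq0Ci.
Qed.

Lemma sphere_conj_finite_or_inv inf (z : C) :
  sphere_conj (finite_or_inv inf z) = finite_or_inv inf (cj true z).
Proof.
case: inf => //; rewrite /finite_or_inv /sphere_inv cj_eq0; case: eqP => // _.
exact: (congr1 Some (cjV true z)).
Qed.

Lemma cjK b (z : C) : cj b (cj b z) = z.
Proof. by case: b z => -[x y] //=; rewrite /cj /= opprK. Qed.

Lemma open_norm1c_ball (w : C) (rad : R) : open [set z : C | norm1c (z - w) < rad].
Proof.
rewrite openE => z /= zw; have e0 : 0 < rad - norm1c (z - w) by rewrite subr_gt0.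
apply/nbhs_ballP; exists (Complex ((rad - norm1c (z - w)) / 2) 0).
  by rewrite /= ltcE /= eqxx divr_gt0.
move=> y; rewrite -ball_normE /= distrC => yz.
have h : 2 * `|y - z| < Complex (rad - norm1c (z - w)) 0.
  rewrite (_ : Complex _ 0 = 2 * Complex ((rad - norm1c (z - w)) / 2) 0 :> C).
    by rewrite ltr_pM2l.
  by rewrite mulr_natl mulr2n CxD addr0 -splitr.
have := le_lt_trans (norm1c_le_norm _) h; rewrite ltcR => h2.
rewrite -(subrK z y) -addrA; apply: le_lt_trans (norm1cD _ _) _.
by rewrite -ltrBrDr.
Qed.

Lemma derivable_comp (h k : C -> C) (z : C) : derivable h z 1 -> derivable k (h z) 1 ->
  derivable (fun x => k (h x)) z 1.
Proof.
move=> /derivable1_diffP dh /derivable1_diffP dk.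
apply: (iffRL (derivable1_diffP (k \o h) z)).
exact: (@differentiable_comp C C C C h k z dh dk).
Qed.

End Preliminaries.

(** * The congruence of a harmonic morphism and its holomorphic representation *)

Section Surface.
Variables (R : realType) (N : riemann_surface R) (A : set (M4 R)) (phi : M4 R -> N).
Variables (A_open : open A) (phi_analytic : real_analytic_map A phi)
  (phi_harmonic : harmonic_morphism A phi)
  (dphi_neq0 : forall p, A p -> ~ differential_zero_at phi p).
Local Notation V := (M4 R).
Local Notation C := (Cx R).
Implicit Types (c d : chart R N) (p q : V) (b inf : bool).

Local Notation dom c := (coord_dom A c phi).
Local Notation crd c := (in_coord c phi).

Lemma phi_continuous p : A p -> {for p, continuous phi}.
Proof. by case: phi_analytic => + _; exact. Qed.

Lemma coord_dom_open c : rs_atlas c -> open (dom c).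
Proof.
move=> /rs_is_chart[oc _ _]; rewrite openE => p [Ap cp]; apply: filterI.
  by apply: open_nbhs_nbhs; split.
by apply: (phi_continuous Ap); apply: open_nbhs_nbhs; split.
Qed.

Lemma coord_csmooth c : rs_atlas c -> csmooth (dom c) (crd c).
Proof. by move=> ac; have [[_ /(_ c ac)]] := phi_harmonic. Qed.

Lemma coord_null_wave c : rs_atlas c -> null_wave (dom c) (crd c).
Proof.
move=> ac; have [_ /(_ c ac) H] := phi_harmonic; split; first exact: coord_csmooth.
  move=> p /H[_ g0]; rewrite -[RHS]g0 /grad_square big_ord_recl; congr (_ + _).
    by rewrite /msign eqxx mulN1r.
  by apply: eq_bigr => j _; rewrite /msign /= mul1r.
move=> p /H[w0 _]; rewrite -[RHS]w0 /wave_operator big_ord_recl; congr (_ + _).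
  by rewrite /msign eqxx mulN1r.
by apply: eq_bigr => j _; rewrite /msign /= mul1r.
Qed.

Lemma coord_change c d p : rs_atlas c -> rs_atlas d -> dom c p -> dom d p ->
  exists t, forall i, cpartial i (crd d) p = t * cpartial i (crd c) p.
Proof.
move=> ac ad cp dp; have [h [[_ dh] E]] := rs_compatible ac ad.
have oO := openI (coord_dom_open ac) (coord_dom_open ad).
have hp : derivable h (crd c p) 1.
  by apply: dh; exists (phi p) => //; split; [case: cp|case: dp].
have [t Ht] := cpartial_comp hp (fun i => csmooth_derivable i (coord_csmooth ac) cp).
exists t => i; apply: etrans (Ht i).
by apply: (@cpartial_ext R _ _ _ p i oO) => // q [[_ cq] [_ dq]]; exact: E.
Qed.

Lemma coord_grad_neq0 c p : rs_atlas c -> dom c p -> exists i, cpartial i (crd c) p != 0.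
Proof.
move=> ac cp; apply: contrapT => nz; apply: (dphi_neq0 cp.1) => d ad dp i.
have [t Ht] := coord_change ac ad cp (conj cp.1 dp).
apply: etrans (Ht i) _; have [E|E] := eqVneq (cpartial i (crd c) p) 0.
  exact: etrans (congr1 (fun z => t * z) E) (mulr0 _).
by exfalso; apply: nz; exists i.
Qed.

Lemma coord_unobstructed b c d p : rs_atlas c -> rs_atlas d -> dom c p -> dom d p ->
  unobstructed b (crd c) p -> unobstructed b (crd d) p.
Proof.
move=> ac ad cp dp.
apply: (@unobstructed_change R (dom c `&` dom d)) => //.
- by apply: openI; exact: coord_dom_open.
- by apply: csmooth_sub (coord_csmooth ac) => q [].
- by apply: csmooth_sub (coord_csmooth ad) => q [].
- exact: coord_grad_neq0.
- by move=> q [cq dq]; exact: coord_change.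
Qed.

Definition frame c p (r : R) := [/\ rs_atlas c, 0 < r, cube p r `<=` dom c &
  jet_bounded (cube p r) (crd c)].

Lemma frame_exists p : A p -> exists c r, frame c p r.
Proof.
move=> Ap; have [c ac cp] := rs_cover (phi p).
have dp : dom c p by split.
have [_ /(_ c ac p dp)[ra ia]] := phi_analytic.
have [r [r0 sub ab]] := analytic_abound (coord_dom_open ac) dp (coord_csmooth ac) ra ia.
by exists c, r.
Qed.

(* Whether the representing function of phi is antiholomorphic. Holomorphy wins
   where both null plane fields vary only along the gradient. *)
Definition opposite_at p : bool := `[< ~ exists c, [/\ rs_atlas c, dom c p &
  \forall q \near p, unobstructed false (crd c) q] >].

(** Vanishing of the obstruction near q, in whatever chart, transfers to the chart of the frame and
    then spreads to the whole cube by the identity theorem. So [opposite_at] is constant on a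
    frame. *)
Lemma frame_opp c p r q : frame c p r -> cube p r q ->
  opposite_at q = ~~ `[< forall x, cube p r x -> unobstructed false (crd c) x >].
Proof.
move=> [ac r0 sub jb] qr; rewrite /opposite_at asbool_neg; congr (~~ _).
have Cq : nbhs q (cube p r) by exact: open_nbhs_nbhs (conj (@cube_open R p r) qr).
apply/asbool_equiv_eq; split; last first.
  move=> H; exists c; split=> //; first exact: sub.
  by apply: filterS Cq => x; exact: H.
move=> [d [ad dq nu]].
apply: (unobstructed_cube jb qr).
have dn : nbhs q (dom d) by apply: open_nbhs_nbhs; split=> //; exact: coord_dom_open.
near=> x; apply: (@coord_unobstructed false d c) => //.
- by near: x.
- by apply: sub; near: x.
- by near: x.
Unshelve. all: by end_near. Qed.

Lemma frame_unobstructed c p r q : frame c p r -> cube p r q ->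
  unobstructed (opposite_at q) (crd c) q.
Proof.
move=> fr qr; rewrite (frame_opp fr qr); have [ac r0 sub jb] := fr.
case: asboolP => /= [H|H]; first exact: (H q qr).
have [sc nu wa] := coord_null_wave ac.
have nw : null_wave (cube p r) (crd c).
  by split=> [|x /sub|x /sub]; [exact: csmooth_sub sc|exact: nu|exact: wa].
case: (null_wave_cube jb nw (fun x xr => coord_grad_neq0 ac (sub x xr))) => K; last exact: (K q qr).
by exfalso; exact: (H K).
Qed.

Lemma frame_opp_cst c p r q : frame c p r -> cube p r q -> opposite_at q = opposite_at p.
Proof.
move=> fr qr; rewrite (frame_opp fr qr) (frame_opp fr (cube_center p _))//.
by case: fr.
Qed.

Definition ray_field p : 'rV[R]_3 :=
  let c := s2val (cid2 (rs_cover (phi p))) in gdir (opposite_at p) (grad (crd c) p).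

(** Another chart multiplies the gradient by a non-zero complex number, which [gdir] does not see;
    the arbitrary chart chosen in [ray_field] is therefore immaterial. *)
Lemma coord_field c p : rs_atlas c -> dom c p -> ray_field p = gdir (opposite_at p) (grad (crd c) p).
Proof.
move=> ac cp; rewrite /ray_field; case: (cid2 _) => d /= ad dp.
have dmp : dom d p by split=> //; case: cp.
have [t Ht] := coord_change ac ad cp dmp.
have -> : grad (crd d) p = fun i => t * grad (crd c) p i by apply/funext => i; exact: Ht.
apply: gdirZ; last exact: coord_grad_neq0.
apply/eqP => t0; have [i /eqP] := coord_grad_neq0 ad dmp; apply.
apply: etrans (Ht i) _; rewrite t0; exact: mul0r.
Qed.

Lemma frame_field c p r q : frame c p r -> cube p r q ->
  ray_field q = gdir (opposite_at p) (grad (crd c) q).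
Proof.
move=> fr qr; rewrite -(frame_opp_cst fr qr); have [ac _ sub _] := fr.
exact: coord_field (sub q qr).
Qed.

Lemma field_null c p : rs_atlas c -> dom c p -> null_vector (grad (crd c) p).
Proof. by move=> ac cp; have [_ + _] := coord_null_wave ac; exact. Qed.

Lemma field_unit p : A p -> dot (ray_field p) (ray_field p) = 1.
Proof.
move=> Ap; have [c ac cp] := rs_cover (phi p); rewrite (coord_field ac (conj Ap cp)).
by apply: gdir_unit; [exact: field_null|exact: coord_grad_neq0].
Qed.

Lemma Ck_local (W : normedModType R) n (F : V -> W) : 
  (forall p, A p -> exists2 O, O p & Ck n O F) -> Ck n A F.
Proof.
elim: n F => [|n IH] F H.
  by split=> // p /H[B Bp [cF _]]; exact: cF.
split=> [p /H[B Bp [cF _]]|i]; first exact: cF.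
split=> [p /H[B Bp [_ /(_ i)[dF _]]]|]; first exact: dF.
by apply: IH => p /H[B Bp [_ /(_ i)[_ ?]]]; exists B.
Qed.

Lemma field_smooth : smooth_on A ray_field.
Proof.
move=> n; apply: Ck_local => p Ap; have [c [r fr]] := frame_exists Ap.
have [ac r0 sub jb] := fr; exists (cube p r); first exact: cube_center.
have sm := gdir_smooth (opposite_at p) (@cube_open R p r) (csmooth_sub sub (coord_csmooth ac))
  (fun x xr => coord_grad_neq0 ac (sub x xr)).
by apply: Ck_ext (@cube_open R p r) _ (sm n) => q qr; rewrite (frame_field fr qr).
Qed.

Lemma field_shear_free : shear_free A ray_field.
Proof.
move=> p Ap X Xs; have [c [r fr]] := frame_exists Ap.
have [ac r0 sub jb] := fr; have pc := cube_center p r0.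
have [sc nu wa] := coord_null_wave ac.
apply: (@shear_free_point R (cube p r) (crd c) (opposite_at p)) => //.
- exact: cube_open.
- by split=> [|x /sub|x /sub]; [exact: csmooth_sub sc|exact: nu|exact: wa].
- by move=> x /sub; exact: coord_grad_neq0.
- exact: frame_unobstructed fr pc.
- by move=> x; exact: frame_field.
Qed.

Lemma frame_sub c p r r' : 0 < r' -> r' <= r -> frame c p r -> frame c p r'.
Proof.
move=> r'0 r'r [ac r0 sub jb]; have s := @cube_sub R p _ _ r'r; split=> //.
  exact: subset_trans s sub.
exact: jet_bounded_sub s jb.
Qed.

(** [inf] records which chart of the sphere is used: A/B or B/A, according to which of the two is
    non-zero at p, is a holomorphic function of the coordinate by [local_factor]. *)
Lemma local_representation p : A p -> exists c r rad inf (rho : C -> C), [/\ frame c p r,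
  forall z, norm1c (z - crd c p) < rad -> derivable rho z 1 &
  forall q, cube p r q -> norm1c (crd c q - crd c p) < rad /\
    ray_field q = sigma_inv (finite_or_inv inf (cj (opposite_at p) (rho (crd c q))))].
Proof.
move=> Ap; have [c [r fr]] := frame_exists Ap.
have [ac r0 sub jb] := fr; have pc := cube_center p r0.
have gp := coord_grad_neq0 ac (sub p pc).
have oC := @cube_open R p r.
have un q : cube p r q -> unobstructed (opposite_at p) (crd c) q.
  move=> qr; rewrite -(frame_opp_cst fr qr).
  exact: (frame_unobstructed fr qr).
have fE q : cube p r q -> ray_field q = gdir (opposite_at p) (grad (crd c) q).
  exact: (frame_field fr).
have nul q : cube p r q -> null_vector (grad (crd c) q).
  by move=> /sub qr; exact: (field_null ac qr).
set b := opposite_at p in un fE *.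
have w k i j q : cube p r q ->
   wronskian (crd c) (numer b k (crd c)) (denom b k (crd c)) i q * cpartial j (crd c) q =
   wronskian (crd c) (numer b k (crd c)) (denom b k (crd c)) j q * cpartial i (crd c) q.
  by move=> qr; apply: subr0_eq; exact: (un q qr k i j).
have [k nz] := pair_neq0 b gp.
have an i := abound_numer b k i oC jb; have ad i := abound_denom b k i oC jb.
case: nz => nz.
  have aN i : abound i (cube p r) (fun x => - numer b k (crd c) x) := aboundN oC (an i).
  have [|r' [rad [rho [r'0 r'r dr H]]]] := local_factor r0 jb gp an ad nz; first by move=> i j q; exact: w.
  exists c, r', rad, false, (fun z => - rho z); split; first exact: frame_sub fr.
    by move=> z /dr dz; exact: derivableN.
  move=> q qr'; have [h1 h2 h3] := H q qr'; split=> //.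
  have qr := cube_sub r'r qr'; rewrite (fE q qr) (gdir_sigma (nul q qr) h2) -h3.
  by [].
have [|r' [rad [rho [r'0 r'r dr H]]]] := local_factor r0 jb gp ad an nz.
  move=> i j q qr; have alg (x y g f : C) : x * y - g * f = - (g * f - x * y) by rewrite opprB.
  have sw m : wronskian (crd c) (denom b k (crd c)) (numer b k (crd c)) m q =
     - wronskian (crd c) (numer b k (crd c)) (denom b k (crd c)) m q := alg _ _ _ _.
  exact: (etrans (congr1 (fun z => z * _) (sw i)) (etrans (mulNr _ _) (etrans (congr1 -%R (w k i j q qr))
    (esym (etrans (congr1 (fun z => z * _) (sw j)) (mulNr _ _)))))).
exists c, r', rad, true, (fun z => - rho z); split; first exact: frame_sub fr.
  by move=> z /dr dz; exact: derivableN.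
move=> q qr'; have [h1 h2 h3] := H q qr'; split=> //.
have qr := cube_sub r'r qr'; rewrite (fE q qr) (gdir_sigma_inf (nul q qr) h2) /= sigma_sphere_inv -h3.
by [].
Qed.

Lemma frame_tangent c p r q : frame c p r -> cube p r q ->
  cdir (tangent_field ray_field q) (crd c) q = 0.
Proof.
move=> fr qr; have [ac r0 sub jb] := fr.
have nz := coord_grad_neq0 ac (sub q qr).
have := gdir_tangent (opposite_at p) (field_null ac (sub q qr)) nz.
rewrite -(frame_field fr qr) => T.
have cjD b (x y : C) : cj b (x + y) = cj b x + cj b y.
  by case: b; case: x y => x1 x2 [y1 y2] //=; rewrite /cj !CxD /= opprD.
have cjR b (t : R) (x : C) : Complex t 0 * cj b x = cj b (Complex t 0 * x).
  by rewrite cjM; congr (_ * _); case: b => //=; rewrite /cj /= oppr0.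
have E : cj (opposite_at p) (cdir (tangent_field ray_field q) (crd c) q) = 0.
  have cj0 b : cj b (0 : C) = 0 by apply/eqP; rewrite cj_eq0.
  rewrite -[RHS]T /cdir (big_morph _ (cjD _) (cj0 _)) big_ord_recl; congr (_ + _).
    by rewrite mxE unlift_none -cjR; exact: mul1r.
  by apply: eq_bigr => j _; rewrite mxE liftK -cjR.
by apply/eqP; rewrite -(cj_eq0 (opposite_at p)) E.
Qed.

(* The derivative of phi in the fixed direction w_p at a nearby point q is
   controlled by w_p - w_q, hence by phi q - phi p. *)
Lemma rate_bound p : A p -> exists c r rad inf (rho : C -> C) (K : R), [/\ frame c p r,
  0 <= K,
  forall q, cube p r q -> norm1c (crd c q - crd c p) < rad /\
    ray_field q = sigma_inv (finite_or_inv inf (cj (opposite_at p) (rho (crd c q)))) &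
  forall q, cube p r q -> norm1c (cdir (tangent_field ray_field p) (crd c) q) <=
    K * norm1c (crd c q - crd c p)].
Proof.
move=> Ap; have [c [r [rad [inf [rho [fr dr H]]]]]] := local_representation Ap.
have [ac r0 sub jb] := fr; have pc := cube_center p r0.
have z0 : norm1c (crd c p - crd c p) < rad by have [] := H p pc.
have [L [del [L0 del0 HL]]] := derivable_lipschitz (dr _ z0).
have sc := jet_bounded_csmooth jb.
pose F := \sum_i (norm1c (cpartial i (crd c) p) + 1).
have nF i : norm1c (cpartial i (crd c) p) + 1 <= F.
  rewrite /F (bigD1 i)//= lerDl; apply: sumr_ge0 => j _.
  by rewrite addr_ge0 ?norm1c_ge0.
have F0 : 0 <= F by apply: le_trans (nF ord0); rewrite addr_ge0 ?norm1c_ge0.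
have near1 : \forall q \near p, forall i, norm1c (cpartial i (crd c) q - cpartial i (crd c) p) < 1.
  exact: (@filter_forall _ _
    (fun i q => norm1c (cpartial i (crd c) q - cpartial i (crd c) p) < 1) _ (nbhs_filter p)
    (fun i => csmooth_near_norm (csmooth_partial i sc) pc ltr01)).
have near2 := csmooth_near_norm sc pc del0.
have [r' r'0 Hr'] : exists2 r' : R, 0 < r' & forall q, cube p r' q ->
    (forall i, norm1c (cpartial i (crd c) q - cpartial i (crd c) p) < 1) /\
    norm1c (crd c q - crd c p) < del.
  have /nbhs_ballP[r' /= r'0 Hr'] : nbhs p (fun q => (forall i, norm1c (cpartial i (crd c) q - cpartial i (crd c) p) < 1) /\
    norm1c (crd c q - crd c p) < del) by exact: filterI near1 near2.
  exists r' => // q qr'.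
  by apply: Hr'; rewrite -ball_normE /= distrC.
pose s := Num.min r r'; have s0 : 0 < s by rewrite lt_min r0.
have sr : s <= r by rewrite ge_min lexx.
have sr' : cube p s `<=` cube p r' by apply: cube_sub; rewrite ge_min lexx orbT.
exists c, s, rad, inf, rho, (4 * (2 * L * F)); split=> //.
- exact: frame_sub fr.
- by rewrite !mulr_ge0.
- by move=> q qs; apply: H; exact: cube_sub qs.
move=> q qs; have qr := cube_sub sr qs; have [h1 h2] := Hr' q (sr' q qs).
rewrite -[cdir _ _ _]subr0 -(frame_tangent fr qr) -cdirB.
have -> : 4 * (2 * L * F) * norm1c (crd c q - crd c p) =
   4 * (2 * (L * norm1c (crd c q - crd c p)) * F) by ring.
apply: cdir_norm => // i.
  apply: le_trans (nF i); rewrite -(subrK (cpartial i (crd c) p) (cpartial i (crd c) q)) addrC.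
  apply: le_trans (norm1cD _ _) _; rewrite lerD2l; exact: ltW.
apply: tangent_fieldB => j; have [_ ->] := H p pc; have [_ ->] := H q qr.
apply: le_trans (sigma_inv_lipschitz _ _ _ _) _; rewrite norm1c_cjB.
rewrite ler_pM2l// -norm1cN opprB; exact: HL.
Qed.

(** Along the line through p with the fixed direction w_p, [rate_bound] is a differential inequality
    that makes the coordinate of phi constant; U is a function of that coordinate. *)
Lemma leaf_local p : A p -> exists2 del : R, 0 < del & forall s : R, `|s| < del ->
  let q := p + s *: tangent_field ray_field p in
  [/\ A q, phi q = phi p & ray_field q = ray_field p].
Proof.
move=> Ap; have [c [r [rad [inf [rho [K [fr K0 H HK]]]]]]] := rate_bound Ap.
have [ac r0 sub jb] := fr; have pc := cube_center p r0; have sc := jet_bounded_csmooth jb.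
have oC := @cube_open R p r.
set w := tangent_field ray_field p in HK *.
have W0 : 0 < `|w| + 1 by rewrite ltr_wpDl.
have K1 : 0 < 4 * (K + 1) by rewrite mulr_gt0// ltr_wpDl.
exists (Num.min (r / (`|w| + 1)) (1 / (4 * (K + 1)))).
  by rewrite lt_min !divr_gt0.
move=> s0; rewrite lt_min => /andP[s0r s0K] q.
have inC (s : R) : `|s| <= `|s0| -> cube p r (p + s *: w).
  move=> ss; rewrite /cube /= addrC addKr normrZ.
  apply: le_lt_trans (_ : `|s| * (`|w| + 1) < r); first by rewrite ler_wpM2l// lerDl.
  by rewrite -ltr_pdivlMr//; exact: le_lt_trans s0r.
have sK (s : R) : `|s| <= `|s0| -> 2 * `|s| * K <= 2^-1.
  move=> ss; have := le_lt_trans ss s0K; rewrite ltr_pdivlMr// => h.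
  have a0 := normr_ge0 s; have h2 : `|s| * K <= `|s| * (K + 1) by rewrite ler_wpM2l// lerDl.
  by move: h h2; rewrite mulrCA; move: (`|s| * (K + 1)) => z; rewrite -mulrA; lra.
(* The Gronwall argument as an iteration: inserting a bound into the mean value theorem multiplies
   it by 2 |s| K <= 1/2, the 2 coming from the real and imaginary parts. *)
have claim n (s : R) : `|s| <= `|s0| ->
    norm1c (crd c (p + s *: w) - crd c p) <= rad * 2^-1 ^+ n.
  elim: n s => [|n IH] s ss; first by rewrite expr0 mulr1; have [/ltW] := H _ (inC s ss).
  have part (g : V -> R) (D : C -> R) : (forall x, `|D x| <= norm1c x) ->
      (forall x, cube p r x -> is_derive x w g (D (cdir w (crd c) x))) ->
      `|g (p + s *: w) - g p| <= `|s| * (K * (rad * 2^-1 ^+ n)).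
    move=> nD dg; have [|t ts ->] := @line_mvt R g p w s.
      by move=> t ts; case: (dg _ (inC t (le_trans ts ss))).
    have [_ ->] := dg _ (inC t (le_trans ts ss)); rewrite normrM ler_wpM2l//.
    apply: le_trans (nD _) _; apply: le_trans (HK _ (inC t (le_trans ts ss))) _.
    by rewrite ler_wpM2l//; apply: IH; exact: le_trans ts ss.
  have hr := part (re_part (crd c)) (@complex.Re R)
    (fun x => ler_wpDr (normr_ge0 _) (lexx _)) (fun x xr => (cdir_is_derive w oC sc xr).1).
  have hi := part (im_part (crd c)) (@complex.Im R)
    (fun x => ler_wpDl (normr_ge0 _) (lexx _)) (fun x xr => (cdir_is_derive w oC sc xr).2).
  have rad0 : 0 <= rad * 2^-1 ^+ n.
    by apply: le_trans (IH s ss); exact: norm1c_ge0.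
  rewrite exprS mulrCA /norm1c !raddfB; apply: le_trans (lerD hr hi) _.
  rewrite -mulr2n -[leLHS]mulr_natl; have := ler_wpM2r rad0 (sK s ss).
  by rewrite -!mulrA.
have qc := inC s0 (lexx _); have [_ qA] := sub _ qc; have Aq := (sub _ qc).1.
have fq : crd c q = crd c p.
  apply/eqP; rewrite -subr_eq0 -norm1c_eq0 eq_le norm1c_ge0 andbT.
  by apply: (@le0_of_geometric _ _ rad) => n; exact: claim.
split; first exact: Aq.
  have [_ inj _] := rs_is_chart ac; apply: inj => //; rewrite inE//.
  by have [] := sub p pc.
by have [_ ->] := H q qc; have [_ ->] := H p pc; rewrite fq.
Qed.

Lemma ray_field_continuous p : A p -> {for p, continuous ray_field}.
Proof.
by have [cF _] := field_smooth 0%N; exact: cF.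
Qed.

Definition leaf_domain p : set R := [set s | A (p + s *: tangent_field ray_field p)].

Definition leaf p : set V :=
  [set p + s *: tangent_field ray_field p | s in connected_component (leaf_domain p) 0].

Lemma leaf_domain0 p : A p -> leaf_domain p 0.
Proof. by rewrite /leaf_domain /= scale0r addr0. Qed.

Lemma leaf_domain_near p s : leaf_domain p s -> \forall t \near s, leaf_domain p t.
Proof.
move=> Ts; have n : nbhs (p + s *: tangent_field ray_field p) A.
  by apply: open_nbhs_nbhs; split.
exact: (@line_continuous R p (tangent_field ray_field p) s _ n).
Qed.

(** The set where phi and U keep their values is open by [leaf_local], applied at a point where the
    direction is still that of p, and closed because both target spaces are Hausdorff. *)
Lemma leaf_constant p s : A p -> connected_component (leaf_domain p) 0 s ->
  let q := p + s *: tangent_field ray_field p in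
  phi q = phi p /\ ray_field q = ray_field p.
Proof.
move=> Ap; set w := tangent_field ray_field p.
have cI := @component_connected _ (leaf_domain p) 0.
have sI := @connected_component_sub _ (leaf_domain p) 0.
pose P (t : R) := phi (p + t *: w) = phi p /\ ray_field (p + t *: w) = ray_field p.
move: s; apply: (connected_ind (P := P) cI).
- exact/connected_component_refl/leaf_domain0.
- by rewrite /P scale0r addr0.
- move=> s Is [E1 E2]; have As : A (p + s *: w) := sI s Is.
  have [del del0 H] := leaf_local As.
  apply/nbhs_ballP; exists del; first exact: del0.
  move=> t; rewrite -ball_normE => st _; rewrite /ball_ /= in st.
  have wE : tangent_field ray_field (p + s *: w) = w by rewrite /w /tangent_field E2.
  have := H (t - s); rewrite distrC wE -addrA -scalerDl subrKC => /(_ st)[_ h1 h2].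
  by split; [rewrite h1|rewrite h2].
move=> s Is H; have As : A (p + s *: w) := sI s Is.
have lc := @line_continuous R p w s; split.
  apply: (@rs_hausdorff R N) => B1 B2 n1 n2.
  have /H[t [b1 _ [e1 _]]] : nbhs s (fun t => B1 (phi (p + t *: w))).
    exact: (lc _ (phi_continuous As n1)).
  by exists (phi p); split; [rewrite -e1|exact: nbhs_singleton].
apply: (@norm_hausdorff R) => B1 B2 n1 n2.
have /H[t [b1 _ [_ e2]]] : nbhs s (fun t => B1 (ray_field (p + t *: w))).
  exact: (lc _ (ray_field_continuous As n1)).
by exists (ray_field p); split; [rewrite -e2|exact: nbhs_singleton].
Qed.

Lemma leaf_sub p : leaf p `<=` A.
Proof. by move=> _ [s /connected_component_sub + <-]. Qed.

Lemma leaf_refl p : A p -> leaf p p.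
Proof.
move=> Ap; exists 0; last by rewrite scale0r addr0.
by apply: connected_component_refl; exact: leaf_domain0.
Qed.

Lemma leaf_null p : A p -> null_line_piece (leaf p).
Proof.
move=> Ap; exists p, (tangent_field ray_field p), (connected_component (leaf_domain p) 0).
split=> //.
- split.
    apply/eqP => /rowP/(_ 0); rewrite !mxE unlift_none => /eqP; exact/negP/oner_neq0.
  by rewrite /Defs.minkowski time_part_mkM4 space_part_mkM4 mulr1 field_unit// addNr.
- by apply: component_open_real => t; exact: leaf_domain_near.
- exact: component_connected.
- by exists 0; apply: connected_component_refl; exact: leaf_domain0.
Qed.

(** The component translated by -s is connected, contains 0 and t, and lies in the leaf domain of
    the new base point, whose direction is the same. *)
Lemma leaf_shift p s t : A p -> connected_component (leaf_domain p) 0 s ->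
  connected_component (leaf_domain p) 0 (s + t) ->
  connected_component (leaf_domain (p + s *: tangent_field ray_field p)) 0 t.
Proof.
move=> Ap Is Ist; have [_ E] := leaf_constant Ap Is.
set I := connected_component _ 0 in Is Ist.
have: [set x - s | x in I] t by exists (s + t); rewrite // addrAC subrr add0r.
apply: connected_component_max.
- by exists s; rewrite ?subrr.
- move=> _ [x /connected_component_sub Ix <-]; rewrite /leaf_domain /= /tangent_field E.
  by rewrite -addrA -scalerDl subrKC.
apply: connected_continuous_connected; first exact: component_connected.
apply: continuous_subspaceT => x; apply: cvgB; [exact: cvg_id|exact: cvg_cst].
Qed.

Lemma leaf_eq p q : A p -> leaf p q -> leaf q = leaf p.
Proof.
move=> Ap [s Is <-]; set w := tangent_field ray_field p; set q' := p + s *: w.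
have [_ E] := leaf_constant Ap Is.
have wE : tangent_field ray_field q' = w by rewrite /w /tangent_field E.
have Aq : A q' := connected_component_sub Is.
have I0 : connected_component (leaf_domain p) 0 0 by apply: connected_component_refl; exact: leaf_domain0.
have Iq : connected_component (leaf_domain q') 0 (- s).
  by apply: (leaf_shift Ap Is); rewrite subrr.
have pE : q' + (- s) *: w = p by rewrite -addrA -scalerDl subrr scale0r addr0.
rewrite /leaf wE; apply/seteqP; split=> _ [t It <-].
  exists (s + t); last by rewrite scalerDl addrA.
  have := @leaf_shift q' (- s) (s + t) Aq Iq; rewrite wE pE; apply.
  by rewrite addKr.
exists (t - s); last by rewrite -addrA -scalerDl subrKC.
by apply: (leaf_shift Ap Is); rewrite subrKC.
Qed.

Lemma leaf_line l p q : A q -> l = leaf q -> l p -> l `<=` line p (tangent_field ray_field p).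
Proof.
move=> Aq -> qp; rewrite -(leaf_eq Aq qp) => _ [s _ <-].
by exists s.
Qed.

Lemma congruence_partition p : A p ->
  exists! l, [set leaf q | q in A] l /\ l p.
Proof.
move=> Ap; exists (leaf p); split; first by split; [exists p|exact: leaf_refl].
by move=> _ [[q Aq <-] qp]; exact: leaf_eq.
Qed.

Definition congruence : shear_free_ray_congruence A.
Proof.
refine (@ShearFreeRayCongruence R A [set leaf q | q in A] ray_field _ _ _ _ _ _ _).
- by move=> _ [q Aq <-]; exact: leaf_null.
- by move=> _ [q Aq <-]; exact: leaf_sub.
- exact: congruence_partition.
- by move=> l p [q Aq <-] qp; exact: (leaf_line Aq erefl qp).
- exact: field_smooth.
- exact: field_unit.
- exact: field_shear_free.
Defined.

Lemma leaf_connected p : connected (leaf p).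
Proof.
apply: connected_continuous_connected; first exact: component_connected.
by apply: continuous_subspaceT; exact: line_continuous.
Qed.

Lemma ray_field_fibre p : A p -> \forall q \near p, phi q = phi p -> ray_field q = ray_field p.
Proof.
move=> Ap; have [c [r [rad [inf [rho [fr _ H]]]]]] := local_representation Ap.
have [_ r0 _ _] := fr; have [_ Ep] := H p (cube_center p r0).
apply: (open_nearP (@cube_open R p r) (cube_center p r0)) => q /H[_ Eq] E.
by rewrite Eq Ep /in_coord E.
Qed.

(** A leaf is connected and lies in one fibre, so it stays in the component that it meets. The
    direction is locally a function of phi, hence locally constant on F, and F is connected. *)
Lemma fibre_parallel F : fibre_component A phi F ->
  exists S : set (set V), [/\ S `<=` src_leaf congruence, F = \bigcup_(m in S) m & parallel S].
Proof.
move=> [p Ap FE]; pose G := A `&` phi @^-1` [set phi p].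
have FG : F `<=` G by rewrite FE; exact: connected_component_sub.
have Fp : F p by rewrite FE; exact: connected_component_refl.
have leafF q : F q -> leaf q `<=` F.
  move=> Fq; have [Aq Eq] := FG _ Fq.
  rewrite FE (@same_connected_component _ G p q) -?FE//.
  apply: connected_component_max; [exact: leaf_refl| |exact: leaf_connected].
  move=> _ [s Is <-]; have [E _] := leaf_constant Aq Is.
  by split; [exact: (connected_component_sub Is)|rewrite /= E].
have const q : F q -> ray_field q = ray_field p.
  apply: (connected_locally_constant (I := F)) => //; first by rewrite FE; exact: component_connected.
  move=> x Fx; have [Ax Ex] := FG _ Fx; apply: filterS (ray_field_fibre Ax) => y h Fy.
  by apply: h; have [_ ->] := FG _ Fy; rewrite Ex.
exists [set leaf q | q in F]; split.
- by move=> _ [q Fq <-]; exists q => //; have [] := FG _ Fq.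
- apply/seteqP; split=> [q Fq|q [_ [x Fx <-]]]; last exact: leafF.
  by exists (leaf q); [exists q|have [Aq _] := FG _ Fq; exact: leaf_refl].
exists (tangent_field ray_field p).
  by apply/eqP => /rowP/(_ 0); rewrite !mxE unlift_none => /eqP; exact/negP/oner_neq0.
move=> _ [q Fq <-] x qx; have [Aq _] := FG _ Fq.
by rewrite /tangent_field -(const x (leafF q Fq x qx)); exact: (leaf_line Aq erefl qx).
Qed.

Lemma opposite_component p q : A p -> connected_component A p q -> opposite_at q = opposite_at p.
Proof.
move=> Ap; move: q; apply: connected_locally_constant; first exact: component_connected.
  exact: connected_component_refl.
move=> s /connected_component_sub As; have [c [r fr]] := frame_exists As.
have [_ r0 _ _] := fr.
apply: (open_nearP (@cube_open R s r) (cube_center s r0)) => q qr _.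
exact: frame_opp_cst fr qr.
Qed.

Lemma holomorphic_chart_comp c (w : C) (rad : R) (h : C -> C) : rs_atlas c ->
  (forall z, norm1c (z - w) < rad -> derivable h z 1) ->
  holomorphic_fun (chart_dom c `&` chart_map c @^-1` [set z : C | norm1c (z - w) < rad])
    (fun y => h (chart_map c y)).
Proof.
move=> ac dh; set U := _ `&` _.
have [oc inj im] := rs_is_chart ac.
have oU : open U.
  apply/(im U); first by move=> y [].
  rewrite (_ : _ @` U = chart_map c @` chart_dom c `&` [set z : C | norm1c (z - w) < rad]).
    by apply: openI; [apply/im|exact: open_norm1c_ball].
  apply/seteqP; split=> [_ [y [cy wy] <-]|_ [[y cy <-] wy]]; last by exists y.
  by split => //; exists y.
split=> // d ad; have [k [[_ dk] E]] := rs_compatible ad ac.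
have [od _ imd] := rs_is_chart ad.
exists (fun z => h (k z)); split; last by move=> x dx [cx _]; rewrite (E x dx cx).
split; first by apply/imd; [move=> x []|exact: openI].
move=> _ [x [dx [cx wx]] <-]; apply: derivable_comp.
  by apply: dk; exists x.
by rewrite -(E x dx cx); exact: dh.
Qed.

Lemma congruence_representation p : A p ->
  exists (A1 : set V) (U : set N) (rho : N -> sphere R),
    [/\ open A1, A1 p, A1 `<=` A, phi @` A1 `<=` U &
        holomorphic_oriented (opposite_at p) U rho /\
        represents congruence A1 (fun q => rho (phi q))].
Proof.
move=> Ap; have [c [r [rad [inf [rho [fr dr H]]]]]] := local_representation Ap.
have [ac r0 sub _] := fr; set b := opposite_at p in H *.
(* Conjugating the factor in advance makes it [turn inf] once [cj b] is applied to [h], and [turnK]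
   then removes it; [h] itself stays holomorphic. *)
pose h (z : C) : C := cj b (turn R inf) * rho z.
have dh z : norm1c (z - crd c p) < rad -> derivable h z 1.
  by move=> /dr; exact: (@derivableZ C C C rho (cj b (turn R inf)) z 1).
have hol := holomorphic_chart_comp ac dh.
exists (cube p r), (chart_dom c `&` chart_map c @^-1` [set z : C | norm1c (z - crd c p) < rad]),
  (fun y => finite_or_inv inf (cj b (h (chart_map c y)))); split.
- exact: cube_open.
- exact: cube_center.
- by move=> q /sub[].
- by move=> _ [q qr <-]; split; [have [] := sub q qr|have [] := H q qr].
split.
  rewrite /holomorphic_oriented.
  rewrite (_ : (if b then _ else _) = fun y => finite_or_inv inf (h (chart_map c y))); last first.
    by case: b @h {dh hol H} => //=; apply/funext => y; rewrite sphere_conj_finite_or_inv cjK.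
  split; first by case: hol.
  move=> x Ux; exists (chart_dom c `&` chart_map c @^-1` [set z : C | norm1c (z - crd c p) < rad]).
  split=> //; first by case: hol.
  exists (fun y => h (chart_map c y)); split=> //.
  by case: (inf); [right|left].
move=> q qr; have [_ E] := H q qr.
by rewrite /= /h cjM cjK turnK.
Qed.

End Surface.

Theorem theoremS8p3 (R : realType) (N : riemann_surface R) (A : set (M4 R))
    (phi : M4 R -> N)
    (A_open : open A)
    (phi_analytic : real_analytic_map A phi)
    (phi_harmonic : harmonic_morphism A phi)
    (dphi_neq0 : forall p, A p -> ~ differential_zero_at phi p) :
  exists l : shear_free_ray_congruence A,
    (forall F, fibre_component A phi F ->
       exists S : set (set (M4 R)),
         [/\ S `<=` src_leaf l, F = \bigcup_(m in S) m & parallel S]) /\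
    exists opposite : M4 R -> bool,
      (forall p q, A p -> connected_component A p q ->
         opposite q = opposite p) /\
      forall p, A p ->
        exists (A1 : set (M4 R)) (V : set N) (rho : N -> sphere R),
          [/\ open A1, A1 p, A1 `<=` A, phi @` A1 `<=` V &
              holomorphic_oriented (opposite p) V rho /\
              represents l A1 (fun q => rho (phi q))].
Proof.
exists (congruence A_open phi_analytic phi_harmonic dphi_neq0); split.
  exact: fibre_parallel.
exists (opposite_at A phi); split; first exact: opposite_component.
exact: congruence_representation.
Qed.
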